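(* Let $X_i=\sum_{k=0}^{\infty}c_k\epsilon_{i-k}$, where $\{\epsilon_i,i\in\mathbb{Z}\}$ is an i.i.d. sequence and $\sum_{k=0}^\infty|c_k|<\infty$, and assume $X_1$ has continuous distribution function $F$ with density $f$ and quantile function $Q$. Assume that $\mathrm{E}|\epsilon_1|^\alpha<\infty$ for some $\alpha\ge 2$, that for some $\rho\in(0,\tfrac12)$ $$\sum_{k=i}^\infty c_k^2=O\bigl(i^{-2/\rho}(\log i)^{-3}\bigr)\qquad (i\to\infty),$$ and that $\epsilon_1$ has a density $f_\epsilon$ satisfying $$\sup_{x\in\mathbb{R}}\bigl(f_\epsilon(x)+|f_\epsilon'(x)|+|f_\epsilon''(x)|\bigr)<\infty .$$ Let $0\le a<b\le 1$ and assume that $\sup_{y\in(a,b)}|f'(Q(y))|<\infty$ and $\inf_{y\in(a,b)}f(Q(y))>0$. Then $$\sup_{y\in(a,b)}|f(Q(y))q_n(y)-\alpha_n(y)|=O_{a.s.}\bigl(n^{-1/4}(\log n)^{1/2}(\log\log n)^{1/4}\bigr).$$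
   Context: Given $X_1,\dots,X_n$, let $F_n(x)=\frac1n\sum_{i=1}^n 1_{\{X_i\le x\}}$ be the empirical distribution function and $Q_n$ the corresponding empirical quantile function, i.e. $Q_n(y)=X_{k:n}$ for $(k-1)/n<y\le k/n$, where $X_{1:n}\le\dots\le X_{n:n}$ are the order statistics. The general quantile process is $q_n(y)=n^{1/2}(Q(y)-Q_n(y))$, $y\in(0,1)$. With $U_i=F(X_i)$ and $E_n(x)=\frac1n\sum_{i=1}^n1_{\{U_i\le x\}}=F_n(Q(x))$, the uniform empirical process is $\alpha_n(x)=n^{1/2}(E_n(x)-x)$, $x\in(0,1)$. For random variables $Z_n$ and positive numbers $r_n$, $Z_n=O_{a.s.}(r_n)$ means $\limsup_{n\to\infty}|Z_n|/r_n<\infty$ almost surely. *)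

(* Defs.v *)
From HB Require Import structures.
From mathcomp Require Export all_boot all_order all_algebra.
From mathcomp Require Export all_classical all_reals all_analysis.
Export Order.TTheory GRing.Theory Num.Theory.
Export numFieldNormedType.Exports.

Set Implicit Arguments.
Unset Strict Implicit.
Unset Printing Implicit Defensive.

Local Open Scope classical_set_scope.
Local Open Scope ring_scope.

Section RandomVariables.
Context (d : measure_display) (T : measurableType d) (R : realType).
Variable P : probability T R.

Definition mutually_independent (I : choiceType) (Y : I -> {RV P >-> R}) :=
  forall (J : seq I) (B : I -> set R), uniq J ->
    (forall i, i \in J -> measurable (B i)) ->
    P (\bigcap_(i in [set` J]) (Y i @^-1` B i)) =
    (\prod_(i <- J) P (Y i @^-1` B i))%E.

Definition identically_distributed (I : choiceType) (Y : I -> {RV P >-> R}) :=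
  forall (i j : I) (B : set R), measurable B ->
    distribution P (Y i) B = distribution P (Y j) B.

Definition iid (I : choiceType) (Y : I -> {RV P >-> R}) :=
  mutually_independent Y /\ identically_distributed Y.

(* [f] is one fixed version of the density of [Y] w.r.t. Lebesgue measure. *)
Definition has_density (Y : {RV P >-> R}) (f : R -> R) :=
  [/\ measurable_fun [set: R] f, (forall x, 0 <= f x) &
      forall A : set R, measurable A ->
        distribution P Y A = (\int[lebesgue_measure]_(x in A) (f x)%:E)%E].

(* [Z n] may be a supremum over an uncountable index set, possibly infinite or
   not measurable: hence values in \bar R and no measurability requirement.
   The limsup ignores the finitely many [n] at which [r n] is not positive. *)
Definition O_as (Z : nat -> T -> \bar R) (r : nat -> R) :=
  {ae P, forall w,
    (limn_esup (fun n => `|Z n w| * ((r n)^-1)%:E) < +oo)%E}.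

End RandomVariables.

Section EmpiricalProcesses.
Context (R : realType).

(* Left-continuous generalized inverse, used for y in (0, 1) only. *)
Definition quantile (F : R -> R) (y : R) : R := inf [set x | y <= F x].

(* Samples are numbered from 1: only x 1, ..., x n are used. *)
Implicit Types (x : nat -> R) (n k : nat) (y : R).

Definition order_stat x n k : R :=
  nth 0 (sort <=%R [seq x i | i <- iota 1 n]) k.-1.

(* The ceiling of n * y is the k such that (k-1)/n < y <= k/n. *)
Definition emp_quantile x n y : R :=
  order_stat x n `|Num.ceil (n%:R * y)|%N.

Definition emp_dist x n y : R :=
  n%:R^-1 * \sum_(1 <= i < n.+1) (x i <= y)%R%:R.

Definition quantile_process (Q : R -> R) x n y : R :=
  Num.sqrt n%:R * (Q y - emp_quantile x n y).

Definition uniform_emp_process (F : R -> R) x n y : R :=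
  Num.sqrt n%:R * (emp_dist (F \o x) n y - y).

End EmpiricalProcesses.

(* Main.v *)
(* Let [c k0] be the first nonzero coefficient and [mu] the law of the innovations. For the
   indicator [phi] of a half-line or of an interval, average over the innovations one at a time:
   [phi_(k+1) y] is the [mu]-mean of [phi_k (y + c k * e)]. As [mu] has a bounded Lipschitz
   density, for [k > k0] both the size and the Lipschitz constant of [phi_k] are at most of the
   order of the length of the interval. Writing [Y i k] for the tail sum over [l >= k] of
   [c l * eps (i - l)], telescope
     [phi (X i) - phi_K (Y i K)] = sum over [k < K] of [phi_k (Y i k) - phi_(k+1) (Y i (k+1))];
   summed over [i] and regrouped by innovation this is a sum of martingale differences whose
   exponential moments are explicit, while [phi_K (Y i K) - E phi (X i)] is negligible by the
   decay of the coefficients. Taking [32^p <= n < 32^(p+1)], [K = 4^p] and union bounds over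
   grids, almost surely [n (F_n - F)] is of order [(n ln ln n)^(1/2)] on compact intervals, and
   its oscillation over intervals of length of order [(ln ln n / n)^(1/2)] is of order
   [(ln n)^(1/2) (n ln ln n)^(1/4)]. The empirical quantile is within [(ln ln n / n)^(1/2)] of
   [Q y], so the oscillation bound and a Taylor expansion of [F] at [Q y] give the theorem. *)

From HB Require Import structures.
Require Import Defs.
From mathcomp Require Import measurable_realfun zify ring lra.

Set Implicit Arguments.
Unset Strict Implicit.
Unset Printing Implicit Defensive.

Local Open Scope classical_set_scope.
Local Open Scope ring_scope.

(** * Past sigma-algebras *)

(** The number K of averaged lags is squeezed from two sides. One innovation enters up to K
    summands, so a martingale increment is only bounded by 1 + C K; with C of order 1 the
    exponential bound uses lam about p / n^(1/2), hence K must stay well below n^(1/2). The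
    remainder after K lags costs n times a tail sum of the |c k|, which must be below n^(1/2) too.
    As 2 / rho > 4, these tails are O(K^(-3/2)): K = 4^p gives 8^-p, hence a remainder of order 4^p
    against 32^(p/2). The variance escapes the factor K: only the lag k0 meets a discontinuous
    function, and its variance is of the order of the interval length; the other lags are bounded
    through C |c k|, which is summable. Conditional expectations are avoided by Fubini's theorem on
    the law of one innovation times the past. The sample size is just one more grid coordinate, so
    that union bounds replace a maximal inequality. A grid polynomial in 32^p costs a term of order
    p in the exponent, one polynomial in p only ln p: this is where ln ln n comes from. *)

Section Past.
Context (R : realType) (d : measure_display) (T : measurableType d)
  (P : probability T R) (eps : int -> {RV P >-> R}).

(** Cylinders over finitely many past innovations: they are stable under intersection, and mutual
    independence speaks of them directly. *)
Definition past_cylinder (j : int) : set (set T) :=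
  [set A | exists m (B : nat -> set R), [/\ forall l, measurable (B l),
     forall l, (m <= l)%N -> B l = setT &
     A = [set w | forall l : nat, B l (eps (j - l.+1%:Z) w)]]].

(* [T] with the sigma-algebra generated by the [eps i], [i < j]. *)
Definition past (j : int) := g_sigma_algebraType (past_cylinder j).
HB.instance Definition _ j := Measurable.on (past j).

Lemma past_cylinderI j : setI_closed (past_cylinder j).
Proof.
move=> _ _ [m [B [mB BT ->]]] [n [C [mC CT ->]]].
exists (maxn m n), (fun l => B l `&` C l); split.
- by move=> l; exact: measurableI.
- by move=> l; rewrite geq_max => /andP[ml nl]; rewrite BT// CT// setIT.
- by apply/seteqP; split => w /=; [move=> [h1 h2] l; split|move=> h; split => l; have [] := h l].
Qed.

Lemma past_measurable_eps (j i : int) : i < j ->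
  measurable_fun [set: past j] (eps i : past j -> R).
Proof.
move=> ij _ B mB; rewrite setTI.
apply: sub_sigma_algebra.
have [l ->] : exists l : nat, i = j - l.+1%:Z.
  exists (absz (j - i - 1)%R); rewrite -addn1 PoszD gez0_abs; last by lia.
  by lia.
exists l.+1, (fun l' => if l' == l then B else setT); split.
- by move=> l'; case: ifP.
- by move=> l' ll'; rewrite gtn_eqF.
- apply/seteqP; split => w /=.
    by move=> Bw l'; case: eqP => [->|].
  by move=> /(_ l); rewrite eqxx.
Qed.

Lemma past_sub (j : int) (A : set T) : <<s past_cylinder j >> A -> measurable A.
Proof.
move: A; apply: smallest_sub; first exact: sigma_algebra_measurable.
move=> _ [m [B [mB BT ->]]].
rewrite (_ : [set _ | _] = \bigcap_l (eps (j - l.+1%:Z) @^-1` B l)).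
  by apply: bigcapT_measurable => l; rewrite -[X in measurable X]setTI; exact: measurable_funPT.
by apply/seteqP; split => w /= h; [move=> l _; exact: h|move=> l; exact: (h l)].
Qed.

Lemma past_id_measurable j : measurable_fun [set: T] (idfun : T -> past j).
Proof. by move=> _ A mA; rewrite setTI; exact: past_sub mA. Qed.

(** The identity as a random element with values in [past j]: its distribution is the restriction of
    [P] to the past. *)
Definition to_past (j : int) : T -> past j := idfun.

HB.instance Definition _ j :=
  isMeasurableFun.Build _ _ _ _ (to_past j) (@past_id_measurable j).

Hypothesis heps : mutually_independent eps.

(** Dynkin's theorem: for a cylinder the claim is mutual independence with [j] added to the list of
    indices, and it passes to complements and to disjoint unions. *)
Lemma past_indep (j : int) (B : set R) (A : set T) : measurable B ->
  <<s past_cylinder j >> A ->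
  P (eps j @^-1` B `&` A) = (P (eps j @^-1` B) * P A)%E.
Proof.
move=> mB.
have mjB : measurable (eps j @^-1` B).
  by rewrite -[X in measurable X]setTI; exact: measurable_funPT.
apply: (@dynkin_induction _ (past j) (past_cylinder j)
  (fun A => P (eps j @^-1` B `&` A) = (P (eps j @^-1` B) * P A)%E)) => //.
- exact: past_cylinderI.
- by rewrite setIT probability_setT mule1.
- move=> _ [m [C [mC CT ->]]].
  pose J := [seq j - l.+1%:Z | l <- iota 0 m].
  (* The index [j - l.+1] is at distance [l.+1] from [j], whence the predecessor. *)
  pose D (i : int) := if i == j then B else C (absz (j - i)%R).-1.
  have DE l : D (j - l.+1%:Z) = C l.
    rewrite /D; case: eqP => [|_]; first by lia.
    by congr C; lia.
  have E1 : [set w | forall l : nat, C l (eps (j - l.+1%:Z) w)] =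
    \bigcap_(i in [set` J]) (eps i @^-1` D i).
    apply/seteqP; split => w /=.
      by move=> h i /= /mapP[l _ ->]; rewrite /= DE; exact: h.
    move=> h l; have [lm|ml] := ltnP l m; last by rewrite CT.
    have := h (j - l.+1%:Z); rewrite DE; apply.
    by apply/mapP; exists l => //; rewrite mem_iota.
  have mD i : measurable (D i) by rewrite /D; case: ifP.
  have uJ : uniq J.
    by rewrite map_inj_uniq ?iota_uniq// => a b; lia.
  have jJ : j \notin J by apply/mapP => -[l _]; lia.
  rewrite E1 (heps (J:=J))//.
  have Dj : D j = B by rewrite /D eqxx.
  have -> : P (eps j @^-1` B) = P (eps j @^-1` D j) by rewrite Dj.
  have := heps (J := j :: J) (B := D); rewrite big_cons => <-//=; last by rewrite jJ.
  congr (P _); apply/seteqP; split => w /=.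
    by move=> [h1 h2] i /=; rewrite inE => /orP[/eqP->|/h2//]; rewrite /D eqxx.
  move=> h; split; first by have := h j; rewrite /= mem_head /D eqxx; exact.
  by move=> i /= iJ; apply: h => /=; rewrite inE iJ orbT.
- move=> S mS PS.
  have mS' := past_sub mS.
  have -> : eps j @^-1` B `&` ~` S = (eps j @^-1` B) `\` (eps j @^-1` B `&` S).
    by rewrite setDIr setDv set0U setDE.
  rewrite measureD//; [|exact: measurableI|].
    have {}PS : P (eps j @^-1` B `&` (S : set T)) = (P (eps j @^-1` B) * P S)%E by [].
    rewrite setIA setIid.
    transitivity (P (eps j @^-1` B) - P (eps j @^-1` B) * P S)%E.
      by rewrite -PS.
    rewrite probability_setC//.
    by rewrite muleBr ?mule1//; exact: fin_num_measure.
  apply: le_lt_trans (ltry 1); exact: probability_le1.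
- move=> F mF tF PF.
  have mF' n := past_sub (mF n).
  rewrite setI_bigcupr !measure_bigcup//.
  + have <- : (fine (P (eps j @^-1` B)))%:E = P (eps j @^-1` B).
      by rewrite fineK// fin_num_measure.
    rewrite -nneseriesZl//; apply: eq_eseriesr => n _.
    by rewrite fineK ?fin_num_measure//; exact: PF.
  + by move=> n _; exact: measurableI.
  + exact: trivIset_setIl.
Qed.

End Past.

Section PastFubini.
Context (R : realType) (d : measure_display) (T : measurableType d)
  (P : probability T R) (eps : int -> {RV P >-> R}).

Lemma past_pair_measurable (j : int) :
  measurable_fun [set: T] (fun w : T => (eps j w, to_past eps j w)).
Proof. by apply/measurable_fun_pairP; split => //=; exact: measurable_funPT. Qed.

Definition past_pair (j : int) (w : T) : R * past eps j := (eps j w, to_past eps j w).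

HB.instance Definition _ j :=
  isMeasurableFun.Build _ _ _ _ (past_pair j) (@past_pair_measurable j).

Hypothesis heps : iid eps.

Let mu := distribution P (eps 1%:Z).

Lemma past_pair_distribution (j : int) (X : set (R * past eps j)) : measurable X ->
  ((mu : probability _ _) \x (distribution P (to_past eps j) : probability _ _))%E X =
  distribution P (past_pair j) X.
Proof.
have [hind hid] := heps.
apply: (product_measure_unique (m' := distribution P (past_pair j))) => A B mA mB.
by rewrite /= /mu (hid 1%:Z j A mA); exact: (past_indep hind).
Qed.

(** The innovation at time [j] may be integrated out with the past frozen, because its joint law
    with the past is a product. This stands in for conditioning on the past. *)
Lemma past_fubini (j : int) (Psi : R * past eps j -> \bar R) :
  measurable_fun [set: R * past eps j] Psi -> (forall z, (0 <= Psi z)%E) ->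
  (\int[P]_w Psi (eps j w, w) = \int[P]_w \int[mu]_e Psi (e, w))%E.
Proof.
move=> mPsi Psi0.
transitivity (\int[distribution P (past_pair j)]_z Psi z)%E.
  by rewrite ge0_integral_distribution.
transitivity (\int[((mu : probability _ _) \x (distribution P (to_past eps j) : probability _ _))%E]_z Psi z)%E.
  by apply: eq_measure_integral => A mA _; apply/esym; exact: past_pair_distribution.
rewrite fubini_tonelli2// ge0_integral_distribution//.
  exact: measurable_fun_fubini_tonelli_G.
by move=> y; apply: integral_ge0.
Qed.

End PastFubini.

Lemma bounded_integrable d (T : measurableType d) (R : realType)
    {P : probability T R} (g : T -> R) (C : R) :
  measurable_fun setT g -> (forall x, `|g x| <= C) ->
  P.-integrable setT (EFin \o g).
Proof.
move=> mg gC; apply: measurable_bounded_integrable => //.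
  by apply: (@le_lt_trans _ _ 1%E); [exact: probability_le1|exact: ltry].
exists C; split; first exact: num_real.
by move=> M CM x _; apply: (le_trans (gC x)); exact: ltW.
Qed.

Lemma integrable_prob_cst d (T : measurableType d) (R : realType)
  {P : probability T R} (r : R) : P.-integrable setT (EFin \o cst r).
Proof. exact: finite_measure_integrable_cst. Qed.

Lemma Rintegral_prob_cst d (T : measurableType d) (R : realType)
  (P : probability T R) (r : R) : \int[P]_w r = r.
Proof.
rewrite Rintegral_cst//.
by rewrite (_ : fine _ = 1) ?mulr1//; exact: (congr1 fine (probability_setT P)).
Qed.

(** From [expR (- z) >= 1 - z], as (1 - z) (1 + z + 2 z^2) = 1 + z^2 (1 - 2 z) >= 1. *)
Lemma expR_le_quadratic (R : realType) (z : R) : z <= 2^-1 ->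
  expR z <= 1 + z + 2 * z ^+ 2.
Proof.
move=> z12; have h := expR_ge1Dx (- z).
have e0 := expR_gt0 z.
have : expR z * (1 - z) <= 1.
  rewrite -[leRHS](expRxMexpNx_1 z) ler_pM2l//; lra.
by nra.
Qed.

(** * Averaging over one innovation *)

Section Averaging.
Context (R : realType) (mu : probability R R).
Implicit Types (phi : R -> R) (s y e : R).

Definition test_function phi :=
  measurable_fun [set: R] phi /\ forall y, 0 <= phi y <= 1.

Definition smear s phi : R -> R := fun y => \int[mu]_e phi (y + s * e).

Lemma test_norm phi y : test_function phi -> `|phi y| <= 1.
Proof. by move=> [_ /(_ y)/andP[p0 p1]]; rewrite ger0_norm. Qed.

Lemma test_shift_measurable phi s y : test_function phi ->
  measurable_fun [set: R] (fun e => phi (y + s * e)).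
Proof.
move=> [mphi _]; apply: (measurableT_comp mphi).
by apply: measurable_funD => //; exact: measurable_funM.
Qed.

Lemma test_shift_integrable phi s y : test_function phi ->
  mu.-integrable setT (EFin \o (fun e => phi (y + s * e))).
Proof.
move=> tphi; apply: (bounded_integrable (C := 1)).
  exact: test_shift_measurable.
by move=> e; exact: test_norm.
Qed.

Lemma smear_EFin phi s y : test_function phi ->
  (smear s phi y)%:E = (\int[mu]_e (phi (y + s * e))%:E)%E.
Proof.
move=> tphi; rewrite /smear /Rintegral fineK//.
exact: integrable_fin_num (test_shift_integrable s y tphi).
Qed.

Lemma smear_le phi s (B : R) : test_function phi -> (forall y, phi y <= B) ->
  forall y, smear s phi y <= B.
Proof.
move=> tphi phiB y; rewrite -[leRHS](Rintegral_prob_cst mu).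
apply: le_Rintegral => //; first exact: test_shift_integrable.
exact: integrable_prob_cst.
Qed.

Lemma smear_test phi s : test_function phi -> test_function (smear s phi).
Proof.
move=> tphi; split; last first.
  move=> y; rewrite Rintegral_ge0//=; last first.
    by move=> e _; have [_ /(_ (y + s * e))/andP[]] := tphi.
  by apply: smear_le => // {}y; have [_ /(_ y)/andP[]] := tphi.
have : measurable_fun setT (fun y => (\int[mu]_e (phi (y + s * e))%:E)%E).
  apply: (@measurable_fun_fubini_tonelli_F _ _ _ _ _ mu (fun z : R * R => (phi (z.1 + s * z.2))%:E)).
    apply/measurable_EFinP; apply: (measurableT_comp tphi.1).
    apply: measurable_funD => //.
    by apply: measurable_funM => //; exact: measurable_snd.
  by move=> z; rewrite lee_fin; have [_ /(_ (z.1 + s * z.2))/andP[]] := tphi.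
move=> h; apply/measurable_EFinP; apply: eq_measurable_fun h => y _ /=.
by rewrite smear_EFin.
Qed.

Lemma smear0 phi : smear 0 phi = phi.
Proof.
apply/funext => y; rewrite /smear.
under eq_Rintegral do rewrite mul0r addr0.
exact: Rintegral_prob_cst.
Qed.

Lemma smear_lipschitz phi s (L : R) : test_function phi ->
  (forall y y', `|phi y - phi y'| <= L * `|y - y'|) ->
  forall y y', `|smear s phi y - smear s phi y'| <= L * `|y - y'|.
Proof.
move=> tphi phiL y y'.
rewrite /smear -RintegralB//; [|exact: test_shift_integrable..].
apply: (le_trans (le_normr_Rintegral _ _)) => //.
  have := integrableB measurableT (test_shift_integrable s y tphi) (test_shift_integrable s y' tphi).
  by apply: eq_integrable => // e _ /=.
rewrite -[leRHS](Rintegral_prob_cst mu); apply: le_Rintegral => //.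
- apply: (bounded_integrable (C := 2)).
    apply: measurableT_comp => //; apply: measurable_funB; exact: test_shift_measurable.
  move=> e; rewrite normr_id; apply: (le_trans (ler_normB _ _)).
  by have := test_norm (y + s * e) tphi; have := test_norm (y' + s * e) tphi; lra.
- exact: integrable_prob_cst.
- by move=> e _; apply: (le_trans (phiL _ _)); rewrite opprD addrACA subrr addr0.
Qed.

Definition deviation s phi y e := phi (y + s * e) - smear s phi y.

Lemma deviation_measurable phi s y : test_function phi ->
  measurable_fun [set: R] (deviation s phi y).
Proof. by move=> tphi; apply: measurable_funB => //; exact: test_shift_measurable. Qed.

Lemma deviation_bound phi s y e (B : R) : test_function phi ->
  (forall y, phi y <= B) -> `|deviation s phi y e| <= B.
Proof.
move=> tphi phiB; rewrite /deviation.
have [_ /(_ (y + s * e))/andP[a0 _]] := tphi.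
have [_ /(_ y)/andP[b0 _]] := smear_test s tphi.
have := phiB (y + s * e); have := smear_le s tphi phiB y.
by rewrite ler_norml; lra.
Qed.

Lemma deviation_le1 phi s y e : test_function phi -> `|deviation s phi y e| <= 1.
Proof.
by move=> tphi; apply: deviation_bound => // {}y; have [_ /(_ y)/andP[]] := tphi.
Qed.

Lemma deviation_integrable phi s y : test_function phi ->
  mu.-integrable setT (EFin \o deviation s phi y).
Proof.
move=> tphi; apply: (bounded_integrable (C := 1)).
  exact: deviation_measurable.
by move=> e; exact: deviation_le1.
Qed.

Lemma deviation_mean phi s y : test_function phi -> \int[mu]_e deviation s phi y e = 0.
Proof.
move=> tphi; rewrite RintegralB//.
- by rewrite (Rintegral_prob_cst mu) subrr.
- exact: test_shift_integrable.
- exact: integrable_prob_cst.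
Qed.

(** A function with values in [0, 1] dominates its square, so its variance is at most its mean. For
    the indicator of an interval this mean is, after averaging, of the order of the length. *)
Lemma deviation_sqr phi s y : test_function phi ->
  \int[mu]_e (deviation s phi y e ^+ 2) <= smear s phi y.
Proof.
move=> tphi.
set p := smear s phi y.
have p0 : 0 <= p by have [_ /(_ y)/andP[]] := smear_test s tphi.
have I1 := test_shift_integrable s y tphi.
have I2 : mu.-integrable setT (EFin \o (fun e => (1 - 2 * p) * phi (y + s * e))).
  apply: (bounded_integrable (C := `|1 - 2 * p|)).
    by apply: measurable_funM => //; exact: test_shift_measurable.
  by move=> e; rewrite normrM ler_piMr//; exact: test_norm.
apply: (@le_trans _ _ (\int[mu]_e ((1 - 2 * p) * phi (y + s * e) + p ^+ 2))).
  apply: le_Rintegral => //.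
  - apply: (bounded_integrable (C := 1)).
      by apply: measurable_funX => //; exact: deviation_measurable.
    by move=> e; rewrite normrX expr_le1//; exact: deviation_le1.
  - have := integrableD measurableT I2 (integrable_prob_cst (p ^+ 2)).
    by apply: eq_integrable => // e _.
  - move=> e _; rewrite /deviation -/p.
    by have [_ /(_ (y + s * e))/andP[a0 a1]] := tphi; nra.
rewrite RintegralD//; last exact: integrable_prob_cst.
rewrite RintegralZl// (Rintegral_prob_cst mu) -/(smear s phi y) -/p; nra.
Qed.

Hypothesis mu1 : mu.-integrable setT (EFin \o (fun e : R => e)).

Let m1 := \int[mu]_e `|e|.

Lemma normr_integrable : mu.-integrable setT (EFin \o (fun e : R => `|e|)).
Proof. exact: integrable_norm mu1. Qed.

(** [deviation] is the mean over an independent copy [e'] of [phi (y + s * e) - phi (y + s * e')],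
    to which the Lipschitz bound applies. *)
Lemma deviation_lipschitz phi s y e (L : R) : test_function phi -> 0 <= L ->
  (forall y y', `|phi y - phi y'| <= L * `|y - y'|) ->
  `|deviation s phi y e| <= L * `|s| * (`|e| + m1).
Proof.
move=> tphi L0 phiL; rewrite /deviation /smear.
rewrite -[X in X - _](Rintegral_prob_cst mu) -RintegralB//; last first.
- exact: test_shift_integrable.
- exact: integrable_prob_cst.
have bnd e' : `|phi (y + s * e) - phi (y + s * e')| <= L * `|s| * (`|e| + `|e'|).
  apply: (le_trans (phiL _ _)).
  rewrite -mulrA ler_wpM2l// opprD addrACA subrr add0r -mulrBr normrM.
  by rewrite ler_wpM2l// ler_normB.
have J : mu.-integrable setT (EFin \o (fun e' => L * `|s| * (`|e| + `|e'|))).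
  have := integrableZl measurableT (L * `|s|) (integrableD measurableT (integrable_prob_cst `|e|) normr_integrable).
  by apply: eq_integrable => // e' _.
have J0 : mu.-integrable setT (EFin \o (fun e' => phi (y + s * e) - phi (y + s * e'))).
  have := integrableB measurableT (integrable_prob_cst (phi (y + s * e))) (test_shift_integrable s y tphi).
  by apply: eq_integrable => // e' _.
apply: (le_trans (le_normr_Rintegral _ _)) => //.
apply: (@le_trans _ _ (\int[mu]_e' (L * `|s| * (`|e| + `|e'|)))).
  apply: le_Rintegral => //; exact: integrable_norm J0.
rewrite RintegralZl//; last first.
  have := (integrableD measurableT (integrable_prob_cst `|e|) normr_integrable).
  by apply: eq_integrable => // e' _.
rewrite RintegralD// ?(Rintegral_prob_cst mu)//; [exact: integrable_prob_cst|exact: normr_integrable].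
Qed.

(** Bernstein's argument: [lam * g] stays below 1/2, so the quadratic bound on [expR] applies; the
    linear term has mean zero, and 1 + x <= e^x closes the estimate. *)
Lemma mgf_step (g : R -> R) (lam b v : R) : measurable_fun setT g ->
  (forall e, `|g e| <= b) -> \int[mu]_e g e = 0 -> \int[mu]_e (g e ^+ 2) <= v ->
  `|lam| * b <= 2^-1 ->
  (\int[mu]_e (expR (lam * g e))%:E <= (expR (2 * lam ^+ 2 * v))%:E)%E.
Proof.
move=> mg gb g0 gv lb.
have Ig : mu.-integrable setT (EFin \o g) by exact: bounded_integrable mg gb.
have Ig2 : mu.-integrable setT (EFin \o (fun e => g e ^+ 2)).
  apply: (bounded_integrable (C := b ^+ 2)); first exact: measurable_funX.
  by move=> e; rewrite normrX lerXn2r// nnegrE ?(le_trans _ (gb e)).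
have I1 : mu.-integrable setT (EFin \o (fun e => 1 + lam * g e)).
  have := integrableD measurableT (integrable_prob_cst 1) (integrableZl measurableT lam Ig).
  by apply: eq_integrable => // e _.
have I2 : mu.-integrable setT (EFin \o (fun e => 2 * lam ^+ 2 * g e ^+ 2)).
  have := (integrableZl measurableT (2 * lam ^+ 2) Ig2).
  by apply: eq_integrable => // e _.
have I3 : mu.-integrable setT (EFin \o (fun e => 1 + lam * g e + 2 * lam ^+ 2 * g e ^+ 2)).
  have := integrableD measurableT I1 I2.
  by apply: eq_integrable => // e _.
apply: (@le_trans _ _ (\int[mu]_e (1 + lam * g e + 2 * lam ^+ 2 * g e ^+ 2)%:E)%E).
  apply: ge0_le_integral => //.
  - apply/measurable_EFinP; apply: measurableT_comp => //; exact: measurable_funM.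
  - by have /integrableP[] := I3.
  - move=> e _; rewrite lee_fin; apply: (le_trans (expR_le_quadratic _)).
      apply: le_trans lb; apply: (le_trans (ler_norm _)).
      by rewrite normrM ler_wpM2l.
    by rewrite exprMn mulrA.
have -> : (\int[mu]_e (1 + lam * g e + 2 * lam ^+ 2 * g e ^+ 2)%:E)%E =
  (\int[mu]_e (1 + lam * g e + 2 * lam ^+ 2 * g e ^+ 2))%:E.
  by rewrite /Rintegral fineK//; exact: integrable_fin_num I3.
rewrite lee_fin RintegralD// RintegralD//; last 2 first.
- exact: integrable_prob_cst.
- by have := (integrableZl measurableT lam Ig); apply: eq_integrable => // e _.
rewrite !RintegralZl// (Rintegral_prob_cst mu) g0 mulr0 addr0.
by apply: le_trans (expR_ge1Dx _); rewrite lerD2l ler_wpM2l// mulr_ge0// sqr_ge0.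
Qed.

End Averaging.

(** * Exponential moments of sums of martingale differences *)

Section MgfChain.
Context (R : realType) (d : measure_display) (T : measurableType d)
  (P : probability T R) (eps : int -> {RV P >-> R}).

Lemma past_mono (j j' : int) : j <= j' ->
  measurable_fun [set: past eps j'] (idfun : past eps j' -> past eps j).
Proof.
move=> jj' _ A mA; rewrite setTI; move: A mA.
apply: smallest_sub.
  split; first exact: measurable0.
    by move=> A mA; rewrite setTD; exact: measurableC.
  by move=> F mF; exact: bigcupT_measurable.
move=> _ [m [B [mB BT ->]]].
have -> : [set w | forall l : nat, B l (eps (j - l.+1%:Z) w)] =
  \bigcap_l ((eps (j - l.+1%:Z) : past eps j' -> R) @^-1` B l).
  by apply/seteqP; split => w /= h; [move=> l _; exact: h|move=> l; exact: (h l)].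
apply: bigcapT_measurable => l; rewrite -[X in measurable X]setTI.
by apply: past_measurable_eps => //; lia.
Qed.

Lemma past_measurable_T (j : int) d' (U : measurableType d') (g : T -> U) :
  measurable_fun [set: past eps j] (g : past eps j -> U) ->
  measurable_fun [set: T] g.
Proof. by move=> mg; exact: (measurableT_comp mg (@past_id_measurable _ _ _ P eps j)). Qed.

Hypothesis heps : iid eps.
Let mu := distribution P (eps 1%:Z).

(** [D a e w] is the increment at time [j0 + a]: [e] stands for the innovation of that time, and [w]
    enters only through the earlier ones. *)
Variables (j0 : int) (D : nat -> R -> T -> R) (b v lam : R).
Hypothesis mD : forall a, measurable_fun [set: R * past eps (j0 + a%:Z)]
  (fun z : R * past eps (j0 + a%:Z) => D a z.1 z.2).
Hypothesis Db : forall a e w, `|D a e w| <= b.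
Hypothesis D0 : forall a w, \int[mu]_e D a e w = 0.
Hypothesis Dv : forall a w, \int[mu]_e (D a e w ^+ 2) <= v.
Hypothesis lamb : `|lam| * b <= 2^-1.

Let S n w := \sum_(a < n) D a (eps (j0 + a%:Z) w) w.

Lemma chain_measurable n : measurable_fun [set: past eps (j0 + n%:Z)]
  (S n : past eps (j0 + n%:Z) -> R).
Proof.
apply: measurable_sum => a.
have mpair : measurable_fun [set: past eps (j0 + n%:Z)]
    (fun w : past eps (j0 + n%:Z) =>
      (eps (j0 + (a : nat)%:Z) w, w : past eps (j0 + (a : nat)%:Z))).
  apply/measurable_fun_pairP; split => /=.
    by apply: past_measurable_eps; rewrite ltrD2l ltz_nat.
  by apply: past_mono; rewrite lerD2l lez_nat ltnW.
exact: (measurableT_comp (@mD a) mpair).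
Qed.

(** The last innovation is integrated out: the earlier sum is a function of its past and factors
    out, which leaves one application of [mgf_step]. *)
Lemma mgf_chain n :
  (\int[P]_w (expR (lam * S n w))%:E <= (expR (2 * lam ^+ 2 * v * n%:R))%:E)%E.
Proof.
elim: n => [|n IH].
  rewrite /S; under eq_integral do rewrite big_ord0 mulr0 expR0.
  by rewrite mulr0 expR0 integral_cst// mul1e probability_le1.
pose Psi (z : R * past eps (j0 + n%:Z)) := (expR (lam * (S n z.2 + D n z.1 z.2)))%:E.
have mPsi : measurable_fun [set: R * past eps (j0 + n%:Z)] Psi.
  apply/measurable_EFinP; apply: measurableT_comp => //; apply: measurable_funM => //.
  apply: measurable_funD; last exact: mD.
  by apply: (measurableT_comp (@chain_measurable n)); exact: measurable_snd.
have := past_fubini heps mPsi (fun z => ltW _) ; rewrite -/mu => fub.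
have -> : (\int[P]_w (expR (lam * S n.+1 w))%:E =
  \int[P]_w Psi (eps (j0 + n%:Z) w, w))%E.
  by apply: eq_integral => w _; rewrite /S big_ord_recr.
rewrite fub; last by move=> z; rewrite lte_fin expR_gt0.
apply: (@le_trans _ _ (\int[P]_w ((expR (2 * lam ^+ 2 * v))%:E * (expR (lam * S n w))%:E))%E).
  apply: ge0_le_integral => //.
  - by move=> w _; apply: integral_ge0 => e _; rewrite lee_fin expR_ge0.
  - apply: (@past_measurable_T (j0 + n%:Z)).
    apply: (measurable_fun_fubini_tonelli_G Psi mPsi).
    by move=> z; rewrite lee_fin expR_ge0.
  - apply: measurable_funeM; apply/measurable_EFinP; apply: measurableT_comp => //.
    by apply: measurable_funM => //; exact: past_measurable_T (@chain_measurable n).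
  move=> w _; rewrite /Psi/=.
  have mDw : measurable_fun [set: R] (fun e => D n e w).
    have mp : measurable_fun [set: R] (fun e : R => (e, w : past eps (j0 + n%:Z))).
      by apply/measurable_fun_pairP; split; [exact: measurable_id|exact: measurable_cst].
    exact: (measurableT_comp (@mD n) mp).
  have -> : (\int[mu]_e (expR (lam * (S n w + D n e w)))%:E)%E =
    (\int[mu]_e ((expR (lam * S n w))%:E * (expR (lam * D n e w))%:E))%E.
    by apply: eq_integral => e _; rewrite mulrDr expRD.
  rewrite ge0_integralZl//; last first.
    by apply/measurable_EFinP; apply: measurableT_comp => //; exact: measurable_funM.
  rewrite muleC; apply: lee_wpmul2r; first by rewrite lee_fin expR_ge0.
  exact: mgf_step mDw (fun e => Db n e w) (D0 n w) (Dv n w) lamb.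
rewrite ge0_integralZl//; last first.
  apply/measurable_EFinP; apply: measurableT_comp => //.
  by apply: measurable_funM => //; exact: past_measurable_T (@chain_measurable n).
apply: (le_trans (lee_wpmul2l _ IH)); first by rewrite lee_fin expR_ge0.
rewrite -EFinM -expRD lee_fin ler_expR.
have -> : n.+1%:R = n%:R + 1 :> R by rewrite natr1.
by rewrite mulrDr mulr1 addrC.
Qed.

End MgfChain.

(** * Averaging over successive innovations *)

Section SmearIter.
Context (R : realType) (mu : probability R R) (c : nat -> R).

Fixpoint smear_iter (k : nat) (phi : R -> R) : R -> R :=
  if k is k'.+1 then smear mu (c k') (smear_iter k' phi) else phi.

Lemma smear_iter_test k phi : test_function phi -> test_function (smear_iter k phi).
Proof. by move=> tphi; elim: k => //= k IH; exact: smear_test. Qed.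

Variable k0 : nat.
Hypothesis ck0 : forall k, (k < k0)%N -> c k = 0.

(* In [band_tame] the constant [C] is proportional to the length of the interval. *)
Definition tame (C : R) phi := [/\ test_function phi,
  (forall y, smear_iter k0.+1 phi y <= C) &
  forall y y', `|smear_iter k0.+1 phi y - smear_iter k0.+1 phi y'| <= C * `|y - y'|].

Lemma smear_iter_tame C phi k : tame C phi -> (k0 < k)%N ->
  (forall y, smear_iter k phi y <= C) /\
  forall y y', `|smear_iter k phi y - smear_iter k phi y'| <= C * `|y - y'|.
Proof.
move=> [tphi bphi lphi]; elim: k => // k IH; rewrite ltnS leq_eqVlt => /orP[/eqP<-//|/IH[b l]].
by split => /=; [apply: smear_le|apply: smear_lipschitz] => //; exact: smear_iter_test.
Qed.

Lemma tame_ge0 C phi : tame C phi -> 0 <= C.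
Proof.
move=> [tphi bphi _]; apply: le_trans (bphi 0).
by have [_ /(_ 0)/andP[]] := smear_iter_test k0.+1 tphi.
Qed.

Lemma deviation_lt k phi y e : test_function phi -> (k < k0)%N ->
  deviation mu (c k) (smear_iter k phi) y e = 0.
Proof.
by move=> tphi kk; rewrite /deviation ck0// smear0 mul0r addr0 subrr.
Qed.

End SmearIter.

Section LinearProcess.
Context (R : realType) (d : measure_display) (T : measurableType d)
  (P : probability T R) (eps : int -> {RV P >-> R}) (c : nat -> R).

(* A version of the tail sum that is total and measurable with respect to the past: where the
   series diverges it is a junk value. *)
Definition ma_tail (i : int) (k : nat) (w : T) : R :=
  fine (limn_esup (fun m => (\sum_(k <= l < m) c l * eps (i - l%:Z) w)%:E)).

Lemma ma_tailE i k w (S : R) :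
  series (fun l : nat => c l * eps (i - l%:Z) w) @ \oo --> S ->
  ma_tail i k w = S - \sum_(0 <= l < k) c l * eps (i - l%:Z) w.
Proof.
move=> cS.
have h : (fun m => (\sum_(k <= l < m) c l * eps (i - l%:Z) w)%:E) @ \oo -->
    (S - \sum_(0 <= l < k) c l * eps (i - l%:Z) w)%:E.
  apply: cvg_EFin; first exact: nearW.
  have : (fun m => series (fun l : nat => c l * eps (i - l%:Z) w) m -
     \sum_(0 <= l < k) c l * eps (i - l%:Z) w) @ \oo -->
     S - \sum_(0 <= l < k) c l * eps (i - l%:Z) w by apply: cvgB => //; exact: cvg_cst.
  apply: cvg_trans; apply: near_eq_cvg; near=> m.
  have km : (k <= m)%N by near: m; exact: nbhs_infty_ge.
  rewrite /series/= [X in X - _](@big_cat_nat _ _ _ k)//=.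
  by rewrite addrAC subrr add0r.
by rewrite /ma_tail is_cvg_limn_esupE; [rewrite (cvg_lim _ h)|apply/cvg_ex; eexists; exact: h].
Unshelve. all: end_near. Qed.

Lemma ma_tail_past (i j : int) (k : nat) : i - k%:Z < j ->
  measurable_fun [set: past eps j] (ma_tail i k : past eps j -> R).
Proof.
move=> ikj; rewrite /ma_tail.
have h : measurable_fun [set: past eps j] (fun w : past eps j =>
    limn_esup (fun m => (\sum_(k <= l < m) c l * eps (i - l%:Z) w)%:E)).
  apply: (measurable_fun_limn_esup (f := fun m (w : past eps j) =>
    (\sum_(k <= l < m) c l * eps (i - l%:Z) w)%:E)) => m.
  apply/measurable_EFinP.
  rewrite [X in measurable_fun _ X](_ : _ = (fun w : past eps j =>
     \sum_(l < m - k) c (l + k)%N * eps (i - (l + k)%N%:Z) w)); last first.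
    by apply/funext => w; rewrite -{1}[k]add0n big_addn big_mkord.
  apply: measurable_sum => l.
  by apply: measurable_funM => //; apply: past_measurable_eps; lia.
exact: (measurableT_comp (@fine_measurable R _ measurableT) h).
Qed.

Lemma ma_tail_measurable (i : int) k : measurable_fun [set: T] (ma_tail i k).
Proof. by apply: (past_measurable_T (j := i + 1)); apply: ma_tail_past; lia. Qed.

End LinearProcess.

Lemma Rintegral_bigsum d (T : measurableType d) (R : realType)
    (mu : {measure set T -> \bar R}) (I : Type) (s : seq I) (Q : pred I) (f : I -> T -> R) :
  (forall i, mu.-integrable setT (EFin \o f i)) ->
  mu.-integrable setT (EFin \o (fun x => \sum_(i <- s | Q i) f i x)) /\
  \int[mu]_x (\sum_(i <- s | Q i) f i x) = \sum_(i <- s | Q i) \int[mu]_x f i x.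
Proof.
move=> fI; elim: s => [|i s [IH1 IH2]].
  split; first by apply: eq_integrable (integrable0 mu _) => // x _ /=; rewrite big_nil.
  by under eq_Rintegral do rewrite big_nil; rewrite big_nil /Rintegral integral0.
case Qi : (Q i); last first.
  split; first by apply: eq_integrable IH1 => // x _ /=; rewrite big_cons Qi.
  by under eq_Rintegral do rewrite big_cons Qi; rewrite big_cons Qi.
split.
  apply: eq_integrable (integrableD measurableT (fI i) IH1) => // x _ /=.
  by rewrite big_cons Qi.
under eq_Rintegral do rewrite big_cons Qi.
by rewrite big_cons Qi RintegralD// IH2.
Qed.

(** For a fixed lag [k], the [a] with K <= a + 1 + k < K + M correspond one to one to the positions
    i = a + 1 + k - K of the window. This trades summation by position for summation by
    innovation. *)
Lemma big_shift_window (R : realType) (M K k : nat) (g : nat -> R) : (k < K)%N ->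
  \sum_(a < M + K) (if (K <= a.+1 + k < K + M)%N then g (a.+1 + k - K)%N else 0) =
  \sum_(i < M) g i.
Proof.
move=> kK.
rewrite -(big_mkord xpredT (fun a => if (K <= a.+1 + k < K + M)%N then g (a.+1 + k - K)%N else 0)).
rewrite (@big_cat_nat _ _ _ (K - k.+1))//=; last by lia.
rewrite (@big_cat_nat _ _ _ (K - k.+1 + M) (K - k.+1))//=; [|by lia..].
rewrite big_nat big1 ?add0r; last by move=> a /andP[_ aK]; rewrite ifF//; apply/negbTE; lia.
rewrite [X in _ + X]big_nat [X in _ + X]big1 ?addr0; last first.
  by move=> a /andP[aK _]; rewrite ifF//; apply/negbTE; lia.
rewrite -{1}[(K - k.+1)%N]add0n big_addn addKn big_mkord; apply: eq_bigr => i _.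
have iM := ltn_ord i.
rewrite ifT; last by lia.
by congr g; lia.
Qed.

(** * Martingale increments of the sum over a window *)

Section Increments.
Context (R : realType) (d : measure_display) (T : measurableType d)
  (P : probability T R) (eps : int -> {RV P >-> R}) (c : nat -> R).
Hypothesis heps : iid eps.

Let mu := distribution P (eps 1%:Z).
Let m1 := \int[mu]_e `|e|.
Let m2 := \int[mu]_e (`|e| + m1) ^+ 2.

Hypothesis mu1 : mu.-integrable setT (EFin \o (fun e : R => e)).
Hypothesis mu2 : mu.-integrable setT (EFin \o (fun e : R => (`|e| + m1) ^+ 2)).

Variables (k0 : nat) (Sc : R).
Hypothesis ck0 : forall k, (k < k0)%N -> c k = 0.
Hypothesis cS : forall K, \sum_(k < K) `|c k| <= Sc.

Variables (C : R) (phi : R -> R).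
Hypothesis tphi : tame mu c k0 C phi.

Let phi_test k : test_function (smear_iter mu c k phi).
Proof. by apply: smear_iter_test; case: tphi. Qed.

Definition dev_at (i : nat) (k : nat) (e : R) (w : T) :=
  deviation mu (c k) (smear_iter mu c k phi) (ma_tail eps c i%:Z k.+1 w) e.

(* The terms of the telescoped window sum that involve the innovation [eps (s + 1 - K + a)],
   which enters [X i] with lag [k] for [i = s + (a + 1 + k - K)]. *)
Definition inc (s M K a : nat) (e : R) (w : T) : R :=
  \sum_(k < K | (K <= a.+1 + k < K + M)%N) dev_at (s + (a.+1 + k - K)) k e w.

Lemma dev_at_measurable i k (j : int) : i%:Z - k.+1%:Z < j ->
  measurable_fun [set: R * past eps j] (fun z : R * past eps j => dev_at i k z.1 z.2).
Proof.
move=> ij.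
have mY : measurable_fun [set: R * past eps j] (fun z : R * past eps j => ma_tail eps c i%:Z k.+1 z.2).
  have h : measurable_fun [set: past eps j] (ma_tail eps c i%:Z k.+1 : past eps j -> R).
    exact: ma_tail_past.
  exact: (measurableT_comp h (@measurable_snd _ _ _ _)).
apply: measurable_funB.
  apply: (measurableT_comp (phi_test k).1); apply: measurable_funD => //.
  by apply: measurable_funM => //; exact: measurable_fst.
exact: (measurableT_comp (phi_test k.+1).1).
Qed.

Lemma dev_at_measurable1 i k w : measurable_fun [set: R] (fun e => dev_at i k e w).
Proof. exact: deviation_measurable. Qed.

Lemma dev_at_integrable i k w : mu.-integrable setT (EFin \o (fun e => dev_at i k e w)).
Proof. exact: deviation_integrable. Qed.

(** Three regimes: before [k0] averaging does nothing; at [k0] the test function is still the raw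
    one, bounded by 1 only; after [k0] the bound [C] of the smoothed function is available. *)
Lemma dev_at_bound i k e w : `|dev_at i k e w| <= (k == k0)%:R + C.
Proof.
have C0 := tame_ge0 tphi.
have [kk|kk|->] := ltngtP k k0.
- by rewrite /dev_at (deviation_lt _ ck0)//; [rewrite normr0 add0r|case: tphi].
- rewrite add0r; apply: deviation_bound => //.
  by have [] := smear_iter_tame tphi kk.
- by apply: (@le_trans _ _ 1); [exact: deviation_le1|rewrite lerDl].
Qed.

Lemma dev_at_lip i k e w : k != k0 -> `|dev_at i k e w| <= C * `|c k| * (`|e| + m1).
Proof.
have C0 := tame_ge0 tphi.
have m10 : 0 <= m1 by apply: Rintegral_ge0.
case: ltngtP => // kk _.
  rewrite /dev_at (deviation_lt _ ck0)//; last by case: tphi.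
  by rewrite normr0 !mulr_ge0// addr_ge0.
apply: deviation_lipschitz => //.
by have [] := smear_iter_tame tphi kk.
Qed.

Lemma inc_bound s M K a e w : `|inc s M K a e w| <= 1 + C * K%:R.
Proof.
have C0 := tame_ge0 tphi.
apply: (le_trans (ler_norm_sum _ _ _)).
apply: (@le_trans _ _ (\sum_(k < K) (((k : nat) == k0)%:R + C))).
  rewrite big_mkcond; apply: ler_sum => k _.
  by case: ifP => _; [exact: dev_at_bound|rewrite addr_ge0].
rewrite big_split/= sumr_const card_ord mulr_natr lerD2r.
rewrite -(big_mkord xpredT (fun k => (k == k0)%:R)) -natr_sum.
rewrite (_ : 1 = 1%:R)// ler_nat.
rewrite -big_mkcond/= sum1_count.
by rewrite -/(count_mem k0 _) count_uniq_mem ?iota_uniq//; case: (_ \in _).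
Qed.

Lemma inc_mean s M K a w : \int[mu]_e inc s M K a e w = 0.
Proof.
rewrite /inc.
have [_ ->] := Rintegral_bigsum (index_enum 'I_K)
  (fun k : 'I_K => (K <= a.+1 + k < K + M)%N)
  (fun k : 'I_K => dev_at_integrable (s + (a.+1 + k - K)) k w).
by apply: big1 => k _; exact: deviation_mean.
Qed.

Lemma inc_measurable s M K a :
  measurable_fun [set: R * past eps ((s.+1)%:Z - K%:Z + a%:Z)]
   (fun z : R * past eps ((s.+1)%:Z - K%:Z + a%:Z) => inc s M K a z.1 z.2).
Proof.
rewrite /inc.
rewrite [X in measurable_fun _ X](_ : _ = fun z : R * past eps ((s.+1)%:Z - K%:Z + a%:Z) =>
  \sum_(k < K) (if (K <= a.+1 + k < K + M)%N then dev_at (s + (a.+1 + k - K)) k z.1 z.2 else 0)); last first.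
  by apply/funext => z; rewrite big_mkcond.
apply: measurable_sum => k; case: (K <= a.+1 + k < K + M)%N / boolP => h; last exact: measurable_cst.
by apply: dev_at_measurable; lia.
Qed.

(** The lag [k0] is split off by (x + y)^2 <= 2 x^2 + 2 y^2: its variance is at most its mean, hence
    at most [C]. The other lags are added in absolute value through their Lipschitz bounds, with
    total [C * Sc] whatever [K]. *)
Lemma inc_sqr s M K a w :
  \int[mu]_e (inc s M K a e w ^+ 2) <= 2 * C + 2 * (C * Sc) ^+ 2 * m2.
Proof.
have C0 := tame_ge0 tphi.
have m10 : 0 <= m1 by apply: Rintegral_ge0.
pose cond (k : nat) := (K <= a.+1 + k < K + M)%N.
pose d0 e := if cond k0 && (k0 < K)%N then dev_at (s + (a.+1 + k0 - K)) k0 e w else 0.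
have d0E e : \sum_(k < K | cond k && ((k : nat) == k0)) dev_at (s + (a.+1 + k - K)) k e w = d0 e.
  rewrite /d0; case: ifPn => [/andP[ckk kK]|h].
    rewrite (big_pred1 (Ordinal kK))//= => k /=.
    apply/idP/idP => [/andP[_ /eqP kk]|/eqP->/=]; last by rewrite ckk eqxx.
    exact/eqP/val_inj.
  apply: big1 => k /andP[ckk /eqP kk]; move: h.
  by rewrite -kk ckk ltn_ord.
have d1b e : `|\sum_(k < K | cond k && ((k : nat) != k0)) dev_at (s + (a.+1 + k - K)) k e w|
    <= C * Sc * (`|e| + m1).
  apply: (le_trans (ler_norm_sum _ _ _)).
  apply: (@le_trans _ _ (\sum_(k < K) (C * `|c k| * (`|e| + m1)))).
    rewrite big_mkcond; apply: ler_sum => k _.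
    case: ifP => [/andP[_ kk]|_]; first exact: dev_at_lip.
    by rewrite !mulr_ge0// addr_ge0.
  by rewrite -mulr_suml -mulr_sumr ler_wpM2r ?addr_ge0// ler_wpM2l.
have I0 : mu.-integrable setT (EFin \o (fun e => d0 e ^+ 2)).
  apply: (bounded_integrable (C := 1)).
    apply: measurable_funX; rewrite /d0; case: (cond k0 && _); last exact: measurable_cst.
    exact: dev_at_measurable1.
  move=> e; rewrite normrX expr_le1// /d0; case: ifP => _; last by rewrite normr0.
  exact: deviation_le1.
have I0' : mu.-integrable setT (EFin \o (fun e => 2 * d0 e ^+ 2)).
  exact: eq_integrable (integrableZl measurableT 2 I0).
have I1 : mu.-integrable setT (EFin \o (fun e => 2 * (C * Sc) ^+ 2 * (`|e| + m1) ^+ 2)).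
  exact: eq_integrable (integrableZl measurableT (2 * (C * Sc) ^+ 2) mu2).
apply: (@le_trans _ _ (\int[mu]_e (2 * d0 e ^+ 2 + 2 * (C * Sc) ^+ 2 * (`|e| + m1) ^+ 2))).
  apply: le_Rintegral => //.
  - apply: (bounded_integrable (C := (1 + C * K%:R) ^+ 2)).
      apply: measurable_funX; rewrite /inc.
      rewrite [X in measurable_fun _ X](_ : _ = fun e =>
         \sum_(k < K) (if (K <= a.+1 + k < K + M)%N then dev_at (s + (a.+1 + k - K)) k e w else 0)); last first.
        by apply/funext => z; rewrite big_mkcond.
      apply: measurable_sum => k; case: (K <= a.+1 + k < K + M)%N / boolP => h; last exact: measurable_cst.
      exact: dev_at_measurable1.
    by move=> e; rewrite normrX lerXn2r ?nnegrE ?addr_ge0 ?mulr_ge0//; exact: inc_bound.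
  - exact: eq_integrable (integrableD measurableT I0' I1).
  - move=> e _; rewrite /inc (bigID (fun k : 'I_K => (k : nat) == k0))/= d0E.
    set d1 := (X in d0 e + X); have := d1b e; rewrite -/d1 => b1.
    have : d1 ^+ 2 <= (C * Sc * (`|e| + m1)) ^+ 2.
      rewrite -[d1 ^+ 2]real_normK ?num_real// lerXn2r ?nnegrE//.
      exact: le_trans b1.
    rewrite !exprMn; have := sqr_ge0 (d0 e - d1); rewrite sqrrB sqrrD; lra.
rewrite RintegralD// RintegralZl// RintegralZl//.
rewrite lerD2r ler_wpM2l// /d0.
case: (cond k0 && _); last first.
  by under eq_Rintegral do rewrite expr0n; rewrite /= Rintegral_cst// mul0r.
apply: (le_trans (deviation_sqr _ _ _ _)); first exact: phi_test.
by have [_ h _] := tphi; exact: h.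
Qed.

Definition window_dev (s M K : nat) (w : T) : R := \sum_(i < M)
  (phi (ma_tail eps c (s + i)%N%:Z 0 w) - smear_iter mu c K phi (ma_tail eps c (s + i)%N%:Z K w)).

Lemma window_dev_measurable s M K : measurable_fun [set: T] (window_dev s M K).
Proof.
apply: measurable_sum => i; apply: measurable_funB.
  exact: (measurableT_comp (phi_test 0).1 (ma_tail_measurable _ _ _ _)).
exact: (measurableT_comp (phi_test K).1 (ma_tail_measurable _ _ _ _)).
Qed.

(** Stated on the convergence set: elsewhere the totalized tails need not obey the recursion in [k]
    behind the telescoping. *)
Lemma window_devE s M K w :
  (forall i : nat, cvgn (series (fun l : nat => c l * eps (i%:Z - l%:Z) w))) ->
  window_dev s M K w =
  \sum_(a < M + K) inc s M K a (eps ((s.+1)%:Z - K%:Z + a%:Z) w) w.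
Proof.
move=> cw.
pose g k i := smear_iter mu c k phi (ma_tail eps c (s + i)%N%:Z k w) -
   smear_iter mu c k.+1 phi (ma_tail eps c (s + i)%N%:Z k.+1 w).
transitivity (\sum_(i < M) \sum_(k < K) g k i).
  apply: eq_bigr => i _.
  have := telescope_sumr (fun k => smear_iter mu c k phi (ma_tail eps c (s + i)%N%:Z k w)) (leq0n K).
  rewrite -(big_mkord xpredT (g ^~ i)) /= -[RHS]opprB => /(congr1 (@GRing.opp R)).
  by rewrite opprK => <-; rewrite -sumrN; apply: eq_bigr => k _; rewrite /g opprB.
rewrite exchange_big/=.
transitivity (\sum_(k < K) \sum_(a < M + K)
   (if (K <= a.+1 + k < K + M)%N then g k (a.+1 + k - K)%N else 0)).
  by apply: eq_bigr => k _; rewrite big_shift_window.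
rewrite exchange_big/=; apply: eq_bigr => a _; rewrite /inc [RHS]big_mkcond.
apply: eq_bigr => k _; case: ifP => // h.
rewrite /g /dev_at /deviation /=; congr (smear_iter _ _ _ _ _ - _).
set i := (s + _)%N.
(* The innovation of lag [k] at position [i] is the one numbered [a] in the regrouped sum. *)
have -> : (s.+1)%:Z - K%:Z + a%:Z = i%:Z - k%:Z by rewrite /i; lia.
have /cvg_ex[S cS'] := cw i.
rewrite !(ma_tailE _ cS') big_nat_recr//= opprD addrA subrK.
by [].
Qed.

(** [M] positions and [K] lags meet at most [M + K] innovations, hence the factor in the
    exponent. *)
Lemma mgf_window (s M K : nat) (lam : R) :
  {ae P, forall w, forall i : nat, cvgn (series (fun l : nat => c l * eps (i%:Z - l%:Z) w))} ->
  `|lam| * (1 + C * K%:R) <= 2^-1 ->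
  (\int[P]_w (expR (lam * window_dev s M K w))%:E <=
   (expR (2 * lam ^+ 2 * (2 * C + 2 * (C * Sc) ^+ 2 * m2) * (M + K)%:R))%:E)%E.
Proof.
move=> cw lb.
apply: le_trans (mgf_chain heps (j0 := (s.+1)%:Z - K%:Z) (D := inc s M K) (@inc_measurable s M K)
  (@inc_bound s M K) (@inc_mean s M K) (@inc_sqr s M K) lb (M + K)).
rewrite (@ge0_ae_eq_integral _ _ _ P setT _
   (fun w => (expR (lam * \sum_(a < M + K) inc s M K a (eps ((s.+1)%:Z - K%:Z + a%:Z) w) w))%:E))//.
- apply/measurable_EFinP; apply: measurableT_comp => //; apply: measurable_funM => //.
  exact: window_dev_measurable.
- apply/measurable_EFinP; apply: measurableT_comp => //; apply: measurable_funM => //.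
  have h := chain_measurable (j0 := (s.+1)%:Z - K%:Z) (D := inc s M K) (@inc_measurable s M K) (n := M + K).
  exact: (past_measurable_T h).
- by apply: filterS cw => w cw _; rewrite window_devE.
Qed.

End Increments.

(** * Means, and the error of centering *)

Section Means.
Context (R : realType) (d : measure_display) (T : measurableType d)
  (P : probability T R) (eps : int -> {RV P >-> R}) (c : nat -> R).
Hypothesis heps : iid eps.

Let mu := distribution P (eps 1%:Z).
Let m1 := \int[mu]_e `|e|.

Hypothesis mu1 : mu.-integrable setT (EFin \o (fun e : R => e)).
Hypothesis cvge : {ae P, forall w, forall i : nat,
  cvgn (series (fun l : nat => c l * eps (i%:Z - l%:Z) w))}.

Variable r : nat -> R.
Hypothesis cr : forall K m, \sum_(l < m) `|c (K + l)%N| <= r K.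

Lemma m1_ge0 : 0 <= m1. Proof. exact: Rintegral_ge0. Qed.

Lemma r_ge0 K : 0 <= r K.
Proof. by have := cr K 0; rewrite big_ord0. Qed.

Lemma integral_eps_norm (j : int) : (\int[P]_w (`|eps j w|)%:E = m1%:E)%E.
Proof.
have -> : (\int[P]_w (`|eps j w|)%:E = \int[distribution P (eps j)]_e (`|e|)%:E)%E.
  rewrite ge0_integral_distribution//.
  by apply/measurable_EFinP; exact: normr_measurable.
have -> : (\int[distribution P (eps j)]_e (`|e|)%:E = \int[mu]_e (`|e|)%:E)%E.
  by apply: eq_measure_integral => A mA _; have [_ hid] := heps; exact: hid.
by rewrite /m1 /Rintegral fineK//; exact: integrable_fin_num (normr_integrable mu1).
Qed.

(** Almost surely the tail is dominated by the series of its absolute terms, which is integrated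
    term by term. *)
Lemma integral_ma_tail (i K : nat) :
  (\int[P]_w (`|ma_tail eps c i%:Z K w|)%:E <= (m1 * r K)%:E)%E.
Proof.
pose f (l : nat) (w : T) := (`|c (K + l)%N| * `|eps (i%:Z - (K + l)%N%:Z) w|)%:E.
have mf l : measurable_fun [set: T] (f l).
  by apply/measurable_EFinP; apply: measurable_funM => //; apply: measurableT_comp.
have f0 l w : (0 <= f l w)%E by rewrite lee_fin mulr_ge0.
apply: (@le_trans _ _ (\int[P]_w (\sum_(l <oo) f l w))%E).
  apply: ae_ge0_le_integral => //.
  - by apply/measurable_EFinP; apply: measurableT_comp => //; exact: ma_tail_measurable.
  - by move=> w _; apply: nneseries_ge0.
  - by apply: ge0_emeasurable_sum.
  apply: filterS cvge => w cw _.
  have /cvg_ex[/= S cS] := cw i.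
  have h : (fun m => (`|\sum_(0 <= l < m) c (K + l)%N * eps (i%:Z - (K + l)%N%:Z) w|)%:E) @ \oo -->
     (`|ma_tail eps c i%:Z K w|)%:E.
    apply: cvg_EFin; first exact: nearW.
    apply: (@cvg_norm _ _ _ _ _ (fun m => \sum_(0 <= l < m) c (K + l)%N * eps (i%:Z - (K + l)%N%:Z) w)).
    rewrite (ma_tailE K cS).
    move: cS; rewrite -(cvg_shiftn K) /= => cS.
    pose F l := c l * eps (i%:Z - l%:Z) w.
    rewrite (_ : (fun m : nat => _) = (fun m => series F (m + K)%N - \sum_(0 <= l < K) F l)).
      exact: cvgB cS (cvg_cst _).
    apply/funext => m; rewrite /series/= (@big_cat_nat _ _ _ K _ (m + K)) ?leq_addl//=.
    rewrite addrAC subrr add0r.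
    have := big_addn 0 (m + K)%N K xpredT F; rewrite add0n addnK => ->.
    by apply: eq_bigr => l _; rewrite addnC.
  rewrite -(cvg_lim _ h)//.
  apply: lee_lim.
  - by apply/cvg_ex; eexists; exact: h.
  - by apply: is_cvg_nneseries.
  apply: nearW => m; rewrite sumEFin lee_fin.
  apply: (le_trans (ler_norm_sum _ _ _)); apply: ler_sum => l _.
  by rewrite normrM.
rewrite integral_nneseries//.
apply: lime_le.
  by apply: is_cvg_nneseries => l _ _; apply: integral_ge0.
apply: nearW => m.
rewrite (eq_bigr (fun l => (m1 * `|c (K + l)%N|)%:E)); last first.
  move=> l _; rewrite /f.
  under eq_integral do rewrite EFinM.
  rewrite ge0_integralZl//; last first.
    by apply/measurable_EFinP; apply: measurableT_comp.
  by rewrite integral_eps_norm -EFinM mulrC.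
rewrite sumEFin lee_fin -mulr_sumr ler_wpM2l ?m1_ge0// big_mkord.
exact: cr.
Qed.

Lemma ma_tail_norm_measurable (i K : nat) :
  measurable_fun [set: T] (fun w => `|ma_tail eps c i%:Z K w|).
Proof. by apply: measurableT_comp => //; exact: ma_tail_measurable. Qed.

Lemma ma_tail_integrable (i K : nat) :
  P.-integrable setT (EFin \o (fun w => `|ma_tail eps c i%:Z K w|)).
Proof.
apply/integrableP; split; first by apply/measurable_EFinP; exact: ma_tail_norm_measurable.
under eq_integral do rewrite /= normr_id.
by apply: (le_lt_trans (integral_ma_tail i K)); rewrite ltry.
Qed.

Lemma Rintegral_ma_tail (i K : nat) :
  \int[P]_w `|ma_tail eps c i%:Z K w| <= m1 * r K.
Proof.
rewrite -lee_fin /Rintegral fineK; first exact: integral_ma_tail.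
exact: integrable_fin_num (ma_tail_integrable i K).
Qed.

Lemma ma_tailS w (i k : nat) :
  (forall i : nat, cvgn (series (fun l : nat => c l * eps (i%:Z - l%:Z) w))) ->
  ma_tail eps c i%:Z k w = ma_tail eps c i%:Z k.+1 w + c k * eps (i%:Z - k%:Z) w.
Proof.
move=> cw; have /cvg_ex[S cS] := cw i.
by rewrite !(ma_tailE _ cS) big_nat_recr//= opprD addrA subrK.
Qed.

Section OneTestFunction.
Variable phi : R -> R.
Hypothesis tphi : test_function phi.

Let psi k := smear_iter mu c k phi.

Let psi_test k : test_function (psi k).
Proof. exact: smear_iter_test. Qed.

Let psi_tail_measurable (k i : nat) :
  measurable_fun [set: T] (fun w => psi k (ma_tail eps c i%:Z k w)).
Proof. exact: (measurableT_comp (psi_test k).1 (ma_tail_measurable _ _ _ _)). Qed.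

(** Tower property, one lag per step: by [past_fubini] the innovation of lag [k] is averaged out
    inside the expectation. *)
Lemma smear_iter_mean (i k : nat) :
  \int[P]_w phi (ma_tail eps c i%:Z 0 w) = \int[P]_w psi k (ma_tail eps c i%:Z k w).
Proof.
elim: k => [|k ->]; first by [].
rewrite /Rintegral; congr (fine _).
pose Psi (z : R * past eps (i%:Z - k%:Z)) :=
  (psi k (ma_tail eps c i%:Z k.+1 z.2 + c k * z.1))%:E.
have psi0 k' y : 0 <= psi k' y by have [_ /(_ y)/andP[]] := psi_test k'.
have mPsi : measurable_fun [set: R * past eps (i%:Z - k%:Z)] Psi.
  apply/measurable_EFinP; apply: (measurableT_comp (psi_test k).1).
  apply: measurable_funD; last by apply: measurable_funM => //; exact: measurable_fst.
  have h : measurable_fun [set: past eps (i%:Z - k%:Z)]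
      (ma_tail eps c i%:Z k.+1 : past eps (i%:Z - k%:Z) -> R).
    by apply: ma_tail_past; lia.
  exact: (measurableT_comp h (@measurable_snd _ _ _ _)).
transitivity (\int[P]_w Psi (eps (i%:Z - k%:Z) w, w))%E.
  apply: ge0_ae_eq_integral => //.
  - by apply/measurable_EFinP; exact: psi_tail_measurable.
  - have mp : measurable_fun [set: T]
      (fun w : T => (eps (i%:Z - k%:Z) w, w : past eps (i%:Z - k%:Z))).
      exact: past_pair_measurable.
    exact: (measurableT_comp mPsi mp).
  - by move=> w _; rewrite lee_fin.
  - by move=> w _; rewrite lee_fin.
  - by apply: filterS cvge => w cw _; rewrite /Psi/= -ma_tailS.
rewrite (past_fubini heps)//; last by move=> z; rewrite lee_fin.
by apply: eq_integral => w _; rewrite /psi/= smear_EFin//; exact: (psi_test k).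
Qed.

Variables (C : R) (k0 : nat).
Hypothesis tame_phi : tame mu c k0 C phi.

Lemma mean_approx (i K : nat) : (k0 < K)%N ->
  `|\int[P]_w phi (ma_tail eps c i%:Z 0 w) - psi K 0| <= C * (m1 * r K).
Proof.
move=> kK; have C0 := tame_ge0 tame_phi.
rewrite (smear_iter_mean i K).
have [_ lip] := smear_iter_tame tame_phi kK.
have I1 : P.-integrable setT (EFin \o (fun w => psi K (ma_tail eps c i%:Z K w))).
  by apply: (bounded_integrable (C := 1)) => // w; exact: test_norm.
rewrite -[X in _ - X](Rintegral_prob_cst P) -RintegralB//; last exact: integrable_prob_cst.
have I2 : P.-integrable setT (EFin \o (fun w => psi K (ma_tail eps c i%:Z K w) - psi K 0)).
  exact: eq_integrable (integrableB measurableT I1 (integrable_prob_cst (psi K 0))).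
apply: (le_trans (le_normr_Rintegral _ I2)) => //.
apply: (@le_trans _ _ (\int[P]_w (C * `|ma_tail eps c i%:Z K w|))).
  apply: le_Rintegral => //.
  - exact: integrable_norm I2.
  - exact: eq_integrable (integrableZl measurableT C (ma_tail_integrable i K)).
  - by move=> w _; apply: (le_trans (lip _ _)); rewrite subr0.
rewrite RintegralZl//; last exact: ma_tail_integrable.
by apply: ler_wpM2l => //; exact: Rintegral_ma_tail.
Qed.

(** Both terms are compared with the constant [psi K 0]; the mean can therefore be taken at time 1
    for every [i], without recourse to stationarity. *)
Lemma centering_error (i K : nat) w : (k0 < K)%N ->
  `|psi K (ma_tail eps c i%:Z K w) - \int[P]_w phi (ma_tail eps c 1%:Z 0 w)| <=
  C * (`|ma_tail eps c i%:Z K w| + m1 * r K).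
Proof.
move=> kK; have C0 := tame_ge0 tame_phi.
have [_ lip] := smear_iter_tame tame_phi kK.
have h1 := mean_approx 1 kK.
have := lip (ma_tail eps c i%:Z K w) 0; rewrite subr0 => h2.
rewrite -(subrKA (psi K 0)) mulrDr; apply: (le_trans (ler_normD _ _)).
by apply: lerD => //; rewrite distrC.
Qed.

End OneTestFunction.

End Means.

(* Summability of the means makes [Z n] tend to 0 almost surely: Markov's inequality and the
   Borel-Cantelli lemma in one step, for sums of exponentials over a family of events. *)
Lemma ae_eventually_le1 d (T : measurableType d) (R : realType) (P : probability T R)
    (Z : nat -> T -> R) (u : nat -> R) (U : R) (n1 : nat) :
  (forall n, measurable_fun [set: T] (Z n)) -> (forall n w, 0 <= Z n w) ->
  (forall n, (n1 <= n)%N -> (\int[P]_w (Z n w)%:E <= (u n)%:E)%E) ->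
  (forall m, \sum_(n < m) u (n1 + n)%N <= U) ->
  {ae P, forall w, exists n0, forall n, (n0 <= n)%N -> Z n w <= 1}.
Proof.
move=> mZ Z0 Zu uU.
pose F w : \bar R := (\sum_(n <oo) (Z (n1 + n)%N w)%:E)%E.
have F0 w : (0 <= F w)%E by apply: nneseries_ge0 => n _ _; rewrite lee_fin.
have mF : measurable_fun setT F.
  apply: ge0_emeasurable_sum => [n w _ _|n _]; first by rewrite lee_fin.
  exact/measurable_EFinP.
have IF : P.-integrable setT F.
  apply/integrableP; split => //.
  under eq_integral do rewrite gee0_abs//.
  rewrite /F integral_nneseries//=; last 2 first.
  - by move=> n; exact/measurable_EFinP.
  - by move=> n w _; rewrite lee_fin.
  apply: (@le_lt_trans _ _ U%:E); last exact: ltry.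
  apply: lime_le.
    by apply: is_cvg_nneseries => l _ _; apply: integral_ge0 => w _; rewrite lee_fin.
  apply: nearW => m; apply: (@le_trans _ _ (\sum_(0 <= i < m) (u (n1 + i)%N)%:E)%E).
    by apply: lee_sum => i _; apply: Zu; exact: leq_addr.
  by rewrite sumEFin lee_fin big_mkord.
have := integrable_ae measurableT IF.
apply: filterS => w /(_ Logic.I) Fw.
pose z k := Z (n1 + k)%N w.
have zS m : series z m <= fine (F w).
  rewrite -lee_fin fineK// /series/= -sumEFin /F.
  have := @nneseries_lim_ge R (fun k => (Z (n1 + k)%N w)%:E) xpredT 0 m.
  by apply => k _ _; rewrite lee_fin.
have cz : cvgn (series z).
  apply: nondecreasing_is_cvgn; last by exists (fine (F w)) => _ [m _ <-].
  by apply: nondecreasing_series => k _ _; exact: Z0.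
have /cvgr0_norm_le/(_ _ ltr01)[N _ hN] := cvg_series_cvg_0 cz.
exists (n1 + N)%N => n nN.
have := hN (n - n1)%N; rewrite /= /z subnKC; last by lia.
rewrite ger0_norm//; apply; lia.
Qed.

Lemma geometric_sum_le (R : realType) (x : R) m : 0 <= x -> x < 1 ->
  \sum_(i < m) x ^+ i <= (1 - x)^-1.
Proof.
move=> x0 x1; rewrite -[leRHS]mul1r ler_pdivlMr ?subr_gt0// mulrC.
by rewrite -[1 - x]opprB mulNr -subrX1 opprB gerBl exprn_ge0.
Qed.

(** * Almost sure bounds for families of sums *)

Section UniformDeviations.
Context (R : realType) (d : measure_display) (T : measurableType d)
  (P : probability T R) (eps : int -> {RV P >-> R}) (c : nat -> R).
Hypothesis heps : iid eps.

Let mu := distribution P (eps 1%:Z).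
Let m1 := \int[mu]_e `|e|.
Let m2 := \int[mu]_e (`|e| + m1) ^+ 2.

Hypothesis mu1 : mu.-integrable setT (EFin \o (fun e : R => e)).
Hypothesis mu2 : mu.-integrable setT (EFin \o (fun e : R => (`|e| + m1) ^+ 2)).
Hypothesis cvge : {ae P, forall w, forall i : nat,
  cvgn (series (fun l : nat => c l * eps (i%:Z - l%:Z) w))}.

Variable r : nat -> R.
Hypothesis cr : forall K m, \sum_(l < m) `|c (K + l)%N| <= r K.

Variable k0 : nat.
Hypothesis ck0 : forall k, (k < k0)%N -> c k = 0.

Definition var_factor C : R := 2 * C + 2 * (C * r 0) ^+ 2 * m2.

Let cS K : \sum_(k < K) `|c k| <= r 0.
Proof. exact: (cr 0 K). Qed.

Section Families.
(** At level [n]: [L n] indexes finitely many test functions and windows, [lam] is the parameter of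
    the exponentials, [t] the threshold, and [u] a summable bound for the total mean of the
    exponentials. *)
Variables (I : eqType) (L : nat -> seq I) (phi : nat -> I -> R -> R)
  (s M : nat -> I -> nat) (K Mx : nat -> nat) (C lam t u : nat -> R) (U : R) (n1 : nat).
Hypothesis tameL : forall n x, (n1 <= n)%N -> x \in L n ->
  tame mu c k0 (C n) (phi n x) /\ (M n x <= Mx n)%N.
Hypothesis lam0 : forall n, (n1 <= n)%N -> 0 < lam n.
Hypothesis lamK : forall n, (n1 <= n)%N -> lam n * (1 + C n * (K n)%:R) <= 2^-1.
Hypothesis Lu : forall n, (n1 <= n)%N ->
  (size (L n))%:R * (2 * expR (2 * lam n ^+ 2 * var_factor (C n) * (Mx n + K n)%:R - lam n * t n)) <= u n.
Hypothesis uU : forall m, \sum_(n < m) u (n1 + n)%N <= U.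

Let W n x w := window_dev eps c (phi n x) (s n x) (M n x) (K n) w.

(** Chernoff's bound and the union bound in a single variable: if it is at most 1, so is each of its
    exponentials, and [|W n x w| <= t n] for all [x] at once. *)
Let Z n w := \sum_(x <- L n)
  (expR (lam n * (W n x w - t n)) + expR (lam n * (- W n x w - t n))).

Let W_measurable n x : (n1 <= n)%N -> x \in L n -> measurable_fun [set: T] (W n x).
Proof.
by move=> nn xL; have [tx _] := tameL nn xL; exact: window_dev_measurable tx _ _ _.
Qed.

Let mgf_W (b : bool) n x : (n1 <= n)%N -> x \in L n ->
  (\int[P]_w (expR (lam n * ((-1) ^+ b * W n x w - t n)))%:E <=
   (expR (2 * lam n ^+ 2 * var_factor (C n) * (Mx n + K n)%:R - lam n * t n))%:E)%E.
Proof.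
move=> nn xL; have [tx Mle] := tameL nn xL.
have C0 := tame_ge0 tx.
have m20 : 0 <= m2 by apply: Rintegral_ge0 => e _; exact: sqr_ge0.
have lb : `|(-1) ^+ b * lam n| * (1 + C n * (K n)%:R) <= 2^-1.
  by rewrite normrM normrX normrN1 expr1n mul1r gtr0_norm ?lam0//; exact: lamK.
have h := mgf_window heps mu1 mu2 ck0 cS tx (s n x) (M n x) cvge lb.
under eq_integral => w _.
  have -> : lam n * ((-1) ^+ b * W n x w - t n) = - (lam n * t n) + (-1) ^+ b * lam n * W n x w by ring.
  rewrite expRD EFinM; over.
rewrite ge0_integralZl//; last first.
  apply/measurable_EFinP; apply: measurableT_comp => //; apply: measurable_funM => //.
  exact: W_measurable.
apply: (le_trans (lee_wpmul2l _ h)); first by rewrite lee_fin expR_ge0.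
rewrite -EFinM -expRD lee_fin ler_expR addrC lerD2r.
rewrite exprMn -exprM mulnC exprM sqrrN expr1n expr1n mul1r.
rewrite -/m1 -/m2 -/(var_factor (C n)) ler_wpM2l ?ler_nat ?leq_add2r//.
have vf0 : 0 <= var_factor (C n).
  by apply: addr_ge0; [exact: mulr_ge0|rewrite mulr_ge0// mulr_ge0// sqr_ge0].
by rewrite mulr_ge0// mulr_ge0// sqr_ge0.
Qed.

Let exp_measurable (b : bool) n x : (n1 <= n)%N -> x \in L n ->
  measurable_fun [set: T] (fun w => expR (lam n * ((-1) ^+ b * W n x w - t n))).
Proof.
move=> nn xL; apply: measurableT_comp => //; apply: measurable_funM => //.
by apply: measurable_funB => //; apply: measurable_funM => //; exact: W_measurable.
Qed.

Let ZE n w : Z n w = \sum_(x <- L n) (expR (lam n * ((-1) ^+ false * W n x w - t n)) +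
  expR (lam n * ((-1) ^+ true * W n x w - t n))).
Proof. by apply: eq_bigr => x _; rewrite expr0 expr1 mul1r mulN1r. Qed.

Let Z_measurable_integral n : (n1 <= n)%N -> measurable_fun [set: T] (Z n) /\
  (\int[P]_w (Z n w)%:E <= (u n)%:E)%E.
Proof.
move=> nn.
have -> : Z n = fun w => \sum_(x <- L n) (expR (lam n * ((-1) ^+ false * W n x w - t n)) +
  expR (lam n * ((-1) ^+ true * W n x w - t n))) by apply/funext => w; exact: ZE.
suff [h1 h2] : measurable_fun [set: T] (fun w => \sum_(x <- L n) (expR (lam n * ((-1) ^+ false * W n x w - t n)) +
  expR (lam n * ((-1) ^+ true * W n x w - t n)))) /\
  (\int[P]_w (\sum_(x <- L n) (expR (lam n * ((-1) ^+ false * W n x w - t n)) +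
  expR (lam n * ((-1) ^+ true * W n x w - t n))))%:E <=
  ((size (L n))%:R * (2 * expR (2 * lam n ^+ 2 * var_factor (C n) * (Mx n + K n)%:R - lam n * t n)))%:E)%E.
  by split => //; apply: (le_trans h2); rewrite lee_fin; exact: Lu.
set E := expR (2 * _ ^+ 2 * _ * _ - _).
have : {subset L n <= L n} by [].
(* Induction on an arbitrary list included in [L n], so that the hypotheses on members of [L n]
   remain available. *)
elim: {1 3 4 5}(L n) => [|x l IH] sub.
  split; first by under eq_fun do rewrite big_nil; exact: measurable_cst.
  by under eq_integral do rewrite big_nil; rewrite integral0 mul0r.
have xL : x \in L n by apply: sub; rewrite mem_head.
have [h1 h2] : measurable_fun [set: T] (fun w => \sum_(x <- l) (expR (lam n * ((-1) ^+ false * W n x w - t n)) +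
  expR (lam n * ((-1) ^+ true * W n x w - t n)))) /\
  (\int[P]_w (\sum_(x <- l) (expR (lam n * ((-1) ^+ false * W n x w - t n)) +
  expR (lam n * ((-1) ^+ true * W n x w - t n))))%:E <= ((size l)%:R * (2 * E))%:E)%E.
  by apply: IH => y yl; apply: sub; rewrite inE yl orbT.
have mf := exp_measurable false nn xL.
have mt := exp_measurable true nn xL.
split.
  under eq_fun do rewrite big_cons.
  by apply: measurable_funD => //; exact: measurable_funD.
under eq_integral do rewrite big_cons EFinD EFinD.
rewrite ge0_integralD//; last 4 first.
- by move=> w _; rewrite -EFinD lee_fin addr_ge0 ?expR_ge0.
- by apply: emeasurable_funD; exact/measurable_EFinP.
- by move=> w _; rewrite lee_fin; apply: sumr_ge0 => y _; rewrite addr_ge0 ?expR_ge0.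
- exact/measurable_EFinP.
rewrite ge0_integralD//; last 2 first.
- exact/measurable_EFinP.
- exact/measurable_EFinP.
have -> : ((size (x :: l))%:R * (2 * E))%:E = (E%:E + E%:E + ((size l)%:R * (2 * E))%:E)%E.
  rewrite -!EFinD; congr (_%:E); rewrite /= -[(size l).+1%:R]natr1; ring.
by apply: leeD => //; apply: leeD; exact: mgf_W.
Qed.

Lemma eventually_window : {ae P, forall w, exists n0, forall n, (n0 <= n)%N ->
  forall x, x \in L n -> `|W n x w| <= t n}.
Proof.
have := @ae_eventually_le1 _ _ _ P (fun n => Z (n1 + n)%N) (fun n => u (n1 + n)%N) U 0.
have mZ n : measurable_fun setT (Z (n1 + n)%N) by have [] := Z_measurable_integral (leq_addr n n1).
have Z0 n w : 0 <= Z n w by apply: sumr_ge0 => x _; rewrite addr_ge0 ?expR_ge0.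
move=> /(_ mZ (fun n => Z0 _)).
move=> /(_ (fun n _ => proj2 (Z_measurable_integral (leq_addr _ _)))) /(_ uU).
apply: filterS => w [n0 hn0]; exists (n1 + n0)%N => n nn x xL.
have := hn0 (n - n1)%N; rewrite subnKC; last by lia.
have n1n : (n1 <= n)%N by lia.
move=> /(_ (_ : (n0 <= n - n1)%N)) Zle; have {Zle} := Zle ltac:(lia).
rewrite /Z (big_rem x)//= => Zle.
have l0 := lam0 n1n.
have rest : 0 <= \sum_(y <- rem x (L n))
   (expR (lam n * (W n y w - t n)) + expR (lam n * (- W n y w - t n))).
  by apply: sumr_ge0 => y _; rewrite addr_ge0 ?expR_ge0.
have e1 := expR_gt0 (lam n * (W n x w - t n)).
have e2 := expR_gt0 (lam n * (- W n x w - t n)).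
have : expR (lam n * (W n x w - t n)) <= 1 by lra.
have : expR (lam n * (- W n x w - t n)) <= 1 by lra.
rewrite -expR0 !ler_expR !pmulr_rle0// ler_norml; lra.
Qed.

End Families.

Definition emp_sum (phi : R -> R) (s M : nat) (w : T) : R := \sum_(i < M)
  (phi (ma_tail eps c (s + i)%N%:Z 0 w) - \int[P]_w' phi (ma_tail eps c 1%:Z 0 w')).

Lemma emp_sum_window (phi : R -> R) (C : R) (s M K : nat) w :
  tame mu c k0 C phi -> (k0 < K)%N ->
  `|emp_sum phi s M w - window_dev eps c phi s M K w| <=
  C * (\sum_(i < M) `|ma_tail eps c (s + i)%N%:Z K w| + M%:R * (m1 * r K)).
Proof.
move=> tphi kK; have [tp _ _] := tphi.
rewrite /emp_sum /window_dev -sumrB; apply: (le_trans (ler_norm_sum _ _ _)).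
have -> : C * (\sum_(i < M) `|ma_tail eps c (s + i)%N%:Z K w| + M%:R * (m1 * r K)) =
  \sum_(i < M) C * (`|ma_tail eps c (s + i)%N%:Z K w| + m1 * r K).
  by rewrite -mulr_sumr big_split/= sumr_const card_ord mulr_natl.
apply: ler_sum => i _.
rewrite [X in `|X|](_ : _ = smear_iter mu c K phi (ma_tail eps c (s + i)%N%:Z K w) -
  \int[P]_w' phi (ma_tail eps c 1%:Z 0 w')); last by ring.
exact: (centering_error heps mu1 cvge cr tp tphi).
Qed.

Variable B : R.
Hypothesis rB : forall n, r (4 ^ n) <= B * 8^-1 ^+ n.

Let q : R := Num.sqrt 32.

Let q0 : 0 < q. Proof. by rewrite sqrtr_gt0. Qed.

Let q4 : 4 / q < 1.
Proof.
rewrite ltr_pdivrMr// mul1r -(@ltr_pXn2r _ 2)// ?nnegrE//; last exact: ltW.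
by rewrite sqr_sqrtr//; lra.
Qed.

Let B0 : 0 <= B.
Proof. by have := rB 0; rewrite expr0 mulr1; apply: le_trans; exact: r_ge0 cr _. Qed.

Let m10 : 0 <= m1. Proof. exact: Rintegral_ge0. Qed.

(** 32^n times 8^-n is 4^n, written as a geometrically small multiple of [q ^+ n], the square root
    of the sample size. *)
Lemma tail_rate n : (32 ^ n)%N%:R * r (4 ^ n) <= B * (4 / q) ^+ n * q ^+ n.
Proof.
rewrite -mulrA -exprMn divfK ?gt_eqF//.
apply: (le_trans (ler_wpM2l _ (rB n))) => //.
rewrite mulrCA ler_wpM2l// natrX -exprMn lerXn2r ?nnegrE//; lra.
Qed.

Lemma sum_ma_tail_integral (n m : nat) K :
  (\int[P]_w (\sum_(i < m) `|ma_tail eps c (i : nat)%:Z K w|)%:E <= (m%:R * (m1 * r K))%:E)%E.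
Proof.
under eq_integral do rewrite -sumEFin.
rewrite ge0_integral_sum//; last first.
  by move=> i; apply/measurable_EFinP; exact: ma_tail_norm_measurable.
apply: (@le_trans _ _ (\sum_(i < m) (m1 * r K)%:E)%E).
  by apply: lee_sum => i _; exact: integral_ma_tail.
by rewrite sumEFin sumr_const card_ord mulr_natl.
Qed.

(** Divided by [q ^+ n], the sum has a mean of order [(4 / q) ^+ n], which is summable. The range
    [33 * 32 ^ n] contains every window used later: sample sizes go up to [32 * 32 ^ n], and a
    window added after them has length at most [32 ^ n]. *)
Lemma eventually_tail_sum : {ae P, forall w, exists n0, forall n, (n0 <= n)%N ->
  \sum_(i < 33 * 32 ^ n) `|ma_tail eps c (i : nat)%:Z (4 ^ n) w| <= q ^+ n}.
Proof.
pose Z n w := (q ^+ n)^-1 * \sum_(i < 33 * 32 ^ n) `|ma_tail eps c (i : nat)%:Z (4 ^ n) w|.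
have qn0 n : 0 < q ^+ n by rewrite exprn_gt0.
have mS n : measurable_fun [set: T] (fun w => \sum_(i < 33 * 32 ^ n) `|ma_tail eps c (i : nat)%:Z (4 ^ n) w|).
  by apply: measurable_sum => i; exact: ma_tail_norm_measurable.
have := @ae_eventually_le1 _ _ _ P Z (fun n => 33 * m1 * B * (4 / q) ^+ n) (33 * m1 * B / (1 - 4 / q)) 0.
have mZ n : measurable_fun setT (Z n) by apply: measurable_funM.
have Z0 n w : 0 <= Z n w by rewrite mulr_ge0 ?invr_ge0 ?sumr_ge0// ltW.
move=> /(_ mZ Z0) H; apply: filterS (H _ _) => [w [n0 hn0]|n _|m].
- by exists n0 => n /hn0; rewrite /Z ler_pdivrMl// mulr1.
- rewrite /Z; under eq_integral do rewrite EFinM.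
  rewrite ge0_integralZl//; last 3 first.
  + exact/measurable_EFinP.
  + by move=> w _; rewrite lee_fin sumr_ge0.
  + by rewrite lee_fin invr_ge0 ltW.
  apply: (le_trans (lee_wpmul2l _ (sum_ma_tail_integral n _ _))).
    by rewrite lee_fin invr_ge0 ltW.
  rewrite -EFinM lee_fin ler_pdivrMl// natrM.
  have := tail_rate n => /(ler_wpM2l (mulr_ge0 (ler0n R 33) m10)).
  set X := (32 ^ n)%:R; lra.
- under eq_bigr do rewrite add0n.
  rewrite -mulr_sumr ler_wpM2l ?mulr_ge0//.
  have x1 : 0 < 1 - 4 / q by rewrite subr_gt0.
  by apply: geometric_sum_le => //; rewrite divr_ge0// ltW.
Qed.

(** [emp_sum] differs from its martingale part by the tails left after 4^n lags; weighted by the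
    Lipschitz constant [C n], they cost at most the order of [C n * q ^+ n]. *)
Lemma eventually_emp_sum (I : eqType) (L : nat -> seq I) (phi : nat -> I -> R -> R)
  (s M : nat -> I -> nat) (Mx : nat -> nat) (C lam t u : nat -> R) (U : R) (n1 : nat) :
  (forall n x, (n1 <= n)%N -> x \in L n ->
    [/\ tame mu c k0 (C n) (phi n x), (M n x <= Mx n)%N & (s n x + M n x <= 33 * 32 ^ n)%N]) ->
  (forall n, (n1 <= n)%N -> 0 < lam n) ->
  (forall n, (n1 <= n)%N -> lam n * (1 + C n * (4 ^ n)%:R) <= 2^-1) ->
  (forall n, (n1 <= n)%N -> (size (L n))%:R *
     (2 * expR (2 * lam n ^+ 2 * var_factor (C n) * (Mx n + 4 ^ n)%:R - lam n * t n)) <= u n) ->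
  (forall m, \sum_(n < m) u (n1 + n)%N <= U) ->
  {ae P, forall w, exists n0, forall n, (n0 <= n)%N -> forall x, x \in L n ->
    `|emp_sum (phi n x) (s n x) (M n x) w| <= t n + C n * ((1 + 33 * m1 * B) * q ^+ n)}.
Proof.
move=> tameL lam0 lamK Lu uU.
have tL n x : (n1 <= n)%N -> x \in L n -> tame mu c k0 (C n) (phi n x) /\ (M n x <= Mx n)%N.
  by move=> nn xL; have [] := tameL n x nn xL.
have ev1 := eventually_window s tL lam0 lamK Lu uU.
have ev2 := eventually_tail_sum.
near=> w.
have [n2 h2] : exists n0, forall n, (n0 <= n)%N -> forall x, x \in L n ->
   `|window_dev eps c (phi n x) (s n x) (M n x) (4 ^ n) w| <= t n by near: w.
have [n3 h3] : exists n0, forall n, (n0 <= n)%N ->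
  \sum_(i < 33 * 32 ^ n) `|ma_tail eps c (i : nat)%:Z (4 ^ n) w| <= q ^+ n by near: w.
exists (n1 + (n2 + (n3 + k0)))%N => n nn x xL.
have [nn1 nn2 nn3 nk0] : [/\ n1 <= n, n2 <= n, n3 <= n & k0 <= n]%N by clear -nn; split; lia.
have [tx _ sM] := tameL n x nn1 xL.
have k0n : (k0 < 4 ^ n)%N by apply: leq_ltn_trans (ltn_expl n (isT : (1 < 4)%N)).
have a1 := h2 n nn2 x xL.
have a2 := h3 n nn3.
have a3 := emp_sum_window (s n x) (M n x) w tx k0n.
have C0 := tame_ge0 tx.
have MN : (M n x <= 33 * 32 ^ n)%N by apply: leq_trans sM; exact: leq_addl.
have sN : (s n x <= 33 * 32 ^ n)%N by apply: leq_trans sM; exact: leq_addr.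
have a5 : (M n x)%:R * (m1 * r (4 ^ n)) <= 33 * m1 * B * q ^+ n.
  apply: (@le_trans _ _ ((33 * 32 ^ n)%N%:R * (m1 * r (4 ^ n)))).
    by rewrite ler_wpM2r ?ler_nat// mulr_ge0//; exact: r_ge0 cr _.
  have := tail_rate n => /(ler_wpM2l (mulr_ge0 (ler0n R 33) m10)).
  have : 33 * m1 * (B * (4 / q) ^+ n * q ^+ n) <= 33 * m1 * (B * q ^+ n).
    apply: ler_wpM2l; first exact: mulr_ge0.
    apply: ler_wpM2r; first by rewrite exprn_ge0// ltW.
    by rewrite ler_piMr// exprn_ile1 ?divr_ge0 ?(ltW q4)// ltW.
  rewrite natrM; set X := (32 ^ n)%:R; set Y := r _; lra.
have a4 : \sum_(i < M n x) `|ma_tail eps c (s n x + i)%N%:Z (4 ^ n) w| <= q ^+ n.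
  apply: le_trans a2; move: sM sN; set N := (33 * 32 ^ n)%N => sM sN.
  rewrite -(big_mkord xpredT (fun i => `|ma_tail eps c i%:Z (4 ^ n) w|)).
  rewrite (@big_cat_nat _ _ _ (s n x))//=.
  rewrite (@big_cat_nat _ _ _ (s n x + M n x) (s n x))//= ?leq_addr//.
  have -> : \sum_(s n x <= i < s n x + M n x) `|ma_tail eps c i%:Z (4 ^ n) w| =
    \sum_(i < M n x) `|ma_tail eps c (s n x + i)%N%:Z (4 ^ n) w|.
    rewrite -{1}[s n x]add0n big_addn addKn big_mkord.
    by apply: eq_bigr => i _; rewrite addnC.
  by rewrite addrCA lerDl addr_ge0// sumr_ge0.
have := ler_wpM2l C0 (lerD a4 a5) => a6.
rewrite -[emp_sum _ _ _ _](subrK (window_dev eps c (phi n x) (s n x) (M n x) (4 ^ n) w)).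
apply: (le_trans (ler_normD _ _)); rewrite addrC; apply: lerD => //.
apply: (le_trans a3); apply: (le_trans a6).
by rewrite (_ : (1 + 33 * m1 * B) * q ^+ n = q ^+ n + 33 * m1 * B * q ^+ n)// mulrDl mul1r.
Unshelve. all: by end_near. Qed.

End UniformDeviations.

(** * Smoothness of the marginal distribution *)

Section RealAnalysis.
Context (R : realType).
Implicit Types f df : R -> R.

Lemma lipschitz_of_derivative f df (M : R) :
  (forall x : R, is_derive x 1 f (df x)) -> (forall x, `|df x| <= M) ->
  forall x y, `|f x - f y| <= M * `|x - y|.
Proof.
move=> fd dfM.
have H x y : x <= y -> `|f y - f x| <= M * `|y - x|.
  move=> xy.
  have fc : {within `[x, y], continuous f}.
    by apply: derivable_within_continuous => z _; have [] := fd z.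
  have [z _ ->] := MVT_segment xy (fun z _ => fd z) fc.
  by rewrite normrM ler_wpM2r.
move=> x y; have [xy|/ltW yx] := leP x y; last exact: H.
by rewrite distrC [X in M * X]distrC; exact: H.
Qed.

Lemma is_derive_quadratic f (x k M : R) :
  (forall h, `|f (x + h) - f x - k * h| <= M * h ^+ 2) -> is_derive x 1 f k.
Proof.
move=> fM.
have M0 : 0 <= M by have := fM 1; rewrite expr1n !mulr1; apply: le_trans; exact: normr_ge0.
suff h : (fun h : R => h^-1 *: (f (h *: 1 + x) - f x)) @ 0^' --> k.
  apply: DeriveDef; first by apply/cvg_ex; exists k.
  by apply/cvg_lim => //; exact: h.
apply/cvgrPdist_le => e e0; near=> h.
have h0 : h != 0 by near: h; exact: nbhs_dnbhs_neq.
have hh := fM h.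
rewrite -[k](mulfK h0) -[_ *: _]/(h^-1 * _) [h^-1 * _]mulrC -mulrBl normrM.
rewrite normfV ler_pdivrMr ?normr_gt0//.
rewrite scaler1 [h + x]addrC distrC; apply: (le_trans hh).
rewrite -real_normK ?num_real// expr2 mulrA ler_wpM2r//.
have : `|h| <= e / (M + 1).
  near: h; apply: dnbhs0_le; rewrite divr_gt0//; lra.
rewrite ler_pdivlMr; last lra.
have := normr_ge0 h; nra.
Unshelve. all: by end_near. Qed.

(** Mean value bound for t |-> f (t + h') - f t, whose derivative is at most [M * |h'|]. *)
Lemma second_difference f df (M : R) :
  (forall x : R, is_derive x 1 f (df x)) -> (forall x y, `|df x - df y| <= M * `|x - y|) ->
  forall x h h', `|f (x + h + h') - f (x + h) - (f (x + h') - f x)| <= M * `|h| * `|h'|.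
Proof.
move=> fd dfM x h h'.
pose g (t : R) := f (t + h') - f t.
have gd (t : R) : is_derive t 1 g (df (t + h') - df t).
  have d1 : is_derive t 1 (fun u => f (u + h')) (df (t + h')).
    have ds : is_derive t 1 (fun u : R => u + h') 1.
      by have := is_deriveD (is_derive_id (t : R) (1 : R)) (is_derive_cst (h' : R) (t : R) 1); rewrite addr0.
    have := @is_derive1_comp R f (fun u : R => u + h') t (df (t + h')) 1 (fd _) ds.
    by rewrite mulr1.
  exact: is_deriveB d1 (fd t).
have gb t : `|df (t + h') - df t| <= M * `|h'|.
  by apply: (le_trans (dfM _ _)); rewrite addrAC subrr add0r.
have := lipschitz_of_derivative gd gb (x + h) x.
have -> : x + h - x = h by ring.
by rewrite /g mulrAC.
Qed.

End RealAnalysis.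

Section SmoothCdf.
Context (R : realType).
Implicit Types (G g : R -> R) (M : R).

(** Inequalities rather than derivatives, as they survive averaging with no differentiation under
    the integral. [smooth_lip] controls the size of the averaged indicator of an interval,
    [smooth_diff2] its Lipschitz constant, and [smooth_taylor] yields the expansion of the marginal
    distribution function. *)
Record smooth_cdf M G g : Prop := SmoothCdf {
  smooth_lip : forall x y, `|G x - G y| <= M * `|x - y|;
  smooth_diff2 : forall x h h',
    `|G (x + h + h') - G (x + h) - (G (x + h') - G x)| <= M * `|h| * `|h'|;
  smooth_taylor : forall x h, `|G (x + h) - G x - g x * h| <= M * h ^+ 2;
  smooth_measurable : measurable_fun [set: R] g;
  smooth_bound : forall x, `|g x| <= M }.

Lemma smooth_cdf_ge0 M G g : smooth_cdf M G g -> 0 <= M.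
Proof. by move=> sG; apply: le_trans (smooth_bound sG 0); exact: normr_ge0. Qed.

Lemma smooth_of_taylor M G g : measurable_fun [set: R] g ->
  (forall x, `|g x| <= M) -> (forall x y, `|g x - g y| <= M * `|x - y|) ->
  (forall x h, `|G (x + h) - G x - g x * h| <= M * h ^+ 2) -> smooth_cdf M G g.
Proof.
move=> mg gM gl Gt.
have Gd (x : R) : is_derive x 1 G (g x) by apply: is_derive_quadratic (Gt x).
split => //; first exact: lipschitz_of_derivative Gd gM.
exact: second_difference Gd gl.
Qed.

Lemma smooth_scale M G g (a : R) : a != 0 -> smooth_cdf M G g ->
  smooth_cdf (M * (`|a| + `|a| ^+ 2)) (fun u => G (a * u)) (fun u => a * g (a * u)).
Proof.
move=> a0 sG; have M0 := smooth_cdf_ge0 sG; have n0 := normr_ge0 a.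
have n20 : 0 <= `|a| ^+ 2 by rewrite sqr_ge0.
split.
- move=> x y; apply: (le_trans (smooth_lip sG _ _)).
  rewrite -mulrBr normrM mulrA; apply: ler_wpM2r => //.
  by apply: ler_wpM2l; rewrite ?lerDl.
- move=> x h h'; rewrite !mulrDr; apply: (le_trans (smooth_diff2 sG _ _ _)).
  rewrite !normrM.
  have -> : M * (`|a| * `|h|) * (`|a| * `|h'|) = M * `|a| ^+ 2 * `|h| * `|h'| by ring.
  do 2 (apply: ler_wpM2r; first by []).
  by rewrite lerDr mulr_ge0.
- move=> x h; rewrite mulrDr mulrAC [a * h * _]mulrC.
  apply: (le_trans (smooth_taylor sG _ _)).
  have -> : M * (a * h) ^+ 2 = M * `|a| ^+ 2 * h ^+ 2.
    by rewrite exprMn real_normK ?num_real// mulrA.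
  by apply: ler_wpM2r; [exact: sqr_ge0|apply: ler_wpM2l; rewrite ?lerDr].
- apply: measurable_funM => //; apply: (measurableT_comp (smooth_measurable sG)).
  exact: measurable_funM.
- move=> x; rewrite normrM mulrDr; have := smooth_bound sG (a * x); nra.
Qed.

Lemma smooth_1B M G g : smooth_cdf M G g ->
  smooth_cdf M (fun u => 1 - G u) (fun u => - g u).
Proof.
move=> sG; split.
- move=> x y; have -> : 1 - G x - (1 - G y) = - (G x - G y) by ring.
  by rewrite normrN; exact: smooth_lip sG _ _.
- move=> x h h'; have := smooth_diff2 sG x h h'; rewrite -normrN.
  by congr (`|_| <= _); ring.
- move=> x h; have := smooth_taylor sG x h; rewrite -normrN.
  by congr (`|_| <= _); ring.
- apply: measurableT_comp => //; exact: smooth_measurable sG.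
- by move=> x; rewrite normrN; exact: smooth_bound sG _.
Qed.

End SmoothCdf.

Section Density.
Context (R : realType) (mu : probability R R) (f : R -> R).
Hypothesis mf : measurable_fun [set: R] f.
Hypothesis f0 : forall x, 0 <= f x.
Hypothesis fE : forall A, measurable A -> mu A = (\int[lebesgue_measure]_(x in A) (f x)%:E)%E.

Definition dist_fun (v : R) : R := fine (mu `]-oo, v]%classic).

Lemma dist_funB v v' : v <= v' -> dist_fun v' - dist_fun v = fine (mu `]v, v']%classic).
Proof.
move=> vv'; rewrite /dist_fun.
have -> : `]-oo, v']%classic = `]-oo, v]%classic `|` `]v, v']%classic.
  by rewrite -itv_bndbnd_setU// bnd_simp.
rewrite measureU//; last first.
  by apply/seteqP; split => // x /= []; rewrite !in_itv/= => xv /andP[/(le_lt_trans xv)]; rewrite ltxx.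
by rewrite fineD ?fin_num_measure// addrAC subrr add0r.
Qed.

Lemma dist_fun_increment v v' a b : v <= v' ->
  (forall u, v < u <= v' -> a <= f u <= b) ->
  a * (v' - v) <= dist_fun v' - dist_fun v <= b * (v' - v).
Proof.
move=> vv' fab; have [->|vv] := eqVneq v v'; first by rewrite !subrr !mulr0 lexx.
have {vv} ltv : v < v' by rewrite lt_neqAle vv.
have fv' := fab v' ltac:(by rewrite ltv lexx).
have b0 : 0 <= b by have := f0 v'; lra.
have leb (k : R) : (\int[lebesgue_measure]_(x in `]v, v']%classic) (k%:E))%E = (k * (v' - v))%:E.
  by rewrite integral_cst//= lebesgue_measure_itv/= lte_fin ltv -EFinD.
rewrite dist_funB// -[a * _]/(fine (a * (v' - v))%:E) -[b * _]/(fine (b * (v' - v))%:E).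
apply/andP; split.
  have [a0|a0] := leP 0 a; last first.
    apply: (@le_trans _ _ 0); last exact: fine_ge0.
    by rewrite /= mulr_le0_ge0 ?subr_ge0// ltW.
  rewrite fine_le ?fin_num_measure// fE// -leb.
  apply: ge0_le_integral => //.
  - by apply/measurable_EFinP; exact: measurable_funS mf.
  - by move=> x /=; rewrite in_itv/= => xv; rewrite lee_fin; have /andP[] := fab x xv.
rewrite fine_le ?fin_num_measure// fE// -leb.
apply: ge0_le_integral => //.
- by move=> x _; rewrite lee_fin.
- by apply/measurable_EFinP; exact: measurable_funS mf.
- by move=> x /=; rewrite in_itv/= => xv; rewrite lee_fin; have /andP[] := fab x xv.
Qed.

Lemma dist_fun_smooth (M : R) : (forall x, f x <= M) ->
  (forall x y, `|f x - f y| <= M * `|x - y|) -> smooth_cdf M dist_fun f.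
Proof.
move=> fM fl; apply: smooth_of_taylor => //.
  by move=> x; rewrite ger0_norm.
have M0 : 0 <= M by apply: le_trans (fM 0).
move=> v h; have [h0|/ltW h0] := leP 0 h.
- have vh : v <= v + h by rewrite lerDl.
  have fb u : v < u <= v + h -> f v - M * h <= f u <= f v + M * h.
    move=> /andP[vu uh]; have := fl u v; rewrite (gtr0_norm (_ : 0 < u - v)) ?subr_gt0//.
    have : M * (u - v) <= M * h by rewrite ler_wpM2l// lerBlDl.
    by rewrite ler_norml; lra.
  have := dist_fun_increment vh fb; rewrite addrAC subrr add0r => /andP[b1 b2].
  by rewrite ler_norml; apply/andP; split; lra.
- have vh : v + h <= v by rewrite gerDl.
  have fb u : v + h < u <= v -> f v + M * h <= f u <= f v - M * h.
    move=> /andP[vu uh]; have := fl u v; rewrite (ler0_norm (_ : u - v <= 0)) ?subr_le0//.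
    have : M * - (u - v) <= M * - h by rewrite ler_wpM2l// lerN2; lra.
    by rewrite ler_norml; lra.
  have := dist_fun_increment vh fb; rewrite opprD addrA subrr add0r => /andP[b1 b2].
  by rewrite ler_norml; apply/andP; split; lra.
Qed.

Lemma mu_set1 v : mu [set v] = 0.
Proof.
by rewrite fE// integral_set1.
Qed.

End Density.

(** * Indicators of half-lines and intervals *)

Section TestFunctions.
Context (R : realType).

Definition below (x : R) : R -> R := fun y => (y <= x)%R%:R.
Definition band (x1 x2 : R) : R -> R := fun y => (x1 < y <= x2)%R%:R.

Lemma bool_unit_interval (b : bool) : 0 <= (b%:R : R) <= 1.
Proof. by case: b; rewrite /= ?ler01 ?lexx ?ler01. Qed.

Lemma below_test x : test_function (below x).
Proof.
split; last by move=> y; rewrite /below; exact: bool_unit_interval.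
rewrite (_ : below x = \1_(`]-oo, x]%classic)); last first.
  by apply/funext => y; rewrite indicE/= /below mem_setE in_itv.
by apply: measurable_indic.
Qed.

Lemma bandE x1 x2 y : x1 <= x2 -> band x1 x2 y = below x2 y - below x1 y.
Proof.
move=> x12; rewrite /band /below; have [yx1|x1y] := leP y x1 => /=.
  by rewrite (le_trans yx1 x12) subrr.
by rewrite subr0.
Qed.

Lemma band_test x1 x2 : x1 <= x2 -> test_function (band x1 x2).
Proof.
move=> x12; split; last by move=> y; rewrite /band; exact: bool_unit_interval.
rewrite (_ : band x1 x2 = fun y => below x2 y - below x1 y).
  by apply: measurable_funB; [exact: (below_test x2).1|exact: (below_test x1).1].
by apply/funext => y; rewrite bandE.
Qed.

Variables (mu : probability R R) (c : nat -> R) (k0 : nat).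
Hypothesis ck0 : forall k, (k < k0)%N -> c k = 0.
Hypothesis ck0n : c k0 != 0.

(** Distribution function of [c k0] times an innovation. Averaging up to the lag [k0] turns the
    indicator of the half-line ending at x into y |-> first_dist (x - y). *)
Definition first_dist (u : R) : R := fine (mu [set e | c k0 * e <= u]).

Lemma smear_iter_first phi k : test_function phi -> (k <= k0)%N -> smear_iter mu c k phi = phi.
Proof.
by move=> tphi; elim: k => //= k IH kk; rewrite IH ?(ltnW kk)// ck0// smear0.
Qed.

Lemma first_dist_measurable u : measurable [set e | c k0 * e <= u].
Proof.
by rewrite -[X in measurable X]setTI; apply: measurable_fun_le => //; exact: measurable_funM.
Qed.

Lemma smear_below x y : smear_iter mu c k0.+1 (below x) y = first_dist (x - y).
Proof.
rewrite /= smear_iter_first//; last exact: below_test.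
apply: EFin_inj; rewrite smear_EFin; last exact: below_test.
have mS := first_dist_measurable (x - y).
rewrite /first_dist fineK ?fin_num_measure// -[X in mu X]setIT -integral_indic//.
apply: eq_integral => e _; rewrite indicE /below; congr ((nat_of_bool _)%:R)%:E.
by apply/idP/idP; rewrite inE /= lerBrDl.
Qed.

Lemma smear_band x1 x2 y : x1 <= x2 ->
  smear_iter mu c k0.+1 (band x1 x2) y = first_dist (x2 - y) - first_dist (x1 - y).
Proof.
move=> x12; rewrite -!smear_below /= !smear_iter_first//; [|exact: below_test..|exact: band_test].
rewrite /smear -RintegralB//; [|exact/test_shift_integrable/below_test..].
by apply: eq_Rintegral => e _; exact: bandE.
Qed.

Variables (MG : R) (g : R -> R).
Hypothesis sG : smooth_cdf MG first_dist g.

Lemma below_tame x : tame mu c k0 (1 + MG) (below x).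
Proof.
have MG0 := smooth_cdf_ge0 sG.
split; first exact: below_test.
  move=> y; have [_ /(_ y)/andP[_ h]] := smear_iter_test mu c k0.+1 (below_test x).
  by apply: (le_trans h); rewrite lerDl.
move=> y y'; rewrite !smear_below; apply: (le_trans (smooth_lip sG _ _)).
have -> : x - y - (x - y') = - (y - y') by ring.
by rewrite normrN ler_wpM2r// lerDr.
Qed.

(** The averaged indicator is an increment of [first_dist] over the step [x2 - x1]: first
    differences bound its size and second differences its Lipschitz constant, both in proportion to
    the length. *)
Lemma band_tame x1 x2 : x1 <= x2 -> tame mu c k0 (MG * (x2 - x1)) (band x1 x2).
Proof.
move=> x12.
have n12 : `|x2 - x1| = x2 - x1 by rewrite ger0_norm// subr_ge0.
split; first exact: band_test.
  move=> y; rewrite smear_band//; apply: (le_trans (ler_norm _)).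
  apply: (le_trans (smooth_lip sG _ _)).
  have -> : x2 - y - (x1 - y) = x2 - x1 by ring.
  by rewrite n12.
move=> y y'; rewrite !smear_band//.
have := smooth_diff2 sG (x1 - y') (x2 - x1) (y' - y); rewrite n12 [`|y' - y|]distrC.
have -> : x1 - y' + (x2 - x1) + (y' - y) = x2 - y by ring.
have -> : x1 - y' + (x2 - x1) = x2 - y' by ring.
have -> : x1 - y' + (y' - y) = x1 - y by ring.
by rewrite opprB addrACA [- _ + _]addrC opprB -opprB addrACA opprB.
Qed.

End TestFunctions.

Section FirstDist.
Context (R : realType) (mu : probability R R) (c : nat -> R) (k0 : nat) (f : R -> R) (M : R).
Hypothesis ck0n : c k0 != 0.
Hypothesis mf : measurable_fun [set: R] f.
Hypothesis f0 : forall x, 0 <= f x.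
Hypothesis fE : forall A, measurable A -> mu A = (\int[lebesgue_measure]_(x in A) (f x)%:E)%E.
Hypothesis fM : forall x, f x <= M.
Hypothesis fl : forall x y, `|f x - f y| <= M * `|x - y|.

Lemma first_dist_smooth : exists MG g, smooth_cdf MG (first_dist mu c k0) g.
Proof.
have sK := dist_fun_smooth mf f0 fE fM fl.
have a0 : (c k0)^-1 != 0 by rewrite invr_eq0.
have sS := smooth_scale a0 sK.
have [c0|c0|c0] := ltgtP (c k0) 0; last by have := ck0n; rewrite c0 eqxx.
- exists (M * (`|(c k0)^-1| + `|(c k0)^-1| ^+ 2)), (fun u => - ((c k0)^-1 * f ((c k0)^-1 * u))).
  rewrite (_ : first_dist _ _ _ = fun u => 1 - dist_fun mu ((c k0)^-1 * u)); first exact: smooth_1B sS.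
  apply/funext => u; rewrite /first_dist /dist_fun.
  set v := (c k0)^-1 * u.
  (* Dividing by [c k0 < 0] reverses the inequality: the event is the complement of an open
     half-line, which differs from the closed one by a null point. *)
  have -> : [set e | c k0 * e <= u] = ~` `]-oo, v[%classic.
    apply/seteqP; split => e /=; rewrite in_itv/= => h.
      by apply/negP; rewrite -leNgt /v ler_ndivrMl.
    by move: h => /negP; rewrite -leNgt /v ler_ndivrMl.
  have -> : `]-oo, v]%classic = `]-oo, v[%classic `|` [set v].
    apply/seteqP; split => e /=; rewrite !in_itv/= le_eqVlt.
      by case/orP => [/eqP->|ev]; [right|left].
    by case=> [->|->]; rewrite ?orbT ?eqxx.
  have -> : mu (`]-oo, v[%classic `|` [set v]) = mu `]-oo, v[%classic.
    rewrite measureU//; last first.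
      by apply/seteqP; split => // e /= []; rewrite in_itv/= => /[swap] ->; rewrite ltxx.
    rewrite -[RHS]adde0; congr (_ + _)%E; exact: (mu_set1 fE v).
  by rewrite probability_setC// fineB ?fin_num_measure.
- exists (M * (`|(c k0)^-1| + `|(c k0)^-1| ^+ 2)), (fun u => (c k0)^-1 * f ((c k0)^-1 * u)).
  rewrite (_ : first_dist _ _ _ = fun u => dist_fun mu ((c k0)^-1 * u))//.
  apply/funext => u; rewrite /first_dist /dist_fun; congr (fine (mu _)).
  apply/seteqP; split => e /=; rewrite in_itv/=.
    by rewrite ler_pdivlMl.
  by rewrite ler_pdivlMl.
Qed.

End FirstDist.

(** * The marginal distribution function *)

Section Marginal.
Context (R : realType) (d : measure_display) (T : measurableType d)
  (P : probability T R) (eps : int -> {RV P >-> R}) (c : nat -> R).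
Hypothesis heps : iid eps.

Let mu := distribution P (eps 1%:Z).

Hypothesis mu1 : mu.-integrable setT (EFin \o (fun e : R => e)).

Hypothesis cvge : {ae P, forall w, forall i : nat,
  cvgn (series (fun l : nat => c l * eps (i%:Z - l%:Z) w))}.
Variable k0 : nat.
Hypothesis ck0 : forall k, (k < k0)%N -> c k = 0.
Variables (MG : R) (g : R -> R).
Hypothesis sG : smooth_cdf MG (first_dist mu c k0) g.

(** Taken along the measurable version of the series, to which the averaging lemmas apply;
    [marginal_cdf] identifies it with the distribution function of [X1]. *)
Definition marginal (x : R) : R := \int[P]_w below x (ma_tail eps c 1%:Z 0 w).

Let Y := ma_tail eps c 1%:Z k0.+1.

Let mY : measurable_fun [set: T] Y.
Proof. exact: ma_tail_measurable. Qed.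

Lemma marginalE x : marginal x = \int[P]_w first_dist mu c k0 (x - Y w).
Proof.
rewrite /marginal (smear_iter_mean heps mu1 cvge (below_test x) 1 k0.+1).
by apply: eq_Rintegral => w _; rewrite smear_below.
Qed.

Lemma first_dist_shift_integrable x :
  P.-integrable setT (EFin \o (fun w => first_dist mu c k0 (x - Y w))).
Proof.
have h := smear_iter_test mu c k0.+1 (below_test x).
have I : P.-integrable setT (EFin \o (fun w => smear_iter mu c k0.+1 (below x) (Y w))).
  apply: (bounded_integrable (C := 1)); first exact: (measurableT_comp h.1 mY).
  by move=> w; exact: test_norm h.
by apply: eq_integrable I => // w _ /=; rewrite -smear_below.
Qed.

Lemma marginal_lipschitz x y : `|marginal x - marginal y| <= MG * `|x - y|.
Proof.
have I1 := first_dist_shift_integrable x; have I2 := first_dist_shift_integrable y.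
have I3 : P.-integrable setT (EFin \o (fun w => first_dist mu c k0 (x - Y w) - first_dist mu c k0 (y - Y w))).
  exact: eq_integrable (integrableB measurableT I1 I2).
rewrite !marginalE -RintegralB//; apply: (le_trans (le_normr_Rintegral _ I3)) => //.
rewrite -[leRHS](Rintegral_prob_cst P); apply: le_Rintegral => //.
- exact: integrable_norm I3.
- exact: integrable_prob_cst.
- move=> w _; apply: (le_trans (smooth_lip sG _ _)).
  by have -> : x - Y w - (y - Y w) = x - y by ring.
Qed.

Definition marginal_slope (x : R) : R := \int[P]_w g (x - Y w).

Lemma marginal_taylor x h :
  `|marginal (x + h) - marginal x - marginal_slope x * h| <= MG * h ^+ 2.
Proof.
have I1 := first_dist_shift_integrable x; have I2 := first_dist_shift_integrable (x + h).
have I3 : P.-integrable setT (EFin \o (fun w => first_dist mu c k0 (x + h - Y w) - first_dist mu c k0 (x - Y w))).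
  exact: eq_integrable (integrableB measurableT I2 I1).
have Ig : P.-integrable setT (EFin \o (fun w => g (x - Y w))).
  apply: (bounded_integrable (C := MG)).
    by apply: (measurableT_comp (smooth_measurable sG)); exact: measurable_funB.
  by move=> w; exact: smooth_bound sG _.
have Ig' : P.-integrable setT (EFin \o (fun w => g (x - Y w) * h)).
  exact: eq_integrable (integrableZr measurableT h Ig).
have I4 : P.-integrable setT (EFin \o (fun w => first_dist mu c k0 (x + h - Y w) - first_dist mu c k0 (x - Y w) - g (x - Y w) * h)).
  exact: eq_integrable (integrableB measurableT I3 Ig').
rewrite !marginalE /marginal_slope -RintegralZr// -RintegralB// -RintegralB//.
apply: (le_trans (le_normr_Rintegral _ I4)) => //.
rewrite -[leRHS](Rintegral_prob_cst P); apply: le_Rintegral => //.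
- exact: integrable_norm I4.
- exact: integrable_prob_cst.
- move=> w _; have := smooth_taylor sG (x - Y w) h.
  by have -> : x - Y w + h = x + h - Y w by ring.
Qed.

Lemma band_mean x1 x2 : x1 <= x2 ->
  \int[P]_w band x1 x2 (ma_tail eps c 1%:Z 0 w) = marginal x2 - marginal x1.
Proof.
move=> x12; rewrite /marginal -RintegralB//; last 2 first.
- apply: (bounded_integrable (C := 1)) => [|w]; last exact: test_norm (below_test _).
  exact: (measurableT_comp (below_test _).1 (ma_tail_measurable _ _ _ _)).
- apply: (bounded_integrable (C := 1)) => [|w]; last exact: test_norm (below_test _).
  exact: (measurableT_comp (below_test _).1 (ma_tail_measurable _ _ _ _)).
by apply: eq_Rintegral => w _; rewrite bandE.
Qed.

Variables (X1 : {RV P >-> R}) (f : R -> R).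
Hypothesis X1E : {ae P, forall w, X1 w = ma_tail eps c 1%:Z 0 w}.

Lemma marginal_cdf x : (marginal x)%:E = cdf X1 x.
Proof.
rewrite /cdf /distribution /pushforward /marginal /Rintegral.
have mX : measurable (X1 @^-1` `]-oo, x]) by rewrite -[X in measurable X]setTI; exact: measurable_funPT.
have -> : (\int[P]_w (below x (ma_tail eps c 1%:Z 0 w))%:E)%E = P (X1 @^-1` `]-oo, x]).
  rewrite -[X in P X]setIT -integral_indic//; apply: ge0_ae_eq_integral => //.
  - apply/measurable_EFinP; exact: (measurableT_comp (below_test _).1 (ma_tail_measurable _ _ _ _)).
  - by apply/measurable_EFinP; exact: measurable_indic.
  - by move=> w _; rewrite lee_fin; have /andP[] := (below_test x).2 (ma_tail eps c 1%:Z 0 w).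
  apply: filterS X1E => w <- _; rewrite indicE /below; congr ((nat_of_bool _)%:R)%:E.
  by apply/idP/idP; rewrite inE /= in_itv.
by rewrite fineK// fin_num_measure.
Qed.

Hypothesis hf : has_density X1 f.

Lemma marginal_dist_fun x : marginal x = dist_fun (distribution P X1) x.
Proof. by apply: EFin_inj; rewrite marginal_cdf /dist_fun fineK// fin_num_measure. Qed.

(** The density [f] is an arbitrary version, but where it is continuous it is the derivative of the
    distribution function. The increment over a short step to the right of [x] is estimated both
    through [f] and through [marginal_taylor]. *)
Lemma marginal_slopeE x : {for x, continuous f} -> marginal_slope x = f x.
Proof.
move=> fc; have [mf f0 fE] := hf.
have MG0 := smooth_cdf_ge0 sG.
suff H e : 0 < e -> `|marginal_slope x - f x| <= e.
  apply/eqP; rewrite -subr_eq0 -normr_le0; apply/ler_addgt0Pl => e e0.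
  by rewrite addr0; exact: H.
move=> e0.
have e20 : 0 < e / 2 by rewrite divr_gt0.
have /cvgrPdist_le/(_ _ e20) /nbhs_ballP[del /= del0 hdel] := fc.
(* Half of [e] pays for the variation of [f] over the step, the other half for the Taylor error
   [MG * h]; [MG + 1] avoids a division by zero. *)
pose h := Num.min (del / 2) (e / 2 / (MG + 1)).
have h0 : 0 < h by rewrite lt_min !divr_gt0//; lra.
have hd : h <= del / 2 by rewrite ge_min lexx.
have hM : MG * h <= e / 2.
  have : h <= e / 2 / (MG + 1) by rewrite ge_min lexx orbT.
  rewrite ler_pdivlMr; last lra.
  nra.
have fb u : x < u <= x + h -> f x - e / 2 <= f u <= f x + e / 2.
  move=> /andP[xu uh]; have /= := hdel u.
  rewrite /ball/= ltr0_norm ?subr_lt0// => /(_ ltac:(lra)).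
  by rewrite ler_norml; lra.
have xh : x <= x + h by rewrite lerDl ltW.
have := dist_fun_increment mf f0 fE xh fb.
rewrite -!marginal_dist_fun addrAC subrr add0r => /andP[b1 b2].
have := marginal_taylor x h; rewrite ler_norml => /andP[t1 t2].
have b3 : `|(marginal_slope x - f x) * h| <= e * h.
  by rewrite ler_norml; apply/andP; split; nra.
by move: b3; rewrite normrM (gtr0_norm h0) ler_pM2r.
Qed.

End Marginal.

(** * The empirical process of the linear process *)

Section Numerics.
Context (R : realType).

(** With x = y^2, p x^p = (p y^p) y^p, where p y^p is at most a geometric sum and y^p tends to 0. *)
Lemma natr_expr_small (x kap e : R) : 0 < x -> x < 1 -> 0 < e ->
  exists p0, forall p, (p0 <= p)%N -> kap * (p%:R * x ^+ p) <= e.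
Proof.
move=> x0 x1 e0.
pose y := Num.sqrt x.
have y0 : 0 < y by rewrite sqrtr_gt0.
have y1 : y < 1 by rewrite -sqrtr1 ltr_sqrt.
have xy : x = y ^+ 2 by rewrite sqr_sqrtr// ltW.
have B p : p%:R * y ^+ p <= (1 - y)^-1.
  apply: le_trans (geometric_sum_le p (ltW y0) y1).
  rewrite -[X in X%:R](card_ord p) mulrC mulr_natr -sumr_const; apply: ler_sum => i _.
  by apply: ler_wiXn2l; [exact: ltW|exact: ltW|exact: ltnW].
have /cvgr0_norm_le : (fun p => `|kap| * (1 - y)^-1 * y ^+ p) @ \oo --> 0.
  have := @cvg_geometric R (`|kap| * (1 - y)^-1) y; apply.
  by rewrite ger0_norm ?ltW.
move=> /(_ _ e0)[p0 _ hp]; exists p0 => p pp.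
have := hp p pp; rewrite /= => /(le_trans (ler_norm _)); apply: le_trans.
have xp0 : 0 <= p%:R * x ^+ p by rewrite mulr_ge0// exprn_ge0// ltW.
apply: (@le_trans _ _ (`|kap| * (p%:R * x ^+ p))).
  by apply: ler_wpM2r => //; exact: ler_norm.
rewrite -mulrA ler_wpM2l// xy -exprM mul2n -addnn exprD mulrA.
by rewrite ler_wpM2r ?exprn_ge0// ltW.
Qed.

(* [sqrt32 ^+ p] is the square root of the sample size [32 ^ p]; as [4 / sqrt32 < 1], the [4 ^ p]
   lags averaged out are negligible with respect to it. *)
Definition sqrt32 : R := Num.sqrt 32.

Lemma sqrt32_gt0 : 0 < sqrt32. Proof. by rewrite sqrtr_gt0. Qed.

Lemma sqr_sqrt32 : sqrt32 ^+ 2 = 32. Proof. by rewrite sqr_sqrtr. Qed.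

Lemma four_sqrt32_gt0 : 0 < 4 / sqrt32. Proof. by rewrite divr_gt0// sqrt32_gt0. Qed.

Lemma four_sqrt32_lt1 : 4 / sqrt32 < 1.
Proof.
rewrite ltr_pdivrMr ?sqrt32_gt0// mul1r -(@ltr_pXn2r _ 2)// ?nnegrE//; last exact: ltW sqrt32_gt0.
by rewrite sqr_sqrt32; lra.
Qed.

Lemma sqrt32X_gt0 p : 0 < sqrt32 ^+ p. Proof. by rewrite exprn_gt0// sqrt32_gt0. Qed.

Lemma sqrt32X_sqr p : sqrt32 ^+ p * sqrt32 ^+ p = (32 ^ p)%N%:R.
Proof. by rewrite -exprMn -expr2 sqr_sqrt32 natrX. Qed.

Lemma sqrt32_ge1 : 1 <= sqrt32.
Proof. by have := four_sqrt32_lt1; rewrite ltr_pdivrMr ?sqrt32_gt0//; lra. Qed.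

Lemma sqrt32X_ge1 p : 1 <= sqrt32 ^+ p. Proof. by rewrite exprn_ege1// sqrt32_ge1. Qed.

Lemma four_sqrt32X p : (4 ^ p)%N%:R = (4 / sqrt32) ^+ p * sqrt32 ^+ p.
Proof. by rewrite -exprMn divfK ?gt_eqF ?sqrt32_gt0// natrX. Qed.

(** As p is of order ln n, this is of order (ln ln n)^(1/2). *)
Definition sqrt_ln (p : nat) : R := Num.sqrt (ln p%:R).

(** e <= 4, since the quadratic bound at 1/2 gives e^(1/2) <= 2. *)
Lemma ln_ge1 p : (4 <= p)%N -> 1 <= ln p%:R :> R.
Proof.
move=> p3; have p0 : 0 < p%:R :> R by rewrite ltr0n (leq_trans _ p3).
rewrite -[leLHS](@expRK R 1) ler_ln ?posrE ?expR_gt0//.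
apply: (@le_trans _ _ 4); last by rewrite ler_nat.
have h := @expR_le_quadratic R 2^-1 (lexx _).
have -> : (1 : R) = 2%:R * 2^-1 by rewrite mulfV.
rewrite expRM_natl expr2; have := expR_gt0 (2^-1 : R); nra.
Qed.

Lemma ln_le_id (p : nat) : ln p%:R <= p%:R :> R.
Proof.
case: p => [|p]; first by rewrite ln0.
by apply: ltW; apply: ln_sublinear; rewrite ltr0n.
Qed.

Lemma sqrt_ln_ge1 p : (4 <= p)%N -> 1 <= sqrt_ln p.
Proof. by move=> p3; rewrite -sqrtr1 ler_sqrt ?ln_ge1// (le_trans _ (ln_ge1 p3)). Qed.

Lemma sqrt_ln_sqr p : (4 <= p)%N -> sqrt_ln p * sqrt_ln p = ln p%:R.
Proof. by move=> p3; rewrite -expr2 sqr_sqrtr// (le_trans _ (ln_ge1 p3)). Qed.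

Lemma sqrt_ln_le p : (4 <= p)%N -> sqrt_ln p <= p%:R.
Proof.
move=> p3; have a1 := sqrt_ln_ge1 p3.
apply: le_trans (ln_le_id p); rewrite -(sqrt_ln_sqr p3); nra.
Qed.

Lemma pow32_le_expR p : (32 ^ p)%N%:R <= expR (5 * p%:R) :> R.
Proof.
rewrite [5 * _]mulrC expRM_natl natrX lerXn2r ?nnegrE ?expR_ge0//.
have e2 : 2 <= expR 1 :> R by have := @expR_ge1Dx R 1; lra.
rewrite -[X in expR X]mulr1 expRM_natl.
apply: (@le_trans _ _ (2 ^+ 5)); first by rewrite -natrX ler_nat.
by rewrite lerXn2r ?nnegrE ?expR_ge0.
Qed.

Lemma expRN_sum_le m n1 : \sum_(n < m) expR (- (n1 + n)%N%:R) <= 2 :> R.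
Proof.
have e2 : expR (- 1) <= 2^-1 :> R.
  by rewrite expRN lef_pV2 ?posrE ?expR_gt0//; have := @expR_ge1Dx R 1; lra.
apply: (@le_trans _ _ (\sum_(n < m) (2^-1 : R) ^+ n)).
  apply: ler_sum => n _; apply: (@le_trans _ _ (expR (- 1) ^+ n)).
    rewrite -expRM_natl mulrN1 ler_expR lerN2 ler_nat; exact: leq_addl.
  by rewrite lerXn2r ?nnegrE ?expR_ge0// invr_ge0.
have h : 1 - 2^-1 = 2^-1 :> R by lra.
by apply: (le_trans (geometric_sum_le m _ _)); [lra|lra|rewrite h invrK].
Qed.

Lemma inv_sqr_sum_le m n1 : (2 <= n1)%N -> \sum_(n < m) ((n1 + n)%N%:R ^+ 2)^-1 <= 1 :> R.
Proof.
move=> n2.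
(* Telescoping majorant: 1 / k^2 <= 1 / (k - 1) - 1 / k. *)
suff : \sum_(n < m) ((n1 + n)%N%:R ^+ 2)^-1 <= (n1%:R - 1)^-1 - ((n1 + m)%N%:R - 1)^-1 :> R.
  move=> h; apply: (le_trans h).
  have n1r : 2 <= n1%:R :> R by rewrite ler_nat.
  have : (n1%:R - 1 : R)^-1 <= 1 by rewrite invf_le1; lra.
  have : 0 <= ((n1 + m)%N%:R - 1 : R)^-1 by rewrite invr_ge0 natrD; have := ler0n R m; lra.
  by lra.
elim: m => [|m IH]; first by rewrite big_ord0 addn0 subrr.
rewrite big_ord_recr/=; apply: (le_trans (lerD IH (lexx _))).
have n1r : 2 <= n1%:R :> R by rewrite ler_nat.
set k : R := (n1 + m)%N%:R.
have k2 : 2 <= k by rewrite /k natrD; have := ler0n R m; lra.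
rewrite addnS -natr1 -/k addrK.
have -> : (k ^+ 2)^-1 = (k - 1)^-1 - k^-1 - ((k - 1)^-1 - k^-1 - (k ^+ 2)^-1) by ring.
have : 0 <= (k - 1)^-1 - k^-1 - (k ^+ 2)^-1.
  have -> : (k - 1)^-1 - k^-1 - (k ^+ 2)^-1 = ((k - 1) * k ^+ 2)^-1.
    by field; apply/andP; split; rewrite gt_eqF//; lra.
  by rewrite invr_ge0 mulr_ge0 ?sqr_ge0//; lra.
by lra.
Qed.

End Numerics.

(** * Deviations on finite grids *)

Section Oscillation.
Context (R : realType) (d : measure_display) (T : measurableType d)
  (P : probability T R) (eps : int -> {RV P >-> R}) (c : nat -> R).
Hypothesis heps : iid eps.

Let mu := distribution P (eps 1%:Z).
Let m1 := \int[mu]_e `|e|.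
Let m2 := \int[mu]_e (`|e| + m1) ^+ 2.

Hypothesis mu1 : mu.-integrable setT (EFin \o (fun e : R => e)).
Hypothesis mu2 : mu.-integrable setT (EFin \o (fun e : R => (`|e| + m1) ^+ 2)).
Hypothesis cvge : {ae P, forall w, forall i : nat,
  cvgn (series (fun l : nat => c l * eps (i%:Z - l%:Z) w))}.

Variable r : nat -> R.
Hypothesis cr : forall K m, \sum_(l < m) `|c (K + l)%N| <= r K.
Variable k0 : nat.
Hypothesis ck0 : forall k, (k < k0)%N -> c k = 0.
Variable B : R.
Hypothesis rB : forall n, r (4 ^ n) <= B * 8^-1 ^+ n.
Variables (MG : R) (g : R -> R).
Hypothesis sG : smooth_cdf MG (first_dist mu c k0) g.

Let V := 2 + 2 * (1 + MG) * r 0 ^+ 2 * m2.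
Let B' := 1 + 33 * m1 * B.

Let MG0 : 0 <= MG. Proof. exact: smooth_cdf_ge0 sG. Qed.
Let m20 : 0 <= m2. Proof. by apply: Rintegral_ge0 => e _; exact: sqr_ge0. Qed.
Let V0 : 0 <= V. Proof.
apply: addr_ge0 => //; apply: mulr_ge0 => //; apply: mulr_ge0; last exact: sqr_ge0.
by apply: mulr_ge0 => //; exact: addr_ge0.
Qed.

Lemma tame_le C C' phi : C <= C' -> tame mu c k0 C phi -> tame mu c k0 C' phi.
Proof.
move=> CC' [tp b l]; split => // [y|y y']; first exact: le_trans (b y) CC'.
by apply: (le_trans (l y y')); rewrite ler_wpM2r.
Qed.

(** For bounded [C] its square is absorbed: the variance is linear in [C], hence in the length of an
    interval. *)
Lemma var_factor_le C : 0 <= C -> C <= 1 + MG -> var_factor eps r C <= C * V.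
Proof.
move=> C0 CM; rewrite /var_factor -/mu -/m1 -/m2 /V.
have s0 : 0 <= r 0 ^+ 2 * m2 by rewrite mulr_ge0// sqr_ge0.
have h : C * (C * (r 0 ^+ 2 * m2)) <= C * ((1 + MG) * (r 0 ^+ 2 * m2)).
  by rewrite ler_wpM2l// ler_wpM2r.
by lra.
Qed.

Lemma var_factor_ge0 C : 0 <= C -> 0 <= var_factor eps r C.
Proof.
move=> C0; apply: addr_ge0; apply: mulr_ge0 => //.
by apply: mulr_ge0 => //; exact: sqr_ge0.
Qed.

Definition grid (L : nat) (p i : nat) : R := - L%:R + i%:R / (32 ^ p)%N%:R.

Lemma grid_le L p i k : grid L p i <= grid L p (i + k).
Proof. by rewrite lerD2l ler_wpM2r ?invr_ge0// ler_nat leq_addr. Qed.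

Lemma gridB L p i k : grid L p (i + k) - grid L p i = k%:R / (32 ^ p)%N%:R.
Proof. by rewrite /grid natrD mulrDl; ring. Qed.

Definition emp_dev n x w := emp_sum eps c (below x) 1 n w.

Lemma emp_dev_band n x1 x2 w : x1 <= x2 ->
  emp_sum eps c (band x1 x2) 1 n w = emp_dev n x2 w - emp_dev n x1 w.
Proof.
move=> x12; rewrite /emp_dev /emp_sum -sumrB; apply: eq_bigr => i _.
rewrite bandE// (band_mean eps c x12) /marginal; ring.
Qed.

Let N p : R := (32 ^ p)%N%:R.
Let N0 p : 0 < N p. Proof. by rewrite ltr0n expn_gt0. Qed.
Let N1 p : 1 <= N p. Proof. by rewrite ler1n expn_gt0. Qed.
Let four_le p : (4 ^ p)%N%:R <= N p. Proof. by rewrite /N !natrX lerXn2r ?nnegrE ?ler0n// ler_nat. Qed.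

(** Triples formed of a grid point, a number of cells and a sample size; in [time_grid] the last two
    become the length and the start of a window. Their number is of order (32^p)^3 <= e^(15 p),
    which a probability of order e^(-16 p) beats. *)
Let Lp (L : nat) (w_ : nat -> nat) p : seq (nat * nat * nat) :=
  [seq (x, n) | x <- [seq (i, k) | i <- iota 0 (2 * L * 32 ^ p).+1, k <- iota 0 (w_ p).+1],
    n <- iota 0 (32 * 32 ^ p).+1].

Let LpP L w_ p i k n : (((i, k), n) \in Lp L w_ p) =
  [&& i <= 2 * L * 32 ^ p, k <= w_ p & n <= 32 * 32 ^ p]%N.
Proof.
apply/allpairsPdep/and3P => [[x1 [n' [/allpairsPdep[i' [k' []]]]]]|[iL kw nN]].
  by rewrite !mem_iota !add0n !ltnS => iL kw -> nN [-> -> ->].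
exists (i, k), n; split; [|by rewrite mem_iota add0n ltnS|by []].
by apply/allpairsPdep; exists i, k; split; [rewrite mem_iota add0n ltnS..|by []].
Qed.

Let Lp_size L w_ p : (0 < w_ p <= 32 ^ p)%N ->
  (size (Lp L w_ p))%:R <= 66 * (2 * L%:R + 1) * expR (15 * p%:R) :> R.
Proof.
have hN : N p = (32 ^ p)%N%:R by [].
move=> /andP[w0 wN].
rewrite !size_allpairs !size_iota.
have : (N p ^+ 3) <= expR (15 * p%:R).
  have -> : 15 * p%:R = 3%:R * (5 * p%:R) :> R by ring.
  by rewrite expRM_natl lerXn2r ?nnegrE ?expR_ge0 ?ler0n ?pow32_le_expR// hN.
have wN' : (w_ p)%:R <= N p by rewrite hN ler_nat.
have N1p := N1 p; have Lp0 : 0 <= L%:R :> R by [].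
rewrite -[(2 * L * 32 ^ p).+1]addn1 -[(w_ p).+1]addn1 -[(32 * 32 ^ p).+1]addn1 !natrM !natrD !natrM -hN.
have b1 : 2 * L%:R * N p + 1 <= (2 * L%:R + 1) * N p by lra.
have b2 : (w_ p)%:R + 1 <= 2 * N p by lra.
have b3 : 32 * N p + 1 <= 33 * N p by lra.
move=> e3; apply: (@le_trans _ _ (66 * (2 * L%:R + 1) * N p ^+ 3)); last first.
  by apply: ler_wpM2l => //; rewrite mulr_ge0// addr_ge0// mulr_ge0.
have -> : 66 * (2 * L%:R + 1) * N p ^+ 3 = (2 * L%:R + 1) * N p * (2 * N p) * (33 * N p) by ring.
have LN : 0 <= L%:R * N p by apply: mulr_ge0 => //; lra.
have w0r : 0 <= (w_ p)%:R :> R by [].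
by apply: ler_pM; [apply: mulr_ge0; lra|lra|apply: ler_pM; lra|lra].
Qed.

(** The conditions on [lam] are those of Chernoff's bound: [lam] times the size of an increment is
    at most 1/2, and [lam ^+ 2] times the total variance, proportional to [w_ p], is of order [p].
    Exceeding the threshold, of order [p / lam], then has probability of order e^(-16 p). *)
Lemma oscillation_grid (L : nat) (w_ : nat -> nat) (lam : nat -> R) (kap : R) (n1 : nat) :
  (forall p, (n1 <= p)%N -> (0 < w_ p <= 32 ^ p)%N) ->
  (forall p, (n1 <= p)%N -> 0 < lam p) ->
  (forall p, (n1 <= p)%N -> lam p * (1 + MG * ((w_ p)%:R / N p) * (4 ^ p)%N%:R) <= 2^-1) ->
  (forall p, (n1 <= p)%N -> lam p ^+ 2 * (w_ p)%:R <= kap * p%:R) ->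
  exists A, 0 <= A /\ {ae P, forall w, exists p0, forall p, (p0 <= p)%N ->
    forall i k n, (i <= 2 * L * 32 ^ p)%N -> (k <= w_ p)%N -> (n <= 32 * 32 ^ p)%N ->
    `|emp_dev n (grid L p (i + k)) w - emp_dev n (grid L p i) w| <=
      A * (p%:R / lam p) + MG * ((w_ p)%:R / N p) * (B' * sqrt32 R ^+ p)}.
Proof.
move=> w32 lam0 lamb lamk.
(* 66 = 2 * 33 comes from the variance of at most 33 * 32^p increments, and 16 outweighs the
   exponent 15 of the number of triples. *)
exists (`|66 * MG * V * kap| + 16); split; first by rewrite addr_ge0.
set A := `|_| + 16.
pose phi p (x : nat * nat * nat) := band (grid L p x.1.1) (grid L p (x.1.1 + x.1.2)).
pose C p := MG * ((w_ p)%:R / N p).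
have C0 p : 0 <= C p by rewrite !mulr_ge0// invr_ge0 ltW.
have C1 p : (n1 <= p)%N -> C p <= 1 + MG.
  move=> np; have /andP[_ wp] := w32 p np.
  apply: (@le_trans _ _ MG); last by rewrite lerDr.
  by rewrite ler_piMr// ler_pdivrMr ?N0// mul1r ler_nat.
have hN p : N p = (32 ^ p)%N%:R by [].
have tL p x : (n1 <= p)%N -> x \in Lp L w_ p ->
    [/\ tame mu c k0 (C p) (phi p x), (x.2 <= 32 * 32 ^ p)%N & (1 + x.2 <= 33 * 32 ^ p)%N].
  move=> np; case: x => -[i k] n; rewrite LpP => /and3P[_ kw nN] /=; split => //; last first.
    have : (0 < 32 ^ p)%N by rewrite expn_gt0.
    by move: nN; set z := (32 ^ p)%N; clear; lia.
  apply: tame_le (band_tame ck0 sG (grid_le _ _ _ _)).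
  by rewrite gridB ler_wpM2l// ler_wpM2r ?invr_ge0 ?ler_nat.
have uL p : (n1 <= p)%N -> (size (Lp L w_ p))%:R *
     (2 * expR (2 * lam p ^+ 2 * var_factor eps r (C p) * (32 * 32 ^ p + 4 ^ p)%N%:R - lam p * (A * (p%:R / lam p))))
      <= 132 * (2 * L%:R + 1) * expR (- p%:R).
  move=> np; have l0 := lam0 p np; have /andP[w0 wN] := w32 p np.
  have -> : lam p * (A * (p%:R / lam p)) = A * p%:R by field; rewrite gt_eqF.
  have sz := Lp_size L (w32 p np).
  have ex : 2 * lam p ^+ 2 * var_factor eps r (C p) * (32 * 32 ^ p + 4 ^ p)%N%:R - A * p%:R <= - (16 * p%:R).
    have v1 := var_factor_le (C0 p) (C1 p np).
    have n33 : (32 * 32 ^ p + 4 ^ p)%N%:R <= 33 * N p.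
      by rewrite natrD natrM -hN; have := four_le p; lra.
    have : 2 * lam p ^+ 2 * var_factor eps r (C p) * (32 * 32 ^ p + 4 ^ p)%N%:R <=
        2 * lam p ^+ 2 * (C p * V) * (33 * N p).
      apply: ler_pM => //.
        by apply: mulr_ge0; [apply: mulr_ge0 => //; exact: sqr_ge0|exact: var_factor_ge0].
      by rewrite ler_wpM2l// mulr_ge0// sqr_ge0.
    have -> : 2 * lam p ^+ 2 * (C p * V) * (33 * N p) = 66 * MG * V * (lam p ^+ 2 * (w_ p)%:R).
      by rewrite /C; field; rewrite gt_eqF.
    have : 66 * MG * V * (lam p ^+ 2 * (w_ p)%:R) <= 66 * MG * V * (kap * p%:R).
      by rewrite ler_wpM2l ?lamk// !mulr_ge0.
    have : 66 * MG * V * kap * p%:R <= `|66 * MG * V * kap| * p%:R by rewrite ler_wpM2r// ler_norm.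
    rewrite /A; lra.
  apply: (@le_trans _ _ (66 * (2 * L%:R + 1) * expR (15 * p%:R) * (2 * expR (- (16 * p%:R))))).
    by rewrite ler_pM ?mulr_ge0 ?expR_ge0// ler_wpM2l// ler_expR.
  have -> : - p%:R = 15 * p%:R + - (16 * p%:R) :> R by ring.
  by rewrite expRD; lra.
have U m : \sum_(n < m) 132 * (2 * L%:R + 1) * expR (- (n1 + n)%N%:R) <= 132 * (2 * L%:R + 1) * 2 :> R.
  by rewrite -mulr_sumr ler_wpM2l ?expRN_sum_le// mulr_ge0// addr_ge0// mulr_ge0.
have := eventually_emp_sum heps mu1 mu2 cvge cr ck0 rB tL lam0 lamb uL U.
apply: filterS => w [p0 hp0]; exists p0 => p pp i k n iL kw nN.
have := hp0 p pp ((i, k), n); rewrite /= emp_dev_band ?grid_le//.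
by apply; rewrite LpP iL kw nN.
Qed.

Let B0 : 0 <= B.
Proof. by have := rB 0; rewrite expr0 mulr1; apply: le_trans; exact: r_ge0 cr _. Qed.

Let B'0 : 0 <= B'.
Proof. by apply: addr_ge0 => //; apply: mulr_ge0 => //; apply: mulr_ge0 => //; exact: Rintegral_ge0. Qed.

(** Half-lines give no small variance, but windows of at most 32^p / p terms do: with lam = p /
    32^(p/2), [lam ^+ 2] times the number of increments is at most 2 p, so a threshold of order
    32^(p/2) survives the union over e^(15 p) triples. *)
Lemma time_grid (L : nat) (w_ : nat -> nat) (n1 : nat) :
  (forall p, (n1 <= p)%N -> [&& 2 <= p, 0 < w_ p & w_ p * p <= 32 ^ p]%N) ->
  (forall p, (n1 <= p)%N -> (4 ^ p * p <= 32 ^ p)%N) ->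
  (forall p, (n1 <= p)%N -> p%:R / sqrt32 R ^+ p * (1 + (1 + MG) * (4 ^ p)%N%:R) <= 2^-1) ->
  exists A, 0 <= A /\ {ae P, forall w, exists p0, forall p, (p0 <= p)%N ->
    forall i k s, (i <= 2 * L * 32 ^ p)%N -> (k <= w_ p)%N -> (s <= 32 * 32 ^ p)%N ->
    `|emp_sum eps c (below (grid L p i)) s.+1 k w| <= A * sqrt32 R ^+ p}.
Proof.
move=> wp w4 lamb.
pose A := 4 * (1 + MG) * V + 16.
have A0 : 0 <= A by rewrite addr_ge0// mulr_ge0// mulr_ge0// addr_ge0.
have M0 : 0 <= 1 + MG by rewrite addr_ge0.
exists (A + (1 + MG) * B'); split; first by rewrite addr_ge0// mulr_ge0.
have w32 p : (n1 <= p)%N -> (0 < w_ p <= 32 ^ p)%N.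
  move=> np; have /and3P[p2 -> wpN] := wp p np; apply: leq_trans wpN.
  by rewrite leq_pmulr// (leq_trans _ p2).
pose phi p (x : nat * nat * nat) := below (grid L p x.1.1).
have tL p x : (n1 <= p)%N -> x \in Lp L w_ p ->
    [/\ tame mu c k0 (1 + MG) (phi p x), (x.1.2 <= w_ p)%N & (x.2.+1 + x.1.2 <= 33 * 32 ^ p)%N].
  move=> np; case: x => -[i k] n; rewrite LpP => /and3P[_ kw nN] /=; split => //; last first.
    have /and3P[p2 w0 wpN] := wp p np.
    have : (w_ p * 2 <= w_ p * p)%N by rewrite leq_mul2l p2 orbT.
    by move: nN kw w0 wpN; set z := (32 ^ p)%N; set y := (w_ p * p)%N; clear; lia.
  exact: (below_tame ck0 sG (grid L p i)).
have lam0 p : (n1 <= p)%N -> 0 < p%:R / sqrt32 R ^+ p.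
  by move=> np; have /and3P[p2 _ _] := wp p np; rewrite divr_gt0 ?sqrt32X_gt0// ltr0n (leq_trans _ p2).
have uL p : (n1 <= p)%N -> (size (Lp L w_ p))%:R *
     (2 * expR (2 * (p%:R / sqrt32 R ^+ p) ^+ 2 * var_factor eps r (1 + MG) * (w_ p + 4 ^ p)%N%:R - p%:R / sqrt32 R ^+ p * (A * sqrt32 R ^+ p)))
      <= 132 * (2 * L%:R + 1) * expR (- p%:R).
  move=> np; have l0 := lam0 p np; have q0 := sqrt32X_gt0 R p.
  have -> : p%:R / sqrt32 R ^+ p * (A * sqrt32 R ^+ p) = A * p%:R by field; rewrite gt_eqF.
  have sz := Lp_size L (w32 p np).
  have ex : 2 * (p%:R / sqrt32 R ^+ p) ^+ 2 * var_factor eps r (1 + MG) * (w_ p + 4 ^ p)%N%:R - A * p%:R <= - (16 * p%:R).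
    have v1 := var_factor_le M0 (lexx _).
    have /and3P[p2 w0 wpN] := wp p np.
    have n2 : p%:R * (w_ p + 4 ^ p)%N%:R <= 2 * N p.
      by rewrite -natrM /N -natrM ler_nat mulnDr mul2n -addnn leq_add// mulnC// w4.
    have : 2 * (p%:R / sqrt32 R ^+ p) ^+ 2 * var_factor eps r (1 + MG) * (w_ p + 4 ^ p)%N%:R <=
        2 * (p%:R / sqrt32 R ^+ p) ^+ 2 * ((1 + MG) * V) * (w_ p + 4 ^ p)%N%:R.
      apply: ler_wpM2r => //; apply: ler_wpM2l => //.
      by apply: mulr_ge0 => //; exact: sqr_ge0.
    have -> : 2 * (p%:R / sqrt32 R ^+ p) ^+ 2 * ((1 + MG) * V) * (w_ p + 4 ^ p)%N%:R =
      2 * (1 + MG) * V * (p%:R / N p) * (p%:R * (w_ p + 4 ^ p)%N%:R).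
      by rewrite /N -(sqrt32X_sqr R p); field; rewrite gt_eqF.
    have : 2 * (1 + MG) * V * (p%:R / N p) * (p%:R * (w_ p + 4 ^ p)%N%:R) <=
      2 * (1 + MG) * V * (p%:R / N p) * (2 * N p).
      apply: ler_wpM2l => //; apply: mulr_ge0; first by rewrite !mulr_ge0.
      by rewrite divr_ge0// ltW.
    have -> : 2 * (1 + MG) * V * (p%:R / N p) * (2 * N p) = 4 * (1 + MG) * V * p%:R.
      by field; rewrite gt_eqF.
    rewrite /A; lra.
  apply: (@le_trans _ _ (66 * (2 * L%:R + 1) * expR (15 * p%:R) * (2 * expR (- (16 * p%:R))))).
    by rewrite ler_pM ?mulr_ge0 ?expR_ge0// ler_wpM2l// ler_expR.
  have -> : - p%:R = 15 * p%:R + - (16 * p%:R) :> R by ring.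
  by rewrite expRD; lra.
have U m : \sum_(n < m) 132 * (2 * L%:R + 1) * expR (- (n1 + n)%N%:R) <= 132 * (2 * L%:R + 1) * 2 :> R.
  by rewrite -mulr_sumr ler_wpM2l ?expRN_sum_le// mulr_ge0// addr_ge0// mulr_ge0.
have := eventually_emp_sum heps mu1 mu2 cvge cr ck0 rB tL lam0 lamb uL U.
apply: filterS => w [p0 hp0]; exists p0 => p pp i k s iL kw sN.
have := hp0 p pp ((i, k), s); rewrite LpP iL kw sN => /(_ isT) /=.
by move=> h; apply: (le_trans h); rewrite [leRHS]mulrDl -[X in _ <= _ + X]mulrA.
Qed.

(** There are only O(p^2) pairs, so probabilities of order p^-4 are enough for summability. The
    exponent thus has to be of order ln p instead of p, which allows the threshold with
    [sqrt_ln]. *)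
Lemma coarse_grid (L : nat) (w_ : nat -> nat) (n1 : nat) :
  (forall p, (n1 <= p)%N -> [&& 4 <= p, 0 < w_ p, w_ p <= 32 ^ p & 32 ^ p <= 2 * p * w_ p]%N) ->
  (forall p, (n1 <= p)%N -> sqrt_ln R p / sqrt32 R ^+ p * (1 + (1 + MG) * (4 ^ p)%N%:R) <= 2^-1) ->
  exists A, 0 <= A /\ {ae P, forall w, exists p0, forall p, (p0 <= p)%N ->
    forall i n, (i <= 2 * L * 32 ^ p %/ w_ p)%N -> (n <= 32 * 32 ^ p %/ w_ p)%N ->
    `|emp_dev (n * w_ p) (grid L p (i * w_ p)) w| <= A * (sqrt_ln R p * sqrt32 R ^+ p)}.
Proof.
move=> wp lamb.
(* The first term outweighs the variance; the 4 is the exponent of p^-4. *)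
pose A := 66 * (1 + MG) * V + 4.
have A0 : 0 <= A by rewrite addr_ge0// mulr_ge0// mulr_ge0// addr_ge0.
have M0 : 0 <= 1 + MG by rewrite addr_ge0.
exists (A + (1 + MG) * B'); split; first by rewrite addr_ge0// mulr_ge0.
pose Lc p := [seq (i, n) | i <- iota 0 (2 * L * 32 ^ p %/ w_ p).+1, n <- iota 0 (32 * 32 ^ p %/ w_ p).+1].
have LcP p i n : ((i, n) \in Lc p) = (i <= 2 * L * 32 ^ p %/ w_ p)%N && (n <= 32 * 32 ^ p %/ w_ p)%N.
  apply/allpairsPdep/andP => [[i' [n' []]]|[iL nN]].
    by rewrite !mem_iota !add0n !ltnS => iL nN [-> ->].
  by exists i, n; split; [rewrite mem_iota add0n ltnS..|by []].
pose phi p (x : nat * nat) := below (grid L p (x.1 * w_ p)).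
have tL p x : (n1 <= p)%N -> x \in Lc p ->
    [/\ tame mu c k0 (1 + MG) (phi p x), (x.2 * w_ p <= 32 * 32 ^ p)%N & (1 + x.2 * w_ p <= 33 * 32 ^ p)%N].
  move=> np; case: x => i n; rewrite LcP => /andP[_ nN] /=.
  have nN' : (n * w_ p <= 32 * 32 ^ p)%N.
    by apply: leq_trans (leq_divM _ (w_ p)); rewrite leq_mul2r nN orbT.
  split => //; first exact: (below_tame ck0 sG (grid L p (i * w_ p))).
  have : (0 < 32 ^ p)%N by rewrite expn_gt0.
  by move: nN'; set z := (32 ^ p)%N; set y := (n * w_ p)%N; clear; lia.
have lam0 p : (n1 <= p)%N -> 0 < sqrt_ln R p / sqrt32 R ^+ p.
  by move=> np; have /and4P[p4 _ _ _] := wp p np; rewrite divr_gt0 ?sqrt32X_gt0// (lt_le_trans _ (sqrt_ln_ge1 R p4)).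
have uL p : (n1 <= p)%N -> (size (Lc p))%:R *
     (2 * expR (2 * (sqrt_ln R p / sqrt32 R ^+ p) ^+ 2 * var_factor eps r (1 + MG) * (32 * 32 ^ p + 4 ^ p)%N%:R - sqrt_ln R p / sqrt32 R ^+ p * (A * (sqrt_ln R p * sqrt32 R ^+ p))))
      <= 130 * (4 * L%:R + 1) * (p%:R ^+ 2)^-1.
  move=> np; have l0 := lam0 p np; have q0 := sqrt32X_gt0 R p.
  have /and4P[p4 w0 wN Nw] := wp p np.
  have p1 : 1 <= p%:R :> R by rewrite ler1n (leq_trans _ p4).
  have as_ := sqrt_ln_sqr R p4.
  have -> : sqrt_ln R p / sqrt32 R ^+ p * (A * (sqrt_ln R p * sqrt32 R ^+ p)) = A * ln p%:R.
    by rewrite -as_; field; rewrite gt_eqF.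
  have sz : (size (Lc p))%:R <= 65 * (4 * L%:R + 1) * p%:R ^+ 2 :> R.
    rewrite !size_allpairs !size_iota.
    have dv k : (k * 32 ^ p %/ w_ p <= k * (2 * p))%N.
      rewrite -[leqRHS](mulnK _ w0); apply: leq_div2r.
      by rewrite -mulnA leq_mul2l Nw orbT.
    have d1 : (2 * L * 32 ^ p %/ w_ p).+1%:R <= (4 * L%:R + 1) * p%:R :> R.
      apply: (@le_trans _ _ ((2 * L * (2 * p)).+1)%:R); first by rewrite ler_nat ltnS dv.
      by rewrite -addn1 natrD !natrM; lra.
    have d2 : (32 * 32 ^ p %/ w_ p).+1%:R <= 65 * p%:R :> R.
      apply: (@le_trans _ _ ((32 * (2 * p)).+1)%:R); first by rewrite ler_nat ltnS dv.
      by rewrite -addn1 natrD !natrM; lra.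
    rewrite natrM; apply: (le_trans (ler_pM _ _ d1 d2)) => //.
    have -> : 65 * (4 * L%:R + 1) * p%:R ^+ 2 = (4 * L%:R + 1) * p%:R * (65 * p%:R) :> R by ring.
    exact: lexx.
  have ex : 2 * (sqrt_ln R p / sqrt32 R ^+ p) ^+ 2 * var_factor eps r (1 + MG) * (32 * 32 ^ p + 4 ^ p)%N%:R - A * ln p%:R <= - (4%:R * ln p%:R).
    have v1 := var_factor_le M0 (lexx _).
    have n33 : (32 * 32 ^ p + 4 ^ p)%N%:R <= 33 * N p.
      by rewrite natrD natrM; have := four_le p; rewrite /N; lra.
    have : 2 * (sqrt_ln R p / sqrt32 R ^+ p) ^+ 2 * var_factor eps r (1 + MG) * (32 * 32 ^ p + 4 ^ p)%N%:R <=
        2 * (sqrt_ln R p / sqrt32 R ^+ p) ^+ 2 * ((1 + MG) * V) * (33 * N p).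
      apply: ler_pM => //.
        by apply: mulr_ge0; [apply: mulr_ge0 => //; exact: sqr_ge0|exact: var_factor_ge0].
      by apply: ler_wpM2l => //; apply: mulr_ge0 => //; exact: sqr_ge0.
    have -> : 2 * (sqrt_ln R p / sqrt32 R ^+ p) ^+ 2 * ((1 + MG) * V) * (33 * N p) = 66 * (1 + MG) * V * ln p%:R.
      by rewrite /N -(sqrt32X_sqr R p) -as_; field; rewrite gt_eqF.
    rewrite /A; lra.
  have pp0 : 0 < p%:R :> R by lra.
  apply: (@le_trans _ _ (65 * (4 * L%:R + 1) * p%:R ^+ 2 * (2 * (p%:R ^+ 4)^-1))).
    apply: ler_pM => //; apply: ler_wpM2l => //.
    have -> : (p%:R ^+ 4)^-1 = expR (- (4%:R * ln p%:R)) :> R.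
      by rewrite expRN expRM_natl lnK.
    by rewrite ler_expR.
  have -> : 65 * (4 * L%:R + 1) * p%:R ^+ 2 * (2 * (p%:R ^+ 4)^-1) = 130 * (4 * L%:R + 1) * (p%:R ^+ 2)^-1 :> R.
    by field; rewrite gt_eqF.
  exact: lexx.
have n12 : (2 <= n1)%N by have /and4P[p4 _ _ _] := wp n1 (leqnn _); apply: leq_trans p4.
have U m : \sum_(n < m) 130 * (4 * L%:R + 1) * ((n1 + n)%N%:R ^+ 2)^-1 <= 130 * (4 * L%:R + 1) * 1 :> R.
  by rewrite -mulr_sumr ler_wpM2l ?inv_sqr_sum_le// mulr_ge0// addr_ge0// mulr_ge0.
have := eventually_emp_sum heps mu1 mu2 cvge cr ck0 rB tL lam0 lamb uL U.
apply: filterS => w [p0 hp0]; exists (p0 + n1)%N => p pp i n iL nN.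
have np : (n1 <= p)%N by apply: leq_trans pp; exact: leq_addl.
have /and4P[p4 _ _ _] := wp p np.
have := hp0 p (leq_trans (leq_addr _ _) pp) (i, n); rewrite LcP iL nN => /(_ isT) /=.
move=> h; apply: (le_trans h); rewrite [leRHS]mulrDl lerD2l -[leRHS]mulrA.
apply: ler_wpM2l => //; apply: ler_wpM2l => //.
by rewrite ler_peMl ?sqrt_ln_ge1// ltW// sqrt32X_gt0.
Qed.

End Oscillation.

(** * Uniform bounds for the empirical process and its modulus *)

Section EmpiricalBounds.
Context (R : realType) (d : measure_display) (T : measurableType d)
  (P : probability T R) (eps : int -> {RV P >-> R}) (c : nat -> R).
Hypothesis heps : iid eps.

Let mu := distribution P (eps 1%:Z).
Let m1 := \int[mu]_e `|e|.

Hypothesis mu1 : mu.-integrable setT (EFin \o (fun e : R => e)).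
Hypothesis mu2 : mu.-integrable setT (EFin \o (fun e : R => (`|e| + m1) ^+ 2)).
Hypothesis cvge : {ae P, forall w, forall i : nat,
  cvgn (series (fun l : nat => c l * eps (i%:Z - l%:Z) w))}.

Variable r : nat -> R.
Hypothesis cr : forall K m, \sum_(l < m) `|c (K + l)%N| <= r K.
Variable k0 : nat.
Hypothesis ck0 : forall k, (k < k0)%N -> c k = 0.
Variable B : R.
Hypothesis rB : forall n, r (4 ^ n) <= B * 8^-1 ^+ n.
Variables (MG : R) (g : R -> R).
Hypothesis sG : smooth_cdf MG (first_dist mu c k0) g.

Let F := marginal eps c.
Let B' := 1 + 33 * m1 * B.
Let MG0 : 0 <= MG. Proof. exact: smooth_cdf_ge0 sG. Qed.
Let B0 : 0 <= B.
Proof. by have := rB 0; rewrite expr0 mulr1; apply: le_trans; exact: r_ge0 cr _. Qed.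
Let B'0 : 0 <= B'.
Proof. by apply: addr_ge0 => //; apply: mulr_ge0 => //; apply: mulr_ge0 => //; exact: Rintegral_ge0. Qed.

Definition emp_count n x w : R := \sum_(i < n) below x (ma_tail eps c (1 + i)%N%:Z 0 w).

Lemma emp_devE n x w : emp_dev eps c n x w = emp_count n x w - n%:R * F x.
Proof.
by rewrite /emp_dev /emp_sum sumrB sumr_const card_ord mulr_natl.
Qed.

Lemma emp_count_nd n x x' w : x <= x' -> emp_count n x w <= emp_count n x' w.
Proof.
move=> xx'; apply: ler_sum => i _; rewrite /below ler_nat.
by case: (leP _ x) => // h; rewrite (le_trans h xx').
Qed.

(** The count and [F] are monotone, so the value at [x] is squeezed between those at the ends of a
    cell, up to the increment of n F over the cell, which is at most [del]. *)
Lemma emp_dev_between n x x0 x1 w (del : R) : x0 <= x <= x1 -> MG * (x1 - x0) * n%:R <= del ->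
  `|emp_dev eps c n x w - emp_dev eps c n x0 w| <=
  `|emp_dev eps c n x1 w - emp_dev eps c n x0 w| + 2 * del.
Proof.
move=> /andP[x0x xx1] hdel; rewrite !emp_devE.
have lip := marginal_lipschitz heps mu1 cvge ck0 sG.
have c1 := emp_count_nd n w x0x; have c2 := emp_count_nd n w xx1.
have n0 : 0 <= n%:R :> R by [].
have f1 : n%:R * `|F x - F x0| <= del.
  apply: le_trans hdel; rewrite mulrC ler_wpM2r//; apply: (le_trans (lip _ _)).
  by rewrite ler_wpM2l// ger0_norm ?subr_ge0// lerB.
have f2 : n%:R * `|F x1 - F x0| <= del.
  apply: le_trans hdel; rewrite mulrC ler_wpM2r//; apply: (le_trans (lip _ _)).
  by rewrite ler_wpM2l// ger0_norm ?subr_ge0// (le_trans x0x).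
have g1 := ler_wpM2l n0 (ler_norm (F x - F x0)).
have nF : - (F x - F x0) <= `|F x - F x0| by rewrite -normrN ler_norm.
have g1' := ler_wpM2l n0 nF.
have g2 := ler_wpM2l n0 (ler_norm (F x1 - F x0)).
have h := ler_norm (emp_count n x1 w - n%:R * F x1 - (emp_count n x0 w - n%:R * F x0)).
have h' := normr_ge0 (emp_count n x1 w - n%:R * F x1 - (emp_count n x0 w - n%:R * F x0)).
move: g1 g1' g2; rewrite !mulrN !mulrBr => g1 g1' g2.
by rewrite ler_norml; apply/andP; split; lra.
Qed.

Lemma emp_dev_time n n' x w : (n' <= n)%N ->
  emp_dev eps c n x w - emp_dev eps c n' x w = emp_sum eps c (below x) n'.+1 (n - n') w.
Proof.
move=> nn; rewrite /emp_dev /emp_sum.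
rewrite -(big_mkord xpredT (fun i => below x (ma_tail eps c (1 + i)%N%:Z 0 w) - _)).
rewrite (@big_cat_nat _ _ _ n')//= big_mkord addrAC subrr add0r.
rewrite -{1}[n']add0n big_addn big_mkord; apply: eq_bigr => i _.
by rewrite addSn [(i + n')%N]addnC.
Qed.

Lemma grid_cell (L p : nat) x : - L%:R <= x < L%:R ->
  exists2 j, (j <= 2 * L * 32 ^ p)%N & grid R L p j <= x <= grid R L p (j + 1) /\
    (j%:R <= (x + L%:R) * (32 ^ p)%N%:R < j%:R + 1).
Proof.
move=> /andP[Lx xL].
set N : R := (32 ^ p)%N%:R.
have N0 : 0 < N by rewrite ltr0n expn_gt0.
have y0 : 0 <= (x + L%:R) * N by apply: mulr_ge0; [lra|exact: ltW].
have /andP[j1 j2] := truncn_itv y0.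
set j := Num.truncn _ in j1 j2.
exists j.
  rewrite -(@ler_nat R); apply: (le_trans j1); rewrite !natrM -/N; apply: ler_wpM2r; [exact: ltW|lra].
rewrite -natr1 in j2; split; last by rewrite j1 j2.
rewrite /grid -/N natrD; apply/andP; split.
  by rewrite addrC -lerBrDr opprK ler_pdivrMr.
by rewrite addrC -lerBlDr opprK ler_pdivlMr// ltW.
Qed.

Let N p : R := (32 ^ p)%N%:R.
Let N0 p : 0 < N p. Proof. by rewrite ltr0n expn_gt0. Qed.
Let NE p : N p = sqrt32 R ^+ p * sqrt32 R ^+ p. Proof. by rewrite sqrt32X_sqr. Qed.

Let ratio_le p (kap : R) : 0 <= kap -> kap * (p%:R * (4 / sqrt32 R) ^+ p) <= 2^-1 ->
  forall x, 0 <= x -> x <= kap -> p%:R / sqrt32 R ^+ p * (x * (4 ^ p)%N%:R) <= 2^-1.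
Proof.
move=> k0' h x x0 xk; apply: le_trans h; rewrite four_sqrt32X.
have q0 := sqrt32X_gt0 R p.
have -> : p%:R / sqrt32 R ^+ p * (x * ((4 / sqrt32 R) ^+ p * sqrt32 R ^+ p)) = x * (p%:R * (4 / sqrt32 R) ^+ p).
  by field; rewrite !gt_eqF ?sqrt32X_gt0 ?sqrt32_gt0.
by apply: ler_wpM2r => //; rewrite mulr_ge0// exprn_ge0// ltW// four_sqrt32_gt0.
Qed.

(* Two-step approximation: from [x] to a point of the fine grid of mesh [32^-p], then to one of
   a grid [32 ^ p %/ p] times coarser, both in space and in time; the coarse grid is
   polynomial in [p], which yields [ln p] instead of [p] in the bound. *)
Lemma emp_dev_uniform (L : nat) : exists A, 0 <= A /\
  {ae P, forall w, exists p0, forall p, (p0 <= p)%N -> forall n x,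
    (n <= 32 * 32 ^ p)%N -> - L%:R <= x < L%:R ->
    `|emp_dev eps c n x w| <= A * (sqrt_ln R p * sqrt32 R ^+ p)}.
Proof.
have half0 : 0 < 2^-1 :> R by [].
have [p1 hp1] := natr_expr_small (2 + MG) (four_sqrt32_gt0 R) (four_sqrt32_lt1 R) half0.
pose n1 := (p1 + 4)%N.
pose w_ p := (32 ^ p %/ p)%N.
have four p : (n1 <= p)%N -> (4 <= p)%N by apply: leq_trans; exact: leq_addl.
have pw p : (n1 <= p)%N -> [/\ (0 < w_ p)%N, (w_ p * p <= 32 ^ p)%N & (32 ^ p <= 2 * p * w_ p)%N].
  move=> np; have p4 := four p np.
  have p0 : (0 < p)%N by apply: leq_trans p4.
  have w0 : (0 < w_ p)%N by rewrite divn_gt0// ltnW// ltn_expl.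
  split => //; first exact: leq_divM.
  have := ltn_ceil (32 ^ p) p0; rewrite -/(w_ p) => /ltnW h; apply: (leq_trans h).
  by rewrite mulSn -mulnA mul2n -addnn [(p * _)%N]mulnC leq_add2r leq_pmull.
have w32 p : (n1 <= p)%N -> (0 < w_ p <= 32 ^ p)%N.
  move=> np; have [-> wp _] := pw p np; apply: leq_trans wp.
  by rewrite leq_pmulr// (leq_trans _ (four p np)).
have lam0 p : (n1 <= p)%N -> 0 < p%:R / sqrt32 R ^+ p.
  by move=> np; rewrite divr_gt0 ?sqrt32X_gt0// ltr0n (leq_trans _ (four p np)).
have base x p : (n1 <= p)%N -> 0 <= x -> x <= 1 + MG -> p%:R / sqrt32 R ^+ p * (1 + x * (4 ^ p)%N%:R) <= 2^-1.
  move=> np x0 xM.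
  have h := ratio_le (addr_ge0 (ler0n R 2) MG0) (hp1 p (leq_trans (leq_addr _ _) np)) (x := 1 + x).
  have {}h : p%:R / sqrt32 R ^+ p * ((1 + x) * (4 ^ p)%N%:R) <= 2^-1 by apply: h; lra.
  apply: le_trans h; apply: ler_wpM2l; first exact: ltW (lam0 p np).
  rewrite mulrDl lerD2r mul1r ler1n expn_gt0//.
have wN1 p : (n1 <= p)%N -> 0 <= (w_ p)%:R / N p <= 1.
  move=> np; have /andP[_ wp] := w32 p np.
  apply/andP; split; first by apply: divr_ge0 => //; exact: ltW.
  by rewrite ler_pdivrMr// mul1r ler_nat.
have lam1 p : (n1 <= p)%N -> p%:R / sqrt32 R ^+ p * (1 + MG * ((w_ p)%:R / N p) * (4 ^ p)%N%:R) <= 2^-1.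
  move=> np; have /andP[r0 r1] := wN1 p np; apply: base => //; first exact: mulr_ge0.
  by apply: (le_trans (ler_piMr MG0 r1)); rewrite lerDr.
have kap1 p : (n1 <= p)%N -> (p%:R / sqrt32 R ^+ p) ^+ 2 * (w_ p)%:R <= 1 * p%:R.
  move=> np; have [_ wp _] := pw p np; rewrite mul1r.
  have -> : (p%:R / sqrt32 R ^+ p) ^+ 2 * (w_ p)%:R = p%:R * ((w_ p * p)%N%:R / N p).
    by rewrite natrM NE; field; rewrite gt_eqF ?sqrt32X_gt0.
  by rewrite ler_piMr// ler_pdivrMr// mul1r ler_nat.
have [A1 [A10 H1]] := oscillation_grid heps mu1 mu2 cvge cr ck0 rB sG L w32 lam0 lam1 kap1.
have c1 p : (n1 <= p)%N -> [&& 2 <= p, 0 < w_ p & w_ p * p <= 32 ^ p]%N.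
  by move=> np; have [-> -> _] := pw p np; rewrite (leq_trans _ (four p np)).
have c2 p : (n1 <= p)%N -> (4 ^ p * p <= 32 ^ p)%N.
  move=> np; rewrite (_ : 32 = 4 * 8)%N// expnMn leq_mul2l; apply/orP; right.
  by rewrite ltnW// ltn_expl.
have c3 p : (n1 <= p)%N -> p%:R / sqrt32 R ^+ p * (1 + (1 + MG) * (4 ^ p)%N%:R) <= 2^-1.
  by move=> np; apply: base => //; rewrite addr_ge0.
have [A2 [A20 H2]] := time_grid heps mu1 mu2 cvge cr ck0 rB sG L c1 c2 c3.
have d1 p : (n1 <= p)%N -> [&& 4 <= p, 0 < w_ p, w_ p <= 32 ^ p & 32 ^ p <= 2 * p * w_ p]%N.
  by move=> np; have [_ _ ->] := pw p np; have /andP[-> ->] := w32 p np; rewrite four.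
have d2 p : (n1 <= p)%N -> sqrt_ln R p / sqrt32 R ^+ p * (1 + (1 + MG) * (4 ^ p)%N%:R) <= 2^-1.
  move=> np; apply: le_trans (c3 p np); apply: ler_wpM2r.
    by rewrite addr_ge0// mulr_ge0// addr_ge0.
  by apply: ler_wpM2r; [rewrite invr_ge0 ltW// sqrt32X_gt0|exact/sqrt_ln_le/four].
have [A3 [A30 H3]] := coarse_grid heps mu1 mu2 cvge cr ck0 rB sG L d1 d2.
exists (2 * (A1 + MG * B') + A2 + A3 + 64 * MG); split.
  by rewrite !addr_ge0// !mulr_ge0// addr_ge0// mulr_ge0.
near=> w.
have [P1 h1] : exists p0, forall p, (p0 <= p)%N ->
    forall i k n, (i <= 2 * L * 32 ^ p)%N -> (k <= w_ p)%N -> (n <= 32 * 32 ^ p)%N ->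
    `|emp_dev eps c n (grid R L p (i + k)) w - emp_dev eps c n (grid R L p i) w| <=
      A1 * (p%:R / (p%:R / sqrt32 R ^+ p)) + MG * ((w_ p)%:R / N p) * (B' * sqrt32 R ^+ p) by near: w.
have [P2 h2] : exists p0, forall p, (p0 <= p)%N ->
    forall i k s, (i <= 2 * L * 32 ^ p)%N -> (k <= w_ p)%N -> (s <= 32 * 32 ^ p)%N ->
    `|emp_sum eps c (below (grid R L p i)) s.+1 k w| <= A2 * sqrt32 R ^+ p by near: w.
have [P3 h3] : exists p0, forall p, (p0 <= p)%N ->
    forall i n, (i <= 2 * L * 32 ^ p %/ w_ p)%N -> (n <= 32 * 32 ^ p %/ w_ p)%N ->
    `|emp_dev eps c (n * w_ p) (grid R L p (i * w_ p)) w| <= A3 * (sqrt_ln R p * sqrt32 R ^+ p) by near: w.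
exists (n1 + (P1 + (P2 + P3)))%N => p pp n x nN xL.
have [np pP1 pP2 pP3] : [/\ n1 <= p, P1 <= p, P2 <= p & P3 <= p]%N by clear -pp; split; lia.
have [j jL [xj _]] := grid_cell p xL.
have [w0 _ _] := pw p np; have /andP[r0 r1] := wN1 p np.
have q0 := sqrt32X_gt0 R p; have q1 := sqrt32X_ge1 R p; have a1 := sqrt_ln_ge1 R (four p np).
have p0 : 0 < p%:R :> R by rewrite ltr0n (leq_trans _ (four p np)).
have osc i k n' : (i <= 2 * L * 32 ^ p)%N -> (k <= w_ p)%N -> (n' <= 32 * 32 ^ p)%N ->
    `|emp_dev eps c n' (grid R L p (i + k)) w - emp_dev eps c n' (grid R L p i) w| <= (A1 + MG * B') * sqrt32 R ^+ p.
  move=> iL kw nN'; apply: (le_trans (h1 p pP1 i k n' iL kw nN')).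
  have -> : p%:R / (p%:R / sqrt32 R ^+ p) = sqrt32 R ^+ p by field; rewrite !gt_eqF.
  rewrite [leRHS]mulrDl lerD2l -[leRHS]mulrA -[leLHS]mulrA; apply: ler_wpM2l => //.
  by apply: ler_piMl => //; apply: mulr_ge0 => //; exact: ltW.
have e1 := osc j 1%N n jL w0 nN.
(* The fine mesh is chosen for this: n F varies by a bounded amount over a cell, uniformly in
   [p]. *)
have del : MG * (grid R L p (j + 1) - grid R L p j) * n%:R <= 32 * MG.
  rewrite gridB div1r -mulrA [32 * _]mulrC ler_wpM2l// mulrC ler_pdivrMr//.
  by rewrite -natrM ler_nat.
have e2 := emp_dev_between w xj del.
have jE := divn_eq j (w_ p).
have jcL : (j %/ w_ p * w_ p <= 2 * L * 32 ^ p)%N by apply: leq_trans jL; exact: leq_divM.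
have e3 := osc (j %/ w_ p * w_ p)%N (j %% w_ p)%N n jcL (ltnW (ltn_pmod j w0)) nN.
rewrite -jE in e3.
have ncN : (n %/ w_ p * w_ p <= n)%N := leq_divM _ _.
have e4 := h2 p pP2 (j %/ w_ p * w_ p)%N (n - n %/ w_ p * w_ p)%N (n %/ w_ p * w_ p)%N jcL _ (leq_trans ncN nN).
have {}e4 : `|emp_dev eps c n (grid R L p (j %/ w_ p * w_ p)) w - emp_dev eps c (n %/ w_ p * w_ p) (grid R L p (j %/ w_ p * w_ p)) w| <= A2 * sqrt32 R ^+ p.
  rewrite emp_dev_time//; apply: e4.
  by rewrite {1}(divn_eq n (w_ p)) addKn ltnW// ltn_pmod.
have e5 := h3 p pP3 (j %/ w_ p)%N (n %/ w_ p)%N (leq_div2r _ jL) (leq_div2r _ nN).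
move: e1 e2 e3 e4 e5.
set D1 := emp_dev eps c n x w; set D2 := emp_dev eps c n (grid R L p j) w.
set D3 := emp_dev eps c n (grid R L p (j + 1)) w; set D4 := emp_dev eps c n (grid R L p (j %/ w_ p * w_ p)) w.
set D5 := emp_dev eps c (n %/ w_ p * w_ p) _ w.
move=> e1 e2 e3 e4 e5.
have t : `|D1| <= `|D1 - D2| + `|D2 - D4| + `|D4 - D5| + `|D5|.
  have -> : D1 = (D1 - D2) + (D2 - D4) + (D4 - D5) + D5 by ring.
  rewrite (_ : D1 - D2 + (D2 - D4) + (D4 - D5) + D5 - D2 = D1 - D2); last by ring.
  apply: (le_trans (ler_normD _ _)); rewrite lerD2r.
  by apply: (le_trans (ler_normD _ _)); rewrite lerD2r ler_normD.
have aq : sqrt32 R ^+ p <= sqrt_ln R p * sqrt32 R ^+ p by rewrite ler_peMl// ltW.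
have aq1 : 1 <= sqrt_ln R p * sqrt32 R ^+ p by apply: le_trans aq.
have C1 : 0 <= A1 + MG * B' by rewrite addr_ge0// mulr_ge0.
have g1 := ler_wpM2l C1 aq; have g2 := ler_wpM2l A20 aq; have g3 := ler_wpM2l MG0 aq1.
by lra.
Unshelve. all: by end_near. Qed.

(** In terms of n, of order 32^p: (ln n)^(1/2) (n ln ln n)^(1/4). *)
Definition modulus_rate (p : nat) : R := Num.sqrt (p%:R * (sqrt32 R ^+ p * sqrt_ln R p)).

Lemma emp_dev_modulus (L : nat) (b : R) : 0 <= b -> exists A, 0 <= A /\
  {ae P, forall w, exists p0, forall p, (p0 <= p)%N -> forall n x x',
    (n <= 32 * 32 ^ p)%N -> - L%:R <= x < L%:R -> - L%:R <= x' < L%:R ->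
    x <= x' -> x' - x <= b * (sqrt_ln R p / sqrt32 R ^+ p) ->
    `|emp_dev eps c n x' w - emp_dev eps c n x w| <= A * modulus_rate p}.
Proof.
move=> b0; have M0 : 0 <= MG := MG0.
have half0 : 0 < 2^-1 :> R by [].
have lb0 : 0 < ((2 * (1 + MG)) ^+ 2)^-1 :> R.
  by rewrite invr_gt0 exprn_gt0//; lra.
have [p1 hp1] := natr_expr_small (b + 2) (four_sqrt32_gt0 R) (four_sqrt32_lt1 R) half0.
have [p2 hp2] := natr_expr_small 1 (four_sqrt32_gt0 R) (four_sqrt32_lt1 R) lb0.
pose n1 := (p1 + (p2 + 4))%N.
(* Number of fine cells covering an interval of the allowed length, with room for the rounding of
   both ends. *)
pose w_ p := (Num.truncn (b * (sqrt_ln R p * sqrt32 R ^+ p))).+2.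
pose rho p : R := sqrt32 R ^+ p * sqrt_ln R p.
(* With this choice p / lam is the target rate, and [lam ^+ 2 * w_ p] is of order [p], as
   [oscillation_grid] requires. *)
pose lam p := p%:R / modulus_rate p.
have np p : (n1 <= p)%N -> [/\ p1 <= p, p2 <= p & 4 <= p]%N.
  by move=> h; clear -h; split; lia.
have pr p : (n1 <= p)%N -> [/\ 1 <= p%:R :> R, 1 <= sqrt32 R ^+ p, 1 <= sqrt_ln R p & sqrt_ln R p <= p%:R].
  move=> h; have [_ _ p4] := np p h; split; [|exact: sqrt32X_ge1|exact: sqrt_ln_ge1|exact: sqrt_ln_le].
  by rewrite ler1n (leq_trans _ p4).
have pos p : (n1 <= p)%N -> 0 < p%:R * (sqrt32 R ^+ p * sqrt_ln R p).
  by move=> h; have [? ? ? _] := pr p h; apply: mulr_gt0; [lra|apply: mulr_gt0; lra].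
have rate_sqr p : (n1 <= p)%N -> modulus_rate p ^+ 2 = p%:R * (sqrt32 R ^+ p * sqrt_ln R p).
  by move=> h; rewrite sqr_sqrtr// ltW// pos.
have rate_gt0 p : (n1 <= p)%N -> 0 < modulus_rate p.
  by move=> h; rewrite sqrtr_gt0 pos.
have a_rate p : (n1 <= p)%N -> sqrt_ln R p <= modulus_rate p.
  move=> h; have [p0 q0 a0 ap] := pr p h.
  rewrite -(@ler_pXn2r _ 2)// ?nnegrE; [|lra|exact: ltW (rate_gt0 p h)].
  rewrite rate_sqr//; have : sqrt_ln R p * sqrt_ln R p <= p%:R * sqrt_ln R p by apply: ler_wpM2r => //; lra.
  have : p%:R * sqrt_ln R p * 1 <= p%:R * sqrt_ln R p * sqrt32 R ^+ p by apply: ler_wpM2l => //; apply: mulr_ge0; lra.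
  by rewrite expr2; lra.
have rate_ge1 p : (n1 <= p)%N -> 1 <= modulus_rate p.
  by move=> h; apply: le_trans (a_rate p h); have [] := pr p h.
have small p : (n1 <= p)%N -> (b + 2) * (p%:R * (4 / sqrt32 R) ^+ p) <= 2^-1.
  by move=> h; have [h1 _ _] := np p h; exact: hp1.
have wle p : (n1 <= p)%N -> (w_ p)%:R <= (b + 2) * (sqrt_ln R p * sqrt32 R ^+ p).
  move=> h; have [p0 q0 a0 ap] := pr p h.
  have y0 : 0 <= b * (sqrt_ln R p * sqrt32 R ^+ p) by apply: mulr_ge0 => //; apply: mulr_ge0; lra.
  have /andP[t1 _] := truncn_itv y0.
  have aq : 1 <= sqrt_ln R p * sqrt32 R ^+ p by rewrite -[1]mulr1 ler_pM.
  by rewrite /w_ -addn2 natrD; lra.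
have wN4 p : (n1 <= p)%N -> (w_ p)%:R / N p * (4 ^ p)%N%:R <= 2^-1.
  move=> h; have [p0 q0 a0 ap] := pr p h; apply: le_trans (small p h).
  rewrite four_sqrt32X NE.
  have -> : (w_ p)%:R / (sqrt32 R ^+ p * sqrt32 R ^+ p) * ((4 / sqrt32 R) ^+ p * sqrt32 R ^+ p) =
    (w_ p)%:R / sqrt32 R ^+ p * (4 / sqrt32 R) ^+ p by field; rewrite !gt_eqF ?sqrt32X_gt0 ?sqrt32_gt0.
  rewrite mulrA; apply: ler_wpM2r; first by rewrite exprn_ge0// ltW// four_sqrt32_gt0.
  rewrite ler_pdivrMr ?sqrt32X_gt0//; apply: (le_trans (wle p h)).
  rewrite [leRHS]mulrAC -mulrA; apply: ler_wpM2l; first lra.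
  by rewrite mulrC; apply: ler_wpM2l => //; lra.
have w32 p : (n1 <= p)%N -> (0 < w_ p <= 32 ^ p)%N.
  move=> h; apply/andP; split => //; rewrite -(@ler_nat R) -[leRHS]mul1r -ler_pdivrMr ?N0//.
  have h4 : 1 <= (4 ^ p)%N%:R :> R by rewrite ler1n expn_gt0.
  have wN0 : 0 <= (w_ p)%:R / N p by apply: divr_ge0 => //; exact: ltW.
  by have := wN4 p h; have := ler_wpM2l wN0 h4; rewrite mulr1 -/(N p); lra.
have lam0 p : (n1 <= p)%N -> 0 < lam p.
  by move=> h; have [p0 _ _ _] := pr p h; rewrite divr_gt0 ?rate_gt0//; lra.
have lam_sqr p : (n1 <= p)%N -> lam p ^+ 2 = p%:R / (sqrt32 R ^+ p * sqrt_ln R p).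
  move=> h; have [p0 q0 a0 ap] := pr p h.
  rewrite /lam expr_div_n rate_sqr//; field; rewrite !gt_eqF//; lra.
have lam_le p : (n1 <= p)%N -> lam p * (1 + MG) <= 2^-1.
  move=> h; have [p0 q0 a0 ap] := pr p h; have [_ h2 _] := np p h.
  have M1 : 0 < 1 + MG by lra.
  rewrite -ler_pdivlMr// -(@ler_pXn2r _ 2)// ?nnegrE; [|exact: ltW (lam0 p h)|by rewrite divr_ge0// ltW].
  rewrite lam_sqr// -invfM exprVn; apply: le_trans (hp2 p h2); rewrite mul1r.
  apply: ler_wpM2l; first lra.
  apply: (@le_trans _ _ (sqrt32 R ^+ p)^-1).
    by rewrite lef_pV2 ?posrE ?mulr_gt0//; [rewrite ler_peMr//; lra|lra..].
  rewrite -[leLHS]mul1r ler_pdivrMr ?sqrt32X_gt0// -four_sqrt32X ler1n expn_gt0//.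
have lam1 p : (n1 <= p)%N -> lam p * (1 + MG * ((w_ p)%:R / N p) * (4 ^ p)%N%:R) <= 2^-1.
  move=> h; apply: le_trans (lam_le p h); apply: ler_wpM2l; first exact: ltW (lam0 p h).
  rewrite lerD2l -mulrA ler_piMr//; apply: le_trans (wN4 p h) _; lra.
have kap1 p : (n1 <= p)%N -> lam p ^+ 2 * (w_ p)%:R <= (b + 2) * p%:R.
  move=> h; have [p0 q0 a0 ap] := pr p h; rewrite lam_sqr//.
  have rr : 0 <= p%:R / (sqrt32 R ^+ p * sqrt_ln R p) by apply: divr_ge0; [lra|apply: mulr_ge0; lra].
  apply: (le_trans (ler_wpM2l rr (wle p h))).
  rewrite le_eqVlt; apply/orP; left; apply/eqP; field; rewrite !gt_eqF//; lra.
have [A1 [A10 H1]] := oscillation_grid heps mu1 mu2 cvge cr ck0 rB sG L w32 lam0 lam1 kap1.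
exists (3 * (A1 + MG * B' * (b + 2)) + 128 * MG); split.
  have h : 0 <= A1 + MG * B' * (b + 2).
    by apply: addr_ge0 => //; apply: mulr_ge0; [exact: mulr_ge0|exact: addr_ge0].
  by apply: addr_ge0; exact: mulr_ge0.
apply: filterS H1 => w [P1 h1].
exists (n1 + P1)%N => p pp n x x' nN xL xL' xx' xb.
have hn : (n1 <= p)%N by apply: leq_trans pp; exact: leq_addr.
have hP : (P1 <= p)%N by apply: leq_trans pp; exact: leq_addl.
have [p0 q0 a0 ap] := pr p hn; have r1 := rate_ge1 p hn; have ar := a_rate p hn.
have lE : p%:R / lam p = modulus_rate p.
  by rewrite /lam; field; rewrite !gt_eqF ?rate_gt0//; lra.
have osc i k : (i <= 2 * L * 32 ^ p)%N -> (k <= w_ p)%N ->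
    `|emp_dev eps c n (grid R L p (i + k)) w - emp_dev eps c n (grid R L p i) w| <=
    (A1 + MG * B' * (b + 2)) * modulus_rate p.
  move=> iL kw; apply: (le_trans (h1 p hP i k n iL kw nN)); rewrite lE [leRHS]mulrDl lerD2l.
  have -> : MG * ((w_ p)%:R / N p) * (B' * sqrt32 R ^+ p) = MG * B' * ((w_ p)%:R / sqrt32 R ^+ p).
    by rewrite NE; field; rewrite gt_eqF ?sqrt32X_gt0.
  rewrite -[leRHS]mulrA; apply: ler_wpM2l; first exact: mulr_ge0.
  rewrite ler_pdivrMr ?sqrt32X_gt0//; apply: (le_trans (wle p hn)).
  by rewrite -mulrA; apply: ler_wpM2l; [lra|apply: ler_wpM2r => //; lra].
have [j jL [xj /andP[j1 j2]]] := grid_cell p xL.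
have [j' jL' [xj' /andP[j1' j2']]] := grid_cell p xL'.
have NN : (32 ^ p)%N%:R = N p by [].
have jj' : (j <= j')%N.
  rewrite -ltnS -(@ltr_nat R) -[j'.+1]addn1 natrD; apply: (le_lt_trans j1).
  apply: le_lt_trans j2'; apply: ler_wpM2r; first by [].
  by rewrite lerD2r.
have jw : (j' - j <= w_ p)%N.
  rewrite -ltnS -(@ltr_nat R) natrB//.
  have y0 : 0 <= b * (sqrt_ln R p * sqrt32 R ^+ p) by apply: mulr_ge0 => //; apply: mulr_ge0; lra.
  have /andP[_ t2] := truncn_itv y0.
  have : (x' - x) * N p <= b * (sqrt_ln R p * sqrt32 R ^+ p).
    have := ler_wpM2r (ltW (N0 p)) xb; rewrite {2}NE.
    have -> : b * (sqrt_ln R p / sqrt32 R ^+ p) * (sqrt32 R ^+ p * sqrt32 R ^+ p) = b * (sqrt_ln R p * sqrt32 R ^+ p).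
      by field; rewrite gt_eqF ?sqrt32X_gt0.
    by [].
  have e3 : (w_ p).+1%:R = (Num.truncn (b * (sqrt_ln R p * sqrt32 R ^+ p))).+1%:R + 2 :> R.
    by rewrite /w_ -natrD addn2.
  rewrite e3; move: j1' j2; rewrite NN; lra.
have del i : MG * (grid R L p (i + 1) - grid R L p i) * n%:R <= 32 * MG.
  rewrite gridB div1r -mulrA [32 * _]mulrC ler_wpM2l// mulrC ler_pdivrMr//.
  by rewrite -natrM ler_nat.
have e1 := osc j 1%N jL isT; have e1' := osc j' 1%N jL' isT.
have e2 := osc j (j' - j)%N jL jw; rewrite subnKC// in e2.
have f1 := emp_dev_between w xj (del j); have f2 := emp_dev_between w xj' (del j').
move: e1 e1' e2 f1 f2.
set D1 := emp_dev eps c n x w; set D2 := emp_dev eps c n x' w.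
set D3 := emp_dev eps c n (grid R L p j) w; set D4 := emp_dev eps c n (grid R L p j') w.
move=> e1 e1' e2 f1 f2.
have t : `|D2 - D1| <= `|D2 - D4| + `|D4 - D3| + `|D1 - D3|.
  have -> : D2 - D1 = (D2 - D4) + (D4 - D3) + (D3 - D1) by ring.
  rewrite (distrC D1 D3).
  apply: (le_trans (ler_normD _ _)); rewrite lerD2r; exact: ler_normD.
have g3 := ler_wpM2l MG0 r1.
move: t e1 e1' e2 f1 f2 g3; set Z := modulus_rate p; clear; move=> *.
by lra.
Qed.

End EmpiricalBounds.

(** * The empirical quantile *)

Section OrderStatistics.
Context (R : realType).
Implicit Types (x : nat -> R) (n k : nat) (y z : R).

Definition sample_count x n z : nat := count (fun v => v <= z) [seq x i | i <- iota 1 n].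

Lemma sample_countE x n z : (sample_count x n z)%:R = \sum_(1 <= i < n.+1) (x i <= z)%R%:R :> R.
Proof.
rewrite /sample_count count_map -sum1_count natr_sum big_mkcond/=.
by rewrite /index_iota subSS subn0; apply: eq_bigr => i _; case: ifP.
Qed.

Let t x n := sort <=%R [seq x i | i <- iota 1 n].

Let size_t x n : size (t x n) = n.
Proof. by rewrite size_sort size_map size_iota. Qed.

Let count_t x n z : sample_count x n z = count (fun v => v <= z) (t x n).
Proof. by apply/permP; rewrite perm_sym perm_sort. Qed.

Let sorted_t x n i j : (i <= j < n)%N -> nth 0 (t x n) i <= nth 0 (t x n) j.
Proof.
move=> /andP[ij jn].
have st : sorted <=%R (t x n) by apply: sort_sorted; exact: le_total.
by apply: (sorted_leq_nth le_trans lexx 0 st); rewrite ?inE ?size_t// (leq_ltn_trans ij).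
Qed.

Lemma order_stat_count x n k : (0 < k <= n)%N -> (k <= sample_count x n (order_stat x n k))%N.
Proof.
move=> /andP[k0 kn]; rewrite count_t -(cat_take_drop k (t x n)) count_cat.
apply: (@leq_trans (count (fun v => v <= order_stat x n k) (take k (t x n)))); last exact: leq_addr.
have -> : count (fun v => v <= order_stat x n k) (take k (t x n)) = size (take k (t x n)).
  apply/eqP; rewrite -all_count; apply/(all_nthP 0) => i.
  rewrite size_takel ?size_t// => ik; rewrite nth_take//.
  by apply: sorted_t; rewrite -ltnS prednK// ik (leq_trans _ kn)// prednK.
by rewrite size_takel// size_t.
Qed.

Lemma count_below_order_stat x n k z : (0 < k <= n)%N -> z < order_stat x n k ->
  (sample_count x n z < k)%N.
Proof.
move=> /andP[k0 kn] zk; rewrite count_t -(cat_take_drop k.-1 (t x n)) count_cat.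
have -> : count (fun v => v <= z) (drop k.-1 (t x n)) = 0%N.
  apply/eqP; rewrite -leqn0 leqNgt -has_count; apply/hasPn => v /(nthP 0)[i].
  rewrite size_drop size_t nth_drop => ik <-; rewrite -ltNge; apply: (lt_le_trans zk).
  by apply: sorted_t; rewrite leq_addr/=; lia.
rewrite addn0; apply: (leq_ltn_trans (count_size _ _)).
by rewrite size_takel ?size_t; lia.
Qed.

(** The ceiling is traded for a description by counts: the empirical quantile is the least point
    where the count reaches n y. The expansion uses nothing else about order statistics. *)
Lemma emp_quantile_count x n y : (0 < n)%N -> 0 < y < 1 ->
  n%:R * y <= (sample_count x n (emp_quantile x n y))%:R /\
  forall z, z < emp_quantile x n y -> (sample_count x n z)%:R < n%:R * y.
Proof.
move=> n0 /andP[y0 y1]; have nr : 0 < n%:R :> R by rewrite ltr0n.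
set k := `|Num.ceil (n%:R * y)|%N.
have /andP[c1 c2] := ceil_itv (n%:R * y).
have c0 : 0 < Num.ceil (n%:R * y) by rewrite ceil_gt0 mulr_gt0.
have kE : (k%:R : R) = (Num.ceil (n%:R * y))%:~R.
  by rewrite /k -[in RHS](gez0_abs (ltW c0)).
have k0 : (0 < k)%N by rewrite absz_gt0 gt_eqF.
have c1' : k%:R - 1 < n%:R * y by rewrite kE; move: c1; rewrite intrB.
have kn : (k <= n)%N.
  rewrite -ltnS -(@ltr_nat R) -natr1 -ltrBlDr; apply: (lt_trans c1').
  by rewrite gtr_pMr.
split=> [|z zk].
  apply: (@le_trans _ _ k%:R); first by rewrite kE.
  by rewrite ler_nat; apply: order_stat_count; rewrite k0 kn.
apply: le_lt_trans c1'; rewrite lerBrDr natr1 ler_nat.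
by apply: count_below_order_stat => //; rewrite k0 kn.
Qed.

End OrderStatistics.

(* The count [cn] stands for n F_n and [xi] for the empirical quantile. First [xi] is localized
   around [x], then the modulus of continuity of [cn - n F] is used twice: to bound the jump
   of [cn] at [xi], and to replace [xi] by [x]. *)
Lemma bahadur_expansion (R : realType) (n : nat) (cn F : R -> R)
    (x y xi f0 del M e EB L Del h : R) :
  (0 < n)%N -> {homo cn : u v / u <= v} ->
  F x = y -> 0 < del -> del <= f0 -> 0 <= M -> 0 < e ->
  (forall u v, `|F u - F v| <= M * `|u - v|) ->
  (forall u, `|F (x + u) - F x - f0 * u| <= M * u ^+ 2) ->
  h = 3 * e / del -> M * h <= del / 2 -> h <= Del -> n%:R^-1 <= Del ->
  - L <= x - h - n%:R^-1 -> x + h < L ->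
  (forall u, - L <= u < L -> `|cn u - n%:R * F u| <= n%:R * e) ->
  (forall u v, - L <= u < L -> - L <= v < L -> u <= v -> v - u <= Del ->
     `|(cn v - n%:R * F v) - (cn u - n%:R * F u)| <= EB) ->
  n%:R * y <= cn xi -> (forall z, z < xi -> cn z < n%:R * y) ->
  `|n%:R * f0 * (x - xi) - (cn x - n%:R * y)| <= 2 * EB + M + n%:R * (M * h ^+ 2).
Proof.
move=> n0 cnd Fx d0 df M0 e0 lip tay hE Mh hD nD Lx xL EA modul yxi xiy.
have nr : 0 < n%:R :> R by rewrite ltr0n.
have ni : 0 < n%:R^-1 :> R by rewrite invr_gt0.
have h0 : 0 < h by rewrite hE divr_gt0// mulr_gt0.
have dh : del * h = 3 * e by rewrite hE mulrC divfK// gt_eqF.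
have Mhh : M * h ^+ 2 <= del / 2 * h by rewrite expr2 mulrA ler_wpM2r// ltW.
have f0h : del * h <= f0 * h by rewrite ler_wpM2r// ltW.
(* Origin of the 3 in [h]: [del * h = 3 * e], at most half of which goes to the Taylor remainder,
   and the remaining 3/2 e still exceeds the deviation [e]. *)
have xih : xi <= x + h.
  rewrite leNgt; apply/negP => /xiy.
  have := EA (x + h) _; rewrite ler_norml => /(_ ltac:(lra)) /andP[a1 _].
  have := tay h; rewrite ler_norml Fx => /andP[t1 _].
  have t2 : y + 3 / 2 * e <= F (x + h) by lra.
  have := ler_wpM2l (ltW nr) t2; have := mulr_gt0 nr e0; lra.
have xhi : x - h < xi.
  rewrite ltNge; apply/negP => /cnd.
  have := EA (x - h) _; rewrite ler_norml => /(_ ltac:(lra)) /andP[_ a1].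
  have := tay (- h); rewrite sqrrN ler_norml Fx => /andP[_ t1].
  have t2 : F (x - h) <= y - 3 / 2 * e by lra.
  have := ler_wpM2l (ltW nr) t2; have := mulr_gt0 nr e0; lra.
(* Left of [xi] the count is below n y; over a step 1/n the deviation moves by at most [EB] and n F
   by at most [M]. *)
have jump : cn xi <= n%:R * y + M + EB.
  pose z := xi - n%:R^-1.
  have zxi : z < xi by rewrite /z; lra.
  have := modul z xi _ _ (ltW zxi) _; rewrite ler_norml => /(_ ltac:(rewrite /z; lra) ltac:(lra) ltac:(rewrite /z; lra)) /andP[_ m1].
  have := xiy z zxi.
  have zE : xi - z = n%:R^-1 by rewrite /z; ring.
  have := lip xi z; rewrite zE (gtr0_norm ni) => /(ler_wpM2l (ltW nr)).
  rewrite mulrCA mulfV ?gt_eqF// mulr1 => l1.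
  have := ler_wpM2l (ltW nr) (ler_norm (F xi - F z)); rewrite mulrBr; lra.
have close : `|(cn xi - n%:R * F xi) - (cn x - n%:R * F x)| <= EB.
  have [xxi|/ltW xix] := leP x xi.
    by apply: modul => //; lra.
  by rewrite distrC; apply: modul => //; lra.
have tayx : `|F xi - F x - f0 * (xi - x)| <= M * h ^+ 2.
  have := tay (xi - x); have -> : x + (xi - x) = xi by ring.
  move=> h1; apply: (le_trans h1); apply: ler_wpM2l => //.
  rewrite -real_normK ?num_real// lerXn2r ?nnegrE//; first exact: ltW.
  by rewrite ler_norml; lra.
have tn : `|n%:R * (F xi - F x - f0 * (xi - x))| <= n%:R * (M * h ^+ 2).
  by rewrite normrM (gtr0_norm nr) ler_wpM2l// ltW.
move: close tn; rewrite Fx !ler_norml => /andP[c1 c2] /andP[t1 t2].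
apply/andP; split; lra.
Qed.

(** * Decay of the coefficients *)

Section Coefficients.
Context (R : realType) (c : nat -> R) (rho : R).
Hypothesis hc : cvgn [normed series c].
Hypothesis hrho : 0 < rho < 2^-1.
Hypothesis htail :
  (fun i : nat => \big[+%R/0%R]_(i <= k <oo) (c k ^+ 2) : R) =O_\oo
  (fun i : nat => i%:R `^ (- (2 / rho)) * (ln i%:R) ^- 3 : R).

Let S : R := limn (series (fun n => `|c n|)).

Let series_le n : series (fun n => `|c n|) n <= S.
Proof.
apply: nondecreasing_cvgn_le => //.
by apply: nondecreasing_series => k _ _.
Qed.

Lemma sqr_tail_le i m : \sum_(i <= k < m) c k ^+ 2 <= \big[+%R/0%R]_(i <= k <oo) (c k ^+ 2).
Proof.
apply: (@nondecreasing_cvgn_le _ (fun m => \sum_(i <= k < m) c k ^+ 2)).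
  by apply: nondecreasing_series => k _ _; exact: sqr_ge0.
apply: nondecreasing_is_cvgn.
  by apply: nondecreasing_series => k _ _; exact: sqr_ge0.
(* Every [|c k|] is at most [S], so squares are at most [S * |c k|]. *)
exists (S * S) => _ [n _ <-].
have S0 : 0 <= S by apply: le_trans (series_le 0); rewrite /series/= big_geq.
have cS k : `|c k| <= S.
  apply: le_trans (series_le k.+1); rewrite /series/= big_nat_recr//= lerDr.
  exact: sumr_ge0.
apply: (@le_trans _ _ (\sum_(i <= k < n) S * `|c k|)).
  by apply: ler_sum => k _; rewrite -real_normK ?num_real// expr2 ler_wpM2r.
rewrite -mulr_sumr ler_wpM2l//; apply: le_trans (series_le n); rewrite /series/=.
have [ni|/ltnW iN] := leqP n i; first by rewrite big_geq// sumr_ge0.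
by rewrite (@big_cat_nat _ _ _ i 0 n)//= lerDr sumr_ge0.
Qed.

(** rho < 1/2 gives 2 / rho > 4, and the logarithmic factor is at most 1 from 4 on. *)
Lemma sqr_tail_rate : exists C i0, 0 <= C /\ forall i m, (i0 <= i)%N ->
  \sum_(i <= k < m) c k ^+ 2 <= C * (i%:R ^+ 4)^-1.
Proof.
have /eqOP/bigO_exP[C C0 [i0 _ h]] := htail.
exists C, (i0 + 4)%N; split; first exact: ltW.
move=> i m ii.
have i4 : (4 <= i)%N by apply: leq_trans ii; exact: leq_addl.
have i1 : 1 <= i%:R :> R by rewrite ler1n (leq_trans _ i4).
apply: (le_trans (sqr_tail_le i m)); apply: (le_trans (ler_norm _)).
apply: (le_trans (h i (leq_trans (leq_addr _ _) ii))).
apply: ler_wpM2l; first exact: ltW.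
have l1 := ln_ge1 R i4.
have e1 : i%:R `^ (- (2 / rho)) <= (i%:R ^+ 4)^-1 :> R.
  rewrite -powR_mulrn ?ler0n// -powRN; apply: ler_powR => //.
  move: hrho => /andP[r0 r2]; rewrite lerN2 ler_pdivlMr//; lra.
have e2 : (ln i%:R) ^- 3 <= 1 :> R by rewrite invf_le1 ?exprn_ege1// exprn_gt0//; lra.
have e3 : 0 <= (ln i%:R) ^- 3 :> R by rewrite invr_ge0 exprn_ge0//; lra.
rewrite ger0_norm; last by rewrite mulr_ge0// powR_ge0.
by rewrite -[leRHS]mulr1 ler_pM ?powR_ge0.
Qed.

(* AM-GM, [2 |c k| <= 32^j (c k)^2 + 32^-j], on each block [4^j <= k < 4^(j+1)]. *)
Lemma coefficient_tail : exists (r : nat -> R) (B : R),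
  (forall K m, \sum_(l < m) `|c (K + l)%N| <= r K) /\
  (forall n : nat, r (4 ^ n)%N <= B * 8^-1 ^+ n).
Proof.
have [C [i0 [C0 hC]]] := sqr_tail_rate.
pose s := series (fun n => `|c n|).
have snd i j : (i <= j)%N -> s i <= s j.
  by apply: (nondecreasing_series (P := xpredT)) => k _ _.
(* [C + 3] comes from the geometric sum of the blocks; [S * 8 ^+ i0] takes care of the [n] with 4^n
   < i0, for which n <= i0. *)
exists (fun K => S - s K), ((C + 3) + S * 8 ^+ i0); split.
  move=> K m.
  have E : s (K + m)%N = s K + \sum_(l < m) `|c (K + l)%N|.
    rewrite /s /series/= (@big_cat_nat _ _ _ K 0 (K + m)) ?leq_addr//=; congr (_ + _).
    have := big_addn 0 (K + m)%N K xpredT (fun k => `|c k|); rewrite add0n addKn => ->.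
    by rewrite big_mkord; apply: eq_bigr => i _; rewrite addnC.
  by have := series_le (K + m); rewrite -/s E /s; lra.
have S0 : 0 <= S by apply: le_trans (series_le 0); rewrite /series/= big_geq.
have e0 n : 0 <= (8^-1 : R) ^+ n by rewrite exprn_ge0// invr_ge0.
have block j : (i0 <= 4 ^ j)%N -> s (4 ^ j.+1)%N - s (4 ^ j)%N <= (C + 3) / 2 * 8^-1 ^+ j.
  move=> ij; rewrite /s /series/= (@big_cat_nat _ _ _ (4 ^ j) 0 (4 ^ j.+1)) ?leq_exp2l//= addrAC subrr add0r.
  (* This weight makes both halves of order 8^-j: the squares give (4^j)^-4 * 32^j, and there are 3
     * 4^j terms 32^-j. *)
  pose z : R := 32 ^+ j.
  have z0 : 0 < z by rewrite exprn_gt0.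
  apply: (@le_trans _ _ (\sum_(4 ^ j <= k < 4 ^ j.+1) (c k ^+ 2 * z / 2 + z^-1 / 2))).
    apply: ler_sum => k _.
    have : 0 <= (`|c k| * z - 1) ^+ 2 / z by rewrite divr_ge0 ?sqr_ge0// ltW.
    have -> : (`|c k| * z - 1) ^+ 2 / z = `|c k| ^+ 2 * z - 2 * `|c k| + z^-1.
      by field; rewrite gt_eqF.
    by rewrite real_normK ?num_real//; lra.
  rewrite big_split/= -!mulr_suml sumr_const_nat.
  have h1 : (\sum_(4 ^ j <= k < 4 ^ j.+1) c k ^+ 2) * z <= C * 8^-1 ^+ j.
    apply: (le_trans (ler_wpM2r (ltW z0) (hC (4 ^ j)%N (4 ^ j.+1)%N ij))).
    rewrite -mulrA ler_wpM2l// natrX /z -exprM mulnC exprM -exprVn -exprMn.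
    by rewrite lerXn2r ?nnegrE//; lra.
  have h2 : z^-1 *+ (4 ^ j.+1 - 4 ^ j) <= 3 * 8^-1 ^+ j.
    have -> : z^-1 *+ (4 ^ j.+1 - 4 ^ j) = (4 ^ j.+1 - 4 ^ j)%N%:R * z^-1 by rewrite mulr_natl.
    rewrite natrB ?leq_exp2l// !natrX exprS /z.
    have -> : (4 * 4 ^+ j - 4 ^+ j) * (32 ^+ j)^-1 = 3 * (4 / 32) ^+ j :> R.
      by rewrite exprMn exprVn; ring.
    by rewrite ler_wpM2l// lerXn2r ?nnegrE//; lra.
  lra.
have blocks n k : (i0 <= 4 ^ n)%N -> s (4 ^ (n + k))%N - s (4 ^ n)%N <= (C + 3) * 8^-1 ^+ n.
  move=> inn.
  suff : s (4 ^ (n + k))%N - s (4 ^ n)%N <= (C + 3) * 8^-1 ^+ n - (C + 3) * 8^-1 ^+ (n + k).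
    have : 0 <= (C + 3) * 8^-1 ^+ (n + k) by apply: mulr_ge0 => //; exact: addr_ge0.
    by lra.
  elim: k => [|k IH]; first by rewrite addn0 !subrr.
  have := block (n + k)%N (leq_trans inn (leq_pexp2l _ (leq_addr _ _))) => /(_ isT).
  rewrite addnS [8^-1 ^+ (n + k).+1]exprS.
  have : 0 <= (C + 3) * 8^-1 ^+ (n + k) by apply: mulr_ge0 => //; exact: addr_ge0.
  lra.
move=> n; rewrite mulrDl.
have [inn|nin] := leqP i0 (4 ^ n).
  rewrite ler_wpDr ?mulr_ge0 ?exprn_ge0//.
  rewrite lerBlDr; apply: limr_le => //; apply: nearW => K.
  have Kn : (K <= 4 ^ (n + K))%N by apply: ltnW; apply: (leq_ltn_trans (leq_addl n K)); exact: ltn_expl.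
  by have := blocks n K inn; have := snd _ _ Kn; rewrite /s; lra.
have ni : (n <= i0)%N by apply: ltnW; apply: ltn_trans nin; exact: ltn_expl.
rewrite ler_wpDl ?mulr_ge0 ?addr_ge0//.
apply: (@le_trans _ _ S).
  by rewrite gerBl; apply: sumr_ge0.
rewrite -mulrA ler_peMr// exprVn ler_pdivlMr ?exprn_gt0// mul1r ler_weXn2l//.
by rewrite ler1n.
Qed.

End Coefficients.

(** * Moments of the innovations *)

Section Moments.
Context (R : realType) (d : measure_display) (T : measurableType d)
  (P : probability T R) (Y : {RV P >-> R}) (alpha : R).
Hypothesis halpha : 2 <= alpha.
Hypothesis hmoment : ('E_P[(fun w => `|Y w| `^ alpha)%R] < +oo)%E.

Let mu := distribution P Y.

Let sqr_le (e : R) : `|e| ^+ 2 <= 1 + `|e| `^ alpha.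
Proof.
have [e1|/ltW e1] := leP `|e| 1.
  apply: (@le_trans _ _ 1); first by rewrite expr_le1.
  by rewrite lerDl powR_ge0.
apply: (@le_trans _ _ (`|e| `^ alpha)); last by rewrite lerDr.
by rewrite -powR_mulrn//; exact: ler_powR.
Qed.

Let pow_measurable : measurable_fun [set: R] (fun e : R => `|e| `^ alpha).
Proof. by apply: (measurableT_comp (measurable_powR alpha)); exact: normr_measurable. Qed.

Let pow_integrable : mu.-integrable setT (EFin \o (fun e : R => 1 + `|e| `^ alpha)).
Proof.
have I : mu.-integrable setT (EFin \o (fun e : R => `|e| `^ alpha)).
  apply/integrableP; split; first exact/measurable_EFinP.
  under eq_integral do rewrite /= ger0_norm ?powR_ge0//.
  rewrite ge0_integral_distribution//; first by move: hmoment; rewrite unlock.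
  exact/measurable_EFinP.
exact: eq_integrable (integrableD measurableT (integrable_prob_cst (P := mu) 1) I).
Qed.

Lemma first_moment : mu.-integrable setT (EFin \o (fun e : R => e)).
Proof.
apply: le_integrable pow_integrable => //; first exact/measurable_EFinP.
move=> e _; rewrite lee_fin [leRHS]ger0_norm; last by rewrite addr_ge0// powR_ge0.
by have := sqr_le e; have := sqr_ge0 (`|e| - 1); rewrite sqrrB1; have := normr_ge0 e; have := powR_ge0 `|e| alpha; nra.
Qed.

Lemma second_moment (m : R) : 0 <= m ->
  mu.-integrable setT (EFin \o (fun e : R => (`|e| + m) ^+ 2)).
Proof.
move=> m0.
have I : mu.-integrable setT (EFin \o (fun e : R => (2 + 2 * m ^+ 2) * (1 + `|e| `^ alpha))).
  exact: eq_integrable (integrableZl measurableT (2 + 2 * m ^+ 2) pow_integrable).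
apply: le_integrable I => //.
  by apply/measurable_EFinP; apply: measurable_funX; apply: measurable_funD.
move=> e _; rewrite lee_fin (ger0_norm (sqr_ge0 _)); apply: le_trans (ler_norm _).
have := sqr_le e; have := sqr_ge0 (`|e| - m); have := powR_ge0 `|e| alpha.
have := sqr_ge0 m; rewrite !expr2; nra.
Qed.

End Moments.

(** * The quantile function *)

Section Quantile.
Context (R : realType) (d : measure_display) (T : measurableType d)
  (P : probability T R) (X : {RV P >-> R}) (F : R -> R).
Hypothesis hF : forall x : R, (F x)%:E = cdf X x.
Hypothesis hFc : continuous F.

Lemma cdf_nd : {homo F : x y / x <= y}.
Proof. by move=> x y xy; rewrite -lee_fin !hF; exact: cdf_nondecreasing. Qed.

Lemma cdf_small e : 0 < e -> exists2 x, F x < e & 0 <= F x.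
Proof.
move=> e0; have := cvg_cdfNy0 X.
rewrite (_ : cdf X = EFin \o F); last by apply/funext => x; rewrite /= hF.
move=> /fine_cvgP[_] /cvgrPdist_lt/(_ _ e0)[M [_ hM]].
exists (M - 1).
  have := hM (M - 1) _; rewrite /= sub0r normrN => h; apply: le_lt_trans (ler_norm _) _.
  by apply: h; rewrite ltrBlDr ltrDl.
by rewrite -lee_fin hF cdf_ge0.
Qed.

Lemma cdf_large e : 0 < e -> exists x, 1 - e < F x.
Proof.
move=> e0; have := cvg_cdfy1 X.
rewrite (_ : cdf X = EFin \o F); last by apply/funext => x; rewrite /= hF.
move=> /fine_cvgP[_] /cvgrPdist_lt/(_ _ e0)[M [_ hM]].
exists (M + 1).
have := hM (M + 1) _; rewrite /= => /(_ (ltr_pwDr ltr01 (lexx M))) h.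
by have := le_lt_trans (ler_norm _) h; lra.
Qed.

(** A continuous distribution function takes the value [y] at the infimum: a larger value there
    would persist slightly to the left, a smaller one slightly to the right. *)
Lemma cdf_quantile y : 0 < y < 1 -> F (quantile F y) = y.
Proof.
move=> /andP[y0 y1]; rewrite /quantile; set A := [set x | y <= F x].
have [xl xly _] := cdf_small y0.
have [xu xuy] : exists x, 1 - (1 - y) < F x by apply: cdf_large; lra.
have hA : has_inf A.
  split; first by exists xu; rewrite /A/=; lra.
  exists xl => z; rewrite /A/= => yz; rewrite leNgt; apply/negP => /ltW /cdf_nd; lra.
have /cvgrPdist_lt c0 := hFc (x := inf A).
apply/eqP; rewrite eq_le; apply/andP; split; rewrite leNgt; apply/negP => h.
- have e0 : 0 < F (inf A) - y by lra.
  have /nbhs_ballP[del /= del0 hdel] := c0 _ e0.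
  have := hdel (inf A - del / 2); rewrite /ball/= opprB addrC subrK gtr0_norm; last by rewrite divr_gt0.
  move=> /(_ ltac:(lra)) h2; have := le_lt_trans (ler_norm _) h2 => h3.
  have : inf A <= inf A - del / 2 by apply: ge_inf; [exact: hA.2|rewrite /A/=; lra].
  by lra.
- have e0 : 0 < y - F (inf A) by lra.
  have /nbhs_ballP[del /= del0 hdel] := c0 _ e0.
  have [z zA zi] := inf_adherent del0 hA.
  have iz : inf A <= z by apply: ge_inf => //; exact: hA.2.
  have := hdel z; rewrite /ball/= ler0_norm ?subr_le0// => /(_ ltac:(lra)) h2.
  have := le_lt_trans (ler_norm (F z - F (inf A))) _; rewrite distrC => /(_ _ h2).
  by move: zA; rewrite /A/=; lra.
Qed.

End Quantile.

(** Were all coefficients zero, [X] would vanish almost surely, whereas a law with a density gives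
    no mass to a point. *)
Lemma coefficients_nonzero (R : realType) (d : measure_display) (T : measurableType d)
    (P : probability T R) (c : nat -> R) (Z : nat -> T -> R) (X : {RV P >-> R}) (f : R -> R) :
  {ae P, forall w, series (fun k => c k * Z k w) @ \oo --> X w} ->
  has_density X f -> exists k, c k != 0.
Proof.
move=> cX [mf f0 fE]; apply/not_existsP => c0.
have c00 k : c k = 0 by apply/eqP/negPn/negP; exact: c0.
have X0 : {ae P, forall w, X w = 0}.
  apply: filterS cX => w cw; apply/esym/(cvg_unique _ _ cw) => //.
  rewrite (_ : series _ = cst 0); first exact: cvg_cst.
  apply/funext => n; rewrite /series/= big1// => k _; by rewrite c00 mul0r.
have m0 : measurable (X @^-1` [set 0]) by rewrite -[X in measurable X]setTI; exact: measurable_funPT.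
have P0 : P (X @^-1` [set 0]) = 0.
  by have := fE [set 0] (measurable_set1 _); rewrite integral_set1.
have P1 : P (~` (X @^-1` [set 0])) = 0.
  by apply/negligibleP; [exact: measurableC|apply: negligibleS X0 => w /=].
by have := probability_setC P m0; rewrite P1 P0 sube0 => /eqP; rewrite eq_sym onee_eq0.
Qed.

(** * Comparison of the rates in p and in n *)

Section Rate.
Context (R : realType).

Definition bahadur_rate (n : nat) : R :=
  n%:R `^ (- 4^-1) * (ln n%:R) `^ (2^-1) * (ln (ln n%:R)) `^ (4^-1).

Lemma powR14 (x : R) : 0 <= x -> x `^ (4^-1) = Num.sqrt (Num.sqrt x).
Proof.
move=> x0; have -> : (4^-1 : R) = 2^-1 * 2^-1 by lra.
by rewrite powRrM powR12_sqrt// powR12_sqrt// sqrtr_ge0.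
Qed.

Lemma modulus_rate_le (p n : nat) : (4 <= p)%N -> (32 ^ p <= n < 32 ^ p.+1)%N ->
  0 < bahadur_rate n /\ modulus_rate R p / sqrt32 R ^+ p <= 3 * bahadur_rate n.
Proof.
move=> p4 /andP[pn np].
have n0 : 0 < n%:R :> R by rewrite ltr0n (leq_trans _ pn)// expn_gt0.
have p0 : 1 <= p%:R :> R by rewrite ler1n (leq_trans _ p4).
have q0 := sqrt32X_gt0 R p; have a1 := sqrt_ln_ge1 R p4; have as_ := sqrt_ln_sqr R p4.
have lnp : p%:R <= ln n%:R :> R.
  apply: (@le_trans _ _ (ln (32 ^ p)%N%:R)); last first.
    by rewrite ler_ln ?posrE ?n0 ?ler_nat// ltr0n expn_gt0.
  rewrite natrX lnXn// -[leLHS]mulr1 mulr_natl lerMn2r; apply/orP; right.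
  by rewrite -[32]/(32%:R); apply: ln_ge1.
have lnn0 : 0 < ln n%:R :> R by lra.
have llnp : sqrt_ln R p * sqrt_ln R p <= ln (ln n%:R).
  by rewrite as_ ler_ln ?posrE//; lra.
have ll0 : 0 < ln (ln n%:R) :> R by nra.
have r1 : Num.sqrt p%:R <= (ln n%:R) `^ (2^-1) :> R.
  by rewrite (powR12_sqrt (ltW lnn0)) ler_sqrt// ltW.
have r2 : Num.sqrt (sqrt_ln R p) <= (ln (ln n%:R)) `^ (4^-1) :> R.
  rewrite (powR14 (ltW ll0)) ler_sqrt ?sqrtr_ge0//.
  by rewrite -[leLHS]ger0_norm ?(le_trans ler01)// -sqrtr_sqr ler_sqrt ?expr2// ltW.
(* Origin of the constant 3: n < 32^(p + 1), and the fourth root of 32 is at most 3. *)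
have r3 : (3 * Num.sqrt (sqrt32 R ^+ p))^-1 <= n%:R `^ (- 4^-1) :> R.
  rewrite powRN lef_pV2 ?posrE ?mulr_gt0 ?powR_gt0 ?sqrtr_gt0// (powR14 (ltW n0)).
  have -> : 3 = Num.sqrt (3 ^+ 2) :> R by rewrite sqrtr_sqr ger0_norm.
  rewrite -sqrtrM ?sqr_ge0// ler_sqrt; last by rewrite mulr_ge0 ?sqr_ge0// ltW.
  have q9 : sqrt32 R <= 3 ^+ 2.
    rewrite -(@ler_pXn2r _ 2)// ?nnegrE ?(ltW (sqrt32_gt0 R)) ?sqr_ge0// sqr_sqrt32; lra.
  apply: (@le_trans _ _ (sqrt32 R * sqrt32 R ^+ p)); last by rewrite ler_wpM2r// ltW.
  rewrite -[leRHS]ger0_norm ?mulr_ge0 ?(ltW (sqrt32_gt0 R)) ?(ltW q0)// -sqrtr_sqr ler_sqrt ?sqr_ge0//.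
  rewrite -exprS expr2 sqrt32X_sqr ler_nat; exact: ltnW.
split.
  by rewrite /bahadur_rate !mulr_gt0// powR_gt0.
have s0 : 0 < Num.sqrt (sqrt32 R ^+ p) by rewrite sqrtr_gt0.
have ss : Num.sqrt (sqrt32 R ^+ p) * Num.sqrt (sqrt32 R ^+ p) = sqrt32 R ^+ p by rewrite -expr2 sqr_sqrtr// ltW.
have -> : modulus_rate R p / sqrt32 R ^+ p =
    3 * ((3 * Num.sqrt (sqrt32 R ^+ p))^-1 * Num.sqrt p%:R * Num.sqrt (sqrt_ln R p)).
  rewrite /modulus_rate sqrtrM ?ler0n// sqrtrM ?(ltW q0)// -[X in _ / X]ss; field.
  by rewrite gt_eqF.
rewrite ler_wpM2l// /bahadur_rate.
by apply: ler_pM => //; rewrite ?mulr_ge0 ?invr_ge0 ?mulr_ge0 ?sqrtr_ge0//; apply: ler_pM => //;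
  rewrite ?invr_ge0 ?mulr_ge0 ?sqrtr_ge0.
Qed.

End Rate.

Section RateScale.
Context (R : realType).

(** Of order (ln ln n / n)^(1/2), the scale at which the empirical quantile is localized. *)
Definition mesh (p : nat) : R := sqrt_ln R p / sqrt32 R ^+ p.

Lemma mesh_gt0 p : (4 <= p)%N -> 0 < mesh p.
Proof. by move=> p4; rewrite divr_gt0 ?sqrt32X_gt0// (lt_le_trans ltr01 (sqrt_ln_ge1 R p4)). Qed.

Lemma mesh_small (kap e : R) : 0 <= kap -> 0 < e ->
  exists p0, forall p, (p0 <= p)%N -> kap * mesh p <= e.
Proof.
move=> kap0 e0; have q0 := sqrt32_gt0 R.
have q1 : (sqrt32 R)^-1 < 1.
  by rewrite invf_lt1//; have := four_sqrt32_lt1 R; rewrite ltr_pdivrMr//; lra.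
have qi : 0 < (sqrt32 R)^-1 by rewrite invr_gt0.
have [p0 h] := natr_expr_small kap qi q1 e0.
exists (maxn 4 p0) => p; rewrite geq_max => /andP[p4 pp]; apply: le_trans (h p pp).
by rewrite ler_wpM2l// /mesh exprVn ler_wpM2r ?invr_ge0 ?(ltW (sqrt32X_gt0 R p))// sqrt_ln_le.
Qed.

(** The Taylor remainder, n times the square of [mesh], is of order ln p; this absorbs it into the
    modulus. *)
Lemma sqr_sqrt_ln_le_modulus p : (4 <= p)%N -> sqrt_ln R p * sqrt_ln R p <= modulus_rate R p.
Proof.
move=> p4; have a1 := sqrt_ln_ge1 R p4; have q1 := sqrt32X_gt0 R p.
have ap : sqrt_ln R p * sqrt_ln R p <= p%:R by rewrite sqrt_ln_sqr// ln_le_id.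
have aq : sqrt_ln R p <= sqrt32 R ^+ p.
  apply: (le_trans (sqrt_ln_le R p4)); apply: (@le_trans _ _ (2 ^+ p)).
    by rewrite -natrX ler_nat ltnW// ltn_expl.
  rewrite lerXn2r ?nnegrE ?(ltW (sqrt32_gt0 R))//.
  by have := four_sqrt32_lt1 R; rewrite ltr_pdivrMr ?sqrt32_gt0//; lra.
rewrite -[leLHS]ger0_norm; last by rewrite mulr_ge0; lra.
rewrite -sqrtr_sqr ler_sqrt; last by rewrite !mulr_ge0 ?ler0n//; lra.
have aa : sqrt_ln R p * sqrt_ln R p <= sqrt32 R ^+ p * sqrt_ln R p by rewrite ler_wpM2r//; lra.
by rewrite expr2; apply: ler_pM => //; rewrite mulr_ge0//; lra.
Qed.

End RateScale.

(** * The expansion along one path *)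

Section Pathwise.
Context (R : realType) (F f : R -> R) (a b M del A A2 : R) (L : nat).
Let Q := quantile F.
Hypothesis Fnd : {homo F : x y / x <= y}.
Hypothesis FQ : forall y, a < y < b -> F (Q y) = y.
Hypothesis ab : forall y, a < y < b -> 0 < y < 1.
Hypothesis del0 : 0 < del.
Hypothesis fdel : forall y, a < y < b -> del <= f (Q y).
Hypothesis M0 : 0 <= M.
Hypothesis lip : forall u v, `|F u - F v| <= M * `|u - v|.
Hypothesis taylor : forall y, a < y < b ->
  forall u, `|F (Q y + u) - F (Q y) - f (Q y) * u| <= M * u ^+ 2.
Hypothesis QL : forall y, a < y < b -> - L%:R + 1 <= Q y < L%:R - 1.
Hypothesis A0 : 0 < A.
Hypothesis A20 : 0 <= A2.

Let cn (x : nat -> R) (n : nat) (u : R) : R := (sample_count x n u)%:R.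
Let dev (x : nat -> R) (n : nat) (u : R) : R := cn x n u - n%:R * F u.

(* As [F (Q y + u) > y] for small [u > 0], [F v <= y] is equivalent to [v <= Q y]. *)
Lemma emp_dist_quantile x n y : a < y < b -> (0 < n)%N ->
  emp_dist (F \o x) n y = cn x n (Q y) / n%:R.
Proof.
move=> yab n0; rewrite /emp_dist /cn sample_countE mulrC; congr (_ * _).
apply: eq_bigr => i _ /=; congr ((nat_of_bool _)%:R).
apply/idP/idP => h; last by rewrite -[leRHS](FQ yab) Fnd.
rewrite leNgt; apply/negP => Qx.
pose v := Num.min (x i - Q y) (del / (2 * (M + 1))).
have v0 : 0 < v by rewrite lt_min subr_gt0 Qx divr_gt0// mulr_gt0// ltr_wpDl.
have v1 : v <= x i - Q y by rewrite ge_min lexx.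
have v2 : v * (2 * (M + 1)) <= del.
  by rewrite -ler_pdivlMr ?ge_min ?lexx ?orbT// mulr_gt0// ltr_wpDl.
have := taylor yab v; rewrite FQ// ler_norml => /andP[t _].
have : F (Q y + v) <= y by apply: (le_trans _ h); apply: Fnd; rewrite -lerBrDl.
have : f (Q y) * v >= del * v by rewrite ler_wpM2r ?fdel// ltW.
have : v * v * (2 * (M + 1)) <= v * del by rewrite -mulrA ler_wpM2l// ltW.
have : 0 < v * v by rewrite mulr_gt0.
have : 0 < v * del by rewrite mulr_gt0.
have : 0 <= M * (v * v) by rewrite mulr_ge0// mulr_ge0// ltW.
rewrite expr2 in t; nra.
Qed.

(** The terms match those of [bahadur_expansion]: two uses of the modulus, the jump at the empirical
    quantile, and the Taylor remainder with [h = 3 * A / del * mesh] and n <= 32 * 32^p, whence 288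
    = 9 * 32. *)
Let K := 2 * A2 + M + 288 * M * (A / del) ^+ 2.

Lemma bahadur_at_scale (x : nat -> R) (p n : nat) (y : R) : (4 <= p)%N ->
  (32 ^ p <= n < 32 ^ p.+1)%N ->
  3 * A / del * M * mesh R p <= del / 2 -> 3 * A / del * mesh R p <= 2^-1 ->
  (forall u, - L%:R <= u < L%:R -> `|dev x n u| <= A * (sqrt_ln R p * sqrt32 R ^+ p)) ->
  (forall u v, - L%:R <= u < L%:R -> - L%:R <= v < L%:R -> u <= v ->
     v - u <= (3 * A / del + 1) * mesh R p ->
     `|dev x n v - dev x n u| <= A2 * modulus_rate R p) ->
  a < y < b ->
  `|f (Q y) * quantile_process Q x n y - uniform_emp_process F x n y| <=
    3 * K * bahadur_rate R n.
Proof.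
move=> p4 pn hM h2 EA EB yab.
have n0 : (0 < n)%N by move: pn => /andP[pn _]; rewrite (leq_trans _ pn)// expn_gt0.
have nr : 0 < n%:R :> R by rewrite ltr0n.
have m0 := mesh_gt0 R p4; have q0 := sqrt32X_gt0 R p; have q1 := sqrt32X_ge1 R p.
have a1 := sqrt_ln_ge1 R p4; have qq := sqrt32X_sqr R p.
have r0 : 0 <= 3 * A / del by rewrite divr_ge0 ?mulr_ge0// ltW.
have nq : sqrt32 R ^+ p * sqrt32 R ^+ p <= n%:R by rewrite qq ler_nat; case/andP: pn.
have nq2 : n%:R <= 32 * (sqrt32 R ^+ p * sqrt32 R ^+ p).
  by rewrite qq -natrM ler_nat -expnS; case/andP: pn => _ /ltnW.
have ni : n%:R^-1 <= mesh R p.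
  rewrite /mesh ler_pdivlMr// ler_pdivrMl//.
  have : sqrt32 R ^+ p <= sqrt32 R ^+ p * sqrt32 R ^+ p by nra.
  nra.
have n2 : n%:R^-1 <= 2^-1 :> R.
  rewrite lef_pV2 ?posrE// (le_trans _ nq)// qq ler_nat.
  by rewrite (@leq_trans (2 ^ p))// ?leq_exp2r ?(leq_trans _ p4)// (@leq_trans 4)// (leq_trans p4)// ltnW// ltn_expl.
have [c1 c2] := emp_quantile_count x n0 (ab yab).
have /andP[Q1 Q2] := QL yab.
have := @bahadur_expansion R n (cn x n) F (Q y) y (emp_quantile x n y) (f (Q y)) del M
  (A * mesh R p) (A2 * modulus_rate R p) L%:R ((3 * A / del + 1) * mesh R p)
  (3 * A / del * mesh R p) n0.
have cnd : {homo cn x n : u v / u <= v}.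
  move=> u v uv; rewrite ler_nat; apply: sub_count => z /=; by move=> h; apply: le_trans h uv.
have hE : 3 * A / del * mesh R p = 3 * (A * mesh R p) / del by ring.
move=> /(_ cnd (FQ yab) del0 (fdel yab) M0 (mulr_gt0 A0 m0) lip (taylor yab) hE).
have l1 : 3 * A / del * mesh R p <= (3 * A / del + 1) * mesh R p by nra.
have l2 : n%:R^-1 <= (3 * A / del + 1) * mesh R p by apply: (le_trans ni); nra.
have hM' : M * (3 * A / del * mesh R p) <= del / 2 by move: hM; rewrite mulrA [M * _]mulrC.
have EA' u : - L%:R <= u < L%:R -> `|cn x n u - n%:R * F u| <= n%:R * (A * mesh R p).
  move=> uL; apply: (le_trans (EA u uL)); rewrite [leRHS]mulrCA (ler_wpM2l (ltW A0))// /mesh.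
  rewrite [leRHS]mulrCA ler_wpM2l ?(le_trans ler01 a1)//.
  by rewrite ler_pdivlMr.
move=> /(_ hM' l1 l2 ltac:(lra) ltac:(lra) EA' EB c1 c2) => D.
have mm := sqr_sqrt_ln_le_modulus R p4.
have D' : `|n%:R * f (Q y) * (Q y - emp_quantile x n y) - (cn x n (Q y) - n%:R * y)| <=
    K * modulus_rate R p.
  have -> : K * modulus_rate R p = 2 * (A2 * modulus_rate R p) + M * modulus_rate R p +
      M * (288 * (A / del) ^+ 2 * modulus_rate R p) by rewrite /K; ring.
  apply: (le_trans D); apply: lerD; first apply: lerD => //.
    by rewrite ler_peMr//; apply: le_trans mm; nra.
  rewrite [leLHS]mulrCA ler_wpM2l//.
  have -> : n%:R * (3 * A / del * mesh R p) ^+ 2 = 9 * (A / del) ^+ 2 * (n%:R * mesh R p ^+ 2) by ring.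
  have nm : n%:R * mesh R p ^+ 2 <= 32 * modulus_rate R p.
    apply: (@le_trans _ _ (32 * (sqrt_ln R p * sqrt_ln R p))); last by rewrite ler_wpM2l.
    apply: (@le_trans _ _ (32 * (sqrt32 R ^+ p * sqrt32 R ^+ p) * mesh R p ^+ 2)).
      by rewrite ler_wpM2r// sqr_ge0.
    have -> : 32 * (sqrt32 R ^+ p * sqrt32 R ^+ p) * mesh R p ^+ 2 = 32 * (sqrt_ln R p * sqrt_ln R p) => //.
    by rewrite /mesh; field; rewrite gt_eqF.
  have := ler_wpM2l (mulr_ge0 (ler0n R 9) (sqr_ge0 (A / del))) nm.
  by move=> h; apply: (le_trans h); rewrite le_eqVlt; apply/orP; left; apply/eqP; ring.
have [rate0 mr] := modulus_rate_le R p4 pn.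
have s0 : 0 < Num.sqrt n%:R :> R by rewrite sqrtr_gt0.
have ss : Num.sqrt n%:R * Num.sqrt n%:R = n%:R :> R by rewrite -expr2 sqr_sqrtr// ltW.
have sq : sqrt32 R ^+ p <= Num.sqrt n%:R.
  by rewrite -[leLHS]ger0_norm ?(ltW q0)// -sqrtr_sqr ler_sqrt ?(ltW nr)// expr2.
have K0 : 0 <= K.
  rewrite /K; apply: addr_ge0; first by apply: addr_ge0 => //; apply: mulr_ge0.
  by apply: mulr_ge0; [exact: mulr_ge0 (ler0n R 288) M0|exact: sqr_ge0].
have -> : f (Q y) * quantile_process Q x n y - uniform_emp_process F x n y =
  (n%:R * f (Q y) * (Q y - emp_quantile x n y) - (cn x n (Q y) - n%:R * y)) / Num.sqrt n%:R.
  rewrite /quantile_process /uniform_emp_process (emp_dist_quantile x yab n0).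
  move: (Num.sqrt n%:R) s0 ss => s s0 <-; field.
  by rewrite gt_eqF.
rewrite normrM normfV (gtr0_norm s0) ler_pdivrMr//.
apply: (le_trans D'); rewrite [3 * K]mulrC -mulrA -mulrA ler_wpM2l//.
have := mr; rewrite ler_pdivrMr// => h; apply: (le_trans h).
by rewrite mulrA ler_wpM2l// mulr_ge0// ltW.
Qed.

Lemma bahadur_pathwise (x : nat -> R) :
  (exists p0, forall p, (p0 <= p)%N -> forall n u, (n <= 32 * 32 ^ p)%N ->
     - L%:R <= u < L%:R -> `|dev x n u| <= A * (sqrt_ln R p * sqrt32 R ^+ p)) ->
  (exists p0, forall p, (p0 <= p)%N -> forall n u v, (n <= 32 * 32 ^ p)%N ->
     - L%:R <= u < L%:R -> - L%:R <= v < L%:R -> u <= v ->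
     v - u <= (3 * A / del + 1) * mesh R p ->
     `|dev x n v - dev x n u| <= A2 * modulus_rate R p) ->
  exists C n0, forall n, (n0 <= n)%N -> 0 < bahadur_rate R n /\ forall y, a < y < b ->
  `|f (Q y) * quantile_process Q x n y - uniform_emp_process F x n y| <=
    C * bahadur_rate R n.
Proof.
move=> [p1 EA] [p2 EB].
have r0 : 0 <= 3 * A / del by rewrite divr_ge0 ?mulr_ge0// ltW.
have [p3 h3] : exists p0, forall p, (p0 <= p)%N -> 3 * A / del * M * mesh R p <= del / 2.
  by apply: mesh_small; [exact: mulr_ge0|exact: divr_gt0].
have [p4 h4] : exists p0, forall p, (p0 <= p)%N -> 3 * A / del * mesh R p <= 2^-1.
  by apply: mesh_small => //; rewrite invr_gt0.
exists (3 * K), (32 ^ (4 + p1 + p2 + p3 + p4))%N => n nn.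
have n0 : (0 < n)%N by rewrite (leq_trans _ nn)// expn_gt0.
have pn := trunc_log_bounds (isT : (1 < 32)%N) n0.
have pp : (4 + p1 + p2 + p3 + p4 <= trunc_log 32 n)%N by exact: trunc_log_max.
move: (trunc_log 32 n) pp pn => p pp.
have [p5 p1p p2p p3p p4p] : [/\ 4 <= p, p1 <= p, p2 <= p, p3 <= p & p4 <= p]%N by split; lia.
move=> pn; have np : (n <= 32 * 32 ^ p)%N by rewrite -expnS; case/andP: pn => _ /ltnW.
split; first exact: (modulus_rate_le R p5 pn).1.
move=> y yab; apply: (@bahadur_at_scale x p n y p5 pn) => //.
- exact: h3.
- exact: h4.
- by move=> u uL; exact: (EA p p1p n u np uL).
- by move=> u v uL vL uv d; exact: (EB p p2p n u v np uL vL uv d).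
Qed.

End Pathwise.

Lemma O_as_eventually (R : realType) (d : measure_display) (T : measurableType d)
    (P : probability T R) (Z : nat -> T -> \bar R) (r : nat -> R) :
  {ae P, forall w, exists C n0, forall n, (n0 <= n)%N ->
     0 < r n /\ (0 <= Z n w <= (C * r n)%:E)%E} ->
  O_as P Z r.
Proof.
apply: filterS => w [C [n0 h]].
apply: (@le_lt_trans _ _ C%:E); last exact: ltry.
apply: ge_ereal_inf; exists (ereal_sup [set (`|Z n w| * ((r n)^-1)%:E)%E | n in [set n | (n0 <= n)%N]]).
  by exists [set n | (n0 <= n)%N] => //; exists n0.
apply: ge_ereal_sup => _ [n /= /h [r0 /andP[Z0 ZC]] <-].
rewrite gee0_abs//; apply: (@le_trans _ _ ((C * r n)%:E * ((r n)^-1)%:E)%E).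
  by rewrite lee_wpmul2r// lee_fin invr_ge0 ltW.
by rewrite -EFinM mulfK// gt_eqF.
Qed.

Section QuantileRange.
Context (R : realType) (d : measure_display) (T : measurableType d)
  (P : probability T R) (X : {RV P >-> R}) (F f : R -> R) (a b M del : R).
Hypothesis hF : forall x : R, (F x)%:E = cdf X x.
Hypothesis FQ : forall y, a < y < b -> F (quantile F y) = y.
Hypothesis del0 : 0 < del.
Hypothesis fdel : forall y, a < y < b -> del <= f (quantile F y).
Hypothesis M0 : 0 <= M.
Hypothesis taylor : forall y, a < y < b ->
  forall u, `|F (quantile F y + u) - F (quantile F y) - f (quantile F y) * u| <= M * u ^+ 2.

(* A lower bound on [f (Q y)] and the Taylor bound keep [y] away from 0 and 1. *)
Lemma quantile_range : exists L : nat, forall y, a < y < b ->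
  - L%:R + 1 <= quantile F y < L%:R - 1.
Proof.
pose h := del / (2 * (M + 1)).
have h0 : 0 < h by rewrite divr_gt0// mulr_gt0// ltr_wpDl.
have hM : h * (2 * (M + 1)) = del by rewrite divfK// gt_eqF// mulr_gt0// ltr_wpDl.
have kap0 : 0 < h * h by rewrite mulr_gt0.
have [xl xlk _] := cdf_small hF kap0.
have [xu xuk] := cdf_large hF kap0.
have F01 x : 0 <= F x <= 1 by rewrite -!lee_fin hF cdf_ge0 cdf_le1.
pose L := Num.bound (`|xl| + `|xu| + 1).
have LB : `|xl| + `|xu| + 1 < L%:R by apply: archi_boundP; rewrite !addr_ge0.
exists L => y yab; have y0 := FQ yab; have yd := fdel yab.
have hf : del * h <= f (quantile F y) * h by rewrite ler_wpM2r// ltW.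
have dh : del * h = 2 * M * (h * h) + 2 * (h * h) by rewrite -hM; ring.
have Mh : 0 <= M * (h * h) by rewrite mulr_ge0// ltW.
have yl : h * h <= y.
  have /andP[Fl _] := F01 (quantile F y - h).
  have := taylor yab (- h); rewrite sqrrN expr2 ler_norml y0 => /andP[_ t]; lra.
have yu : y <= 1 - h * h.
  have /andP[_ Fu] := F01 (quantile F y + h).
  have := taylor yab h; rewrite expr2 ler_norml y0 => /andP[t _]; lra.
have ql : xl <= quantile F y.
  by rewrite leNgt; apply/negP => /ltW /(cdf_nd hF); lra.
have qu : quantile F y <= xu.
  by rewrite leNgt; apply/negP => /ltW /(cdf_nd hF); lra.
have := ler_norm xu; have := ler_norm (- xl); rewrite normrN.
have := normr_ge0 xl; have := normr_ge0 xu; lra.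
Qed.

End QuantileRange.

Lemma density_bounds (R : realType) (f : R -> R) :
  (forall x, 0 <= f x) ->
  (forall x : R, derivable f x 1) ->
  (ereal_sup [set (f x + `|derive1 f x| + `|derive1 (derive1 f) x|)%R%:E | x in [set: R]] < +oo)%E ->
  exists M, (forall x, f x <= M) /\ (forall x y, `|f x - f y| <= M * `|x - y|).
Proof.
move=> f0 df; set S := ereal_sup _ => Soo.
have Sx x : ((f x + `|derive1 f x| + `|derive1 (derive1 f) x|)%R%:E <= S)%E.
  by apply: ereal_sup_ubound; exists x.
have Sf : S \is a fin_num.
  by rewrite fin_numElt Soo (lt_le_trans _ (Sx 0)) ?ltNyr.
have Sr x : f x + `|derive1 f x| + `|derive1 (derive1 f) x| <= fine S.
  by rewrite -lee_fin fineK.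
exists (fine S); split=> [x|].
  by have := Sr x; have := normr_ge0 (derive1 f x); have := normr_ge0 (derive1 (derive1 f) x); lra.
apply: (@lipschitz_of_derivative _ f (derive1 f)) => x.
  by rewrite derive1E; apply: derivableP.
by have := Sr x; have := f0 x; have := normr_ge0 (derive1 (derive1 f) x); lra.
Qed.

Lemma positive_lower_bound (R : realType) (f : R -> R) (A : set R) : A !=set0 ->
  (0 < ereal_inf [set (f x)%:E | x in A])%E -> exists2 del, 0 < del & forall x, A x -> del <= f x.
Proof.
move=> [x0 Ax0]; set S := ereal_inf _ => S0.
have Sx x : A x -> (S <= (f x)%:E)%E by move=> Ax; apply: ereal_inf_lbound; exists x.
have Sf : S \is a fin_num.
  by rewrite fin_numElt (lt_trans _ S0) ?ltNyr// (le_lt_trans (Sx _ Ax0))// ltry.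
exists (fine S); first by rewrite -lte_fin fineK.
by move=> x Ax; rewrite -lee_fin fineK// Sx.
Qed.

Lemma first_nonzero (R : realType) (c : nat -> R) : (exists k, c k != 0) ->
  exists2 k0, c k0 != 0 & forall k, (k < k0)%N -> c k = 0.
Proof.
move=> ex; case: (ex_minnP ex) => k0 ck0 h; exists k0 => // k kk.
by apply/eqP/negPn/negP => /h; rewrite leqNgt kk.
Qed.

Theorem theorem2p1 (R : realType) (d : measure_display) (T : measurableType d)
    (P : probability T R)
    (c : nat -> R) (eps : int -> {RV P >-> R}) (X : nat -> {RV P >-> R})
    (F f feps : R -> R) (alpha rho a b : R)
    (heps : iid eps)
    (hc : cvgn [normed series c])
    (hX : forall i : nat, {ae P, forall w,
       series (fun k : nat => c k * eps (i%:Z - k%:Z) w) @ \oo --> X i w})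
    (hF : forall x : R, (F x)%:E = cdf (X 1%N) x)
    (hFcont : continuous F)
    (hf : has_density (X 1%N) f)
    (halpha : 2 <= alpha)
    (hmoment : ('E_P[(fun w => `|eps 1%:Z w| `^ alpha)%R] < +oo)%E)
    (hrho : 0 < rho < 2^-1)
    (htail :
       (fun i : nat => \big[+%R/0%R]_(i <= k <oo) (c k ^+ 2) : R) =O_\oo
       (fun i : nat => i%:R `^ (- (2 / rho)) * (ln i%:R) ^- 3 : R))
    (hfeps : has_density (eps 1%:Z) feps)
    (hfeps1 : forall x : R, derivable feps x 1)
    (hfeps2 : forall x : R, derivable (derive1 feps) x 1)
    (hfeps_sup : (ereal_sup
       [set (feps x + `|derive1 feps x| + `|derive1 (derive1 feps) x|)%R%:E | x in [set: R]]
       < +oo)%E)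
    (hab : [/\ 0 <= a, a < b & b <= 1])
    (hf1 : forall y : R, a < y < b -> derivable f (quantile F y) 1)
    (hf1_sup : (ereal_sup
       [set (`|derive1 f (quantile F y)|)%R%:E | y in `]a, b[%classic] < +oo)%E)
    (hf_inf : (0 < ereal_inf
       [set (f (quantile F y))%:E | y in `]a, b[%classic])%E) :
  O_as P
    (fun n w => ereal_sup
       [set (`| f (quantile F y) * quantile_process (quantile F) (X ^~ w) n y
                - uniform_emp_process F (X ^~ w) n y |)%:E
       | y in `]a, b[%classic])
    (fun n => n%:R `^ (- 4^-1) * (ln n%:R) `^ (2^-1)
              * (ln (ln n%:R)) `^ (4^-1)).
Proof.
have [a0 ab b1] := hab.
have mid : a < (a + b) / 2 < b by lra.
have ab01 y : a < y < b -> 0 < y < 1 by lra.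
have FQ y : a < y < b -> F (quantile F y) = y by move=> /ab01; exact: cdf_quantile hF hFcont _.
have [k0 ck0n ck0] := first_nonzero (coefficients_nonzero (hX 1%N) hf).
have [mfe fe0 feE] := hfeps.
have [Mf [fM fl]] := density_bounds fe0 hfeps1 hfeps_sup.
have [M [g sG]] := first_dist_smooth ck0n mfe fe0 feE fM fl.
have M0 := smooth_cdf_ge0 sG.
have mu1 := first_moment halpha hmoment.
have m10 : 0 <= \int[distribution P (eps 1%:Z)]_e `|e| by exact: Rintegral_ge0.
have mu2 := second_moment halpha hmoment m10.
have [r [B [cr rB]]] := coefficient_tail hc hrho htail.
have hXall := ae_foralln hX.
have cvge : {ae P, forall w, forall i : nat,
    cvgn (series (fun l : nat => c l * eps (i%:Z - l%:Z) w))}.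
  by apply: filterS hXall => w h i; apply/cvg_ex; exists (X i w); exact: h.
have XE : {ae P, forall w, forall i : nat, X i w = ma_tail eps c i%:Z 0 w}.
  by apply: filterS hXall => w h i; rewrite (ma_tailE 0 (h i)) big_geq// subr0.
have X1E : {ae P, forall w, X 1%N w = ma_tail eps c 1%:Z 0 w} by apply: filterS XE => w /(_ 1%N).
have FE : F = marginal eps c.
  by apply/funext => x; apply: EFin_inj; rewrite hF -(marginal_cdf X1E).
have lip u v : `|F u - F v| <= M * `|u - v|.
  by rewrite FE; exact: (marginal_lipschitz heps mu1 cvge ck0 sG).
have taylor y : a < y < b ->
    forall u, `|F (quantile F y + u) - F (quantile F y) - f (quantile F y) * u| <= M * u ^+ 2.
  move=> yab u.
  (* Differentiability at the quantile gives the continuity under which the chosen version of the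
     density is the slope of [F]. *)
  have fc : {for quantile F y, continuous f}.
    by apply/differentiable_continuous/derivable1_diffP; exact: hf1.
  have := marginal_taylor heps mu1 cvge ck0 sG (quantile F y) u.
  by rewrite (marginal_slopeE heps mu1 cvge ck0 sG X1E hf fc) -FE.
have [del del0 fdel] : exists2 del, 0 < del & forall y, a < y < b -> del <= f (quantile F y).
  have [|del del0 h] := @positive_lower_bound _ (f \o quantile F) `]a, b[%classic _ hf_inf.
    by exists ((a + b) / 2); rewrite /= in_itv.
  by exists del => // y yab; apply: h; rewrite /= in_itv.
have [L QL] := quantile_range hF FQ del0 fdel M0 taylor.
have [A1 [A10 hA1]] := emp_dev_uniform heps mu1 mu2 cvge cr ck0 rB sG L.
(* [A1] may vanish, while the localization of the quantile requires a positive width. *)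
pose A := A1 + 1; have A0 : 0 < A by rewrite ltr_wpDl.
have b0 : 0 <= 3 * A / del + 1 by rewrite addr_ge0// divr_ge0 ?mulr_ge0// ltW.
have [A2 [A20 hA2]] := emp_dev_modulus heps mu1 mu2 cvge cr ck0 rB sG L b0.
apply: O_as_eventually.
have countE w n u : (forall i : nat, X i w = ma_tail eps c i%:Z 0 w) ->
    (sample_count (X ^~ w) n u)%:R - n%:R * F u = emp_dev eps c n u w.
  move=> Xw; rewrite emp_devE sample_countE -FE; congr (_ - _).
  by rewrite big_add1 big_mkord; apply: eq_bigr => i _; rewrite Xw.
apply: filterS3 XE hA1 hA2 => w Xw [p1 h1] [p2 h2].
have [||C [n0 h]] := @bahadur_pathwise R F f a b M del A A2 L (cdf_nd hF) FQ ab01 del0 fdel M0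
  lip taylor QL A0 A20 (X ^~ w).
- exists (maxn 4 p1) => p; rewrite geq_max => /andP[p4 pp] n u np uL; rewrite countE//.
  apply: (le_trans (h1 p pp n u np uL)); rewrite ler_wpM2r ?lerDl//.
  by rewrite mulr_ge0 ?(ltW (sqrt32X_gt0 R p))// (le_trans ler01 (sqrt_ln_ge1 R p4)).
- exists p2 => p pp n u v np uL vL uv uvd; rewrite !countE//.
  exact: h2.
exists C, n0 => n /h [rate0 hn]; split => //; apply/andP; split.
  (* The supremum is nonnegative because the midpoint belongs to the index set. *)
  apply: (@le_trans _ _ (`|f (quantile F ((a + b) / 2)) *
      quantile_process (quantile F) (X ^~ w) n ((a + b) / 2) -
      uniform_emp_process F (X ^~ w) n ((a + b) / 2)|)%:E); first by rewrite lee_fin.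
  by apply: ereal_sup_ubound; exists ((a + b) / 2) => //; rewrite /= in_itv.
apply: ge_ereal_sup => _ [y /=] yab <-; rewrite lee_fin; apply: hn.
by move: yab; rewrite in_itv.
Qed.
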